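(* Let $\mathcal{G}$ be the ladder graph. Then there exists a value $p_\mathcal{G}>2$ (depending on $\mathcal{G}$) such that $Z_{p,\mathcal{G}}\neq\emptyset$ for every $p\in[p_\mathcal{G},6)$.
   Context: The ladder graph is the $\mathbb{Z}$-periodic metric graph embedded in $\mathbb{R}^2$ with vertex set $\{(k,0),(k,1):k\in\mathbb{Z}\}$ and edges the segments $[k,k+1]\times\{0\}$, $[k,k+1]\times\{1\}$, $\{k\}\times[0,1]$ for $k\in\mathbb{Z}$, all of length 1. $H^1(\mathcal{G})$: continuous functions on $\mathcal{G}$, $H^1$ on each edge, with norms summed over edges. For $p>2$: $E_p(u,\mathcal{G})=\frac12\|u'\|_{2}^2-\frac1p\|u\|_{p}^p$; $H^1_\mu(\mathcal{G})=\{u\in H^1(\mathcal{G}):\|u\|_2^2=\mu\}$; $\mathcal{E}_{p,\mathcal{G}}(\mu)=\inf_{H^1_\mu(\mathcal{G})}E_p(\cdot,\mathcal{G})$; $\mathfrak{E}_{p,\mathcal{G}}(\mu)$ the set of minimizers; $\mathcal L_p(u,\mathcal{G})=(\|u\|_p^p-\|u'\|_2^2)/\|u\|_2^2$; $\Lambda^\mp_{p,\mathcal{G}}(\mu)=\inf/\sup$ of $\mathcal L_p(u,\mathcal{G})$ over $u\in\mathfrak{E}_{p,\mathcal{G}}(\mu)$; $Z_{p,\mathcal{G}}=\{\mu>0:\mathfrak{E}_{p,\mathcal{G}}(\mu)\neq\emptyset,\ \Lambda^-_{p,\mathcal{G}}(\mu)\neq\Lambda^+_{p,\mathcal{G}}(\mu)\}$.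 *)

(* Defs.v *)
From HB Require Import structures.
From mathcomp Require Import all_boot all_order all_algebra.
From mathcomp Require Import all_classical all_reals all_analysis.

Set Implicit Arguments.
Unset Strict Implicit.
Unset Printing Implicit Defensive.

Import Order.TTheory GRing.Theory Num.Theory.
Import numFieldNormedType.Exports.
Local Open Scope classical_set_scope.
Local Open Scope ring_scope.

(* Edges of the ladder:
     (Bot, k)  = [k,k+1] x {0},  point at parameter t in [0,1] is (k+t, 0)
     (Top, k)  = [k,k+1] x {1},  point at parameter t is (k+t, 1)
     (Vert, k) = {k} x [0,1],    point at parameter t is (k, t)
   All edges have length 1. *)
Inductive ekind := Bot | Top | Vert.

Definition ekind_to_nat (x : ekind) : nat :=
  match x with Bot => 0 | Top => 1 | Vert => 2 end.
Definition nat_to_ekind (n : nat) : option ekind :=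
  match n with 0 => Some Bot | 1 => Some Top | 2 => Some Vert | _ => None end.
Lemma ekind_pcan : pcancel ekind_to_nat nat_to_ekind.
Proof. by case. Qed.
HB.instance Definition _ := Countable.copy ekind (pcan_type ekind_pcan).

Definition edge := (ekind * int)%type.

Section Ladder.
Variable R : realType.

(* A function on the ladder graph: its restriction to each edge,
   parametrized by t in [0,1] (values outside [0,1] are irrelevant). *)
Definition gfun := edge -> R -> R.

Definition leb := (@lebesgue_measure R).

Definition I01 : set R := `[0%R, 1%R]%classic.
Definition I0x (x : R) : set R := `[0%R, x]%classic.

Definition ladder_continuous (u : gfun) : Prop :=
  forall k : int,
    [/\ u (Bot, k) 0 = u (Bot, k - 1) 1,
        u (Bot, k) 0 = u (Vert, k) 0,
        u (Top, k) 0 = u (Top, k - 1) 1 &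
        u (Top, k) 0 = u (Vert, k) 1].

(* f is (the absolutely continuous representative of) an H^1(0,1) function
   with weak derivative g *)
Definition edge_H1 (f g : R -> R) : Prop :=
  [/\ measurable_fun I01 g,
      leb.-integrable I01 (EFin \o g) &
      forall x : R, 0 <= x <= 1 ->
        (\int[leb]_(t in I0x x) (g t)%:E = (f x - f 0)%:E)%E].

Definition edge_int (h : R -> R) : \bar R :=
  (\int[leb]_(t in I01) (h t)%:E)%E.

Definition gsum (F : edge -> \bar R) : \bar R := \esum_(e in [set: edge]) F e.

Definition L2sq (u : gfun) : \bar R := gsum (fun e => edge_int (fun t => u e t ^+ 2)).
(* ||u'||_2^2, with u' given edgewise by g *)
Definition dirsq (g : gfun) : \bar R := gsum (fun e => edge_int (fun t => g e t ^+ 2)).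
Definition Lpp (p : R) (u : gfun) : \bar R :=
  gsum (fun e => edge_int (fun t => `|u e t| `^ p)).

Definition isH1 (u g : gfun) : Prop :=
  [/\ ladder_continuous u, (forall e, edge_H1 (u e) (g e)) &
      (L2sq u + dirsq g < +oo)%E].

(* E_p(u,G) = 1/2 ||u'||_2^2 - 1/p ||u||_p^p  (all quantities finite for u in H^1) *)
Definition Energy (p : R) (u g : gfun) : R :=
  2^-1 * fine (dirsq g) - p^-1 * fine (Lpp p u).

Definition Lfun (p : R) (u g : gfun) : R :=
  (fine (Lpp p u) - fine (dirsq g)) / fine (L2sq u).

Definition Emin (p mu : R) : \bar R :=
  ereal_inf [set x | exists u g, [/\ isH1 u g, L2sq u = mu%:E & x = (Energy p u g)%:E]].

Definition is_minimizer (p mu : R) (u g : gfun) : Prop :=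
  [/\ isH1 u g, L2sq u = mu%:E & (Energy p u g)%:E = Emin p mu].

Definition Lvals (p mu : R) : set (\bar R) :=
  [set x | exists u g, is_minimizer p mu u g /\ x = (Lfun p u g)%:E].

Definition Lambda_minus (p mu : R) : \bar R := ereal_inf (Lvals p mu).
Definition Lambda_plus (p mu : R) : \bar R := ereal_sup (Lvals p mu).

Definition Zset (p : R) : set R :=
  [set mu | [/\ 0 < mu, (exists u g, is_minimizer p mu u g) &
                Lambda_minus p mu <> Lambda_plus p mu]].

End Ladder.

(* Main.v *)
(* Fix d > 0 small. For p close to 6 and mass m <= 81/25 no function with
   Dirichlet energy exactly d has nonpositive energy: by a pointwise bound
   exploiting that the two rails are strongly coupled at low Dirichlet energy,
   the potential term is too small. On the other hand the ground state level is
   negative for every mass (test with wide tents, p < 6), near-minimizers of small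
   mass have Dirichlet energy below d, and near-minimizers of mass 81/25 have
   Dirichlet energy above d (test with a bump on one edge). Let m be the supremum
   of the masses whose near-minimizers can be taken with Dirichlet energy <= d.
   By scaling, there are at mass m minimizing sequences on both sides of d.
   Since the level is negative, minimizing sequences are compact up to
   translation, so two minimizers exist, with Dirichlet energies on either side
   of d and different from d. At fixed mass and energy the multiplier L_p is a
   strictly increasing affine function of the Dirichlet energy, hence
   Lambda^- < Lambda^+ at m. *)

(* At p = 6 the Dirichlet and potential terms respond alike to a change of width, so the mass
   decides the sign of the energy. With the bump used here, a function concentrated on one edge has
   negative energy as soon as its mass exceeds about 3.12. A function of low Dirichlet energy D
   takes nearly equal values on both rails, and its decay is shared by four half-rails; its
   potential term is then at most about mass^2 D / 4, which keeps the energy positive up to mass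
   sqrt 12, about 3.46. The mass 81 / 25 = 3.24 lies in this window. Once d is fixed, replacing 6 by
   p >= 6 - 1 / 4000 costs only a factor close to 1 in both estimates.

   The obstacle is the noncompact graph, with discrete translations only. Strict subadditivity of
   the level is quantified by the potential term, which a negative level bounds from below; cuts on
   either side of a median cell then exclude vanishing and splitting at once. Young's inequality
   with a free weight serves in place of Hölder's inequality. *)
Require Import Defs.
From mathcomp Require Import all_boot all_order all_algebra.
From mathcomp Require Import all_classical all_reals all_analysis.
From mathcomp Require Import measurable_realfun ring lra zify.
Set Implicit Arguments.
Unset Strict Implicit.
Unset Printing Implicit Defensive.
Import Order.TTheory GRing.Theory Num.Theory.
Import numFieldNormedType.Exports.
Local Open Scope classical_set_scope.
Local Open Scope ring_scope.

(** * Functions on one edge *)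

Section RealIntegrable.
Context d (T : measurableType d) (R : realType).
Variables (m : {measure set T -> \bar R}) (D : set T).
Hypothesis mD : measurable D.
Implicit Types f g : T -> R.

Lemma rintegrableD f g :
  m.-integrable D (EFin \o f) -> m.-integrable D (EFin \o g) ->
  m.-integrable D (EFin \o (fun t => f t + g t)).
Proof. by move=> h1 h2; exact: (integrableD mD h1 h2). Qed.

Lemma rintegrableB f g :
  m.-integrable D (EFin \o f) -> m.-integrable D (EFin \o g) ->
  m.-integrable D (EFin \o (fun t => f t - g t)).
Proof. by move=> h1 h2; exact: (integrableB mD h1 h2). Qed.

Lemma rintegrableZ (r : R) f :
  m.-integrable D (EFin \o f) ->
  m.-integrable D (EFin \o (fun t => r * f t)).
Proof. by move=> h1; exact: (integrableZl mD r h1). Qed.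

Lemma rintegrableM f g : measurable_fun D f -> [bounded f t | t in D] ->
  m.-integrable D (EFin \o g) -> m.-integrable D (EFin \o (fun t => f t * g t)).
Proof. by move=> mf bf ig; exact: (integrableMr mD mf bf ig). Qed.

End RealIntegrable.

Section Edge.
Variable R : realType.
Local Notation mu := (@lebesgue_measure R).
Local Notation I := (@I01 R).
Implicit Types (f g h : R -> R) (x y s t : R).

Lemma mI01 : measurable I.
Proof. exact: measurable_itv. Qed.
Hint Resolve mI01 : core.

Lemma muI01 : mu I = 1%E.
Proof. by rewrite /I01 lebesgue_measure_itv/= lte_fin ltr01 oppr0 adde0. Qed.

Lemma inI01 x : I x <-> 0 <= x <= 1.
Proof. by rewrite /I01/= in_itv. Qed.

Lemma sub_itv_I01 x y : 0 <= x -> y <= 1 -> `[x, y]%classic `<=` I.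
Proof.
move=> x0 y1 t; rewrite /I01/= !in_itv/= => /andP[xt ty].
by rewrite (le_trans x0 xt) (le_trans ty).
Qed.

Lemma integrable_sub_itv h x y : 0 <= x -> y <= 1 ->
  mu.-integrable I (EFin \o h) -> mu.-integrable `[x, y] (EFin \o h).
Proof.
move=> x0 y1; apply: integrableS; [exact: mI01|exact: measurable_itv|].
exact: sub_itv_I01.
Qed.

Lemma Rintegral_itv_diff h x y : mu.-integrable I (EFin \o h) ->
  0 <= x -> x <= y -> y <= 1 ->
  \int[mu]_(t in `[0, y]) h t - \int[mu]_(t in `[0, x]) h t =
  \int[mu]_(t in `[x, y]) h t.
Proof.
move=> ih x0 xy y1; rewrite -(@Rintegral_itv_obnd_cbnd _ x); last first.
  apply: integrableS (integrable_sub_itv x0 y1 ih) => //.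
  by apply: subset_itvr; rewrite bnd_simp.
by rewrite Rintegral_itvB ?bnd_simp//; exact: integrable_sub_itv.
Qed.

Lemma edge_H1_Rint f g x : edge_H1 f g -> 0 <= x <= 1 ->
  f x - f 0 = \int[mu]_(t in `[0, x]) g t.
Proof. by move=> [_ _ ftc] /ftc e; rewrite /Rintegral -/(I0x x) e. Qed.

Lemma edge_incr f g x y : edge_H1 f g -> 0 <= x -> x <= y -> y <= 1 ->
  f y - f x = \int[mu]_(t in `[x, y]) g t.
Proof.
move=> h x0 xy y1.
have -> : f y - f x = (f y - f 0) - (f x - f 0) by ring.
rewrite !(edge_H1_Rint h) ?x0 ?y1 ?(le_trans x0) ?(le_trans xy)//.
by rewrite Rintegral_itv_diff//; case: h.
Qed.

(** [edge_H1] asks only for an integrable derivative. The square-integrability is a global condition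
    in [isH1]; this is its form on one edge. *)
Definition edge2 f g :=
  edge_H1 f g /\ (edge_int (fun t => g t ^+ 2)%R < +oo)%E.

Lemma integrable_sqr g : measurable_fun I g ->
  (edge_int (fun t => g t ^+ 2)%R < +oo)%E ->
  mu.-integrable I (EFin \o (fun t => g t ^+ 2)).
Proof.
move=> mg fin; apply/integrableP; split.
  by apply/measurable_EFinP; exact: measurable_funX.
apply: le_lt_trans fin; rewrite /edge_int le_eqVlt; apply/orP; left; apply/eqP.
by apply: eq_integral => t _; rewrite /= ger0_norm ?sqr_ge0.
Qed.

Lemma edge2_sqr f g : edge2 f g ->
  mu.-integrable I (EFin \o (fun t => g t ^+ 2)).
Proof. by move=> [[mg _ _] fin]; exact: integrable_sqr. Qed.

Lemma Rintegral_cst_itv x y r : x <= y -> \int[mu]_(t in `[x, y]) r = r * (y - x).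
Proof.
move=> xy; rewrite Rintegral_cst; last exact: measurable_itv.
rewrite [X in fine X](lebesgue_measure_itv `[x, y])/= lte_fin.
by move: xy; rewrite le_eqVlt => /predU1P[->|->//]; rewrite ltxx/= subrr.
Qed.

Lemma integrable_cst_itv x y r : mu.-integrable `[x, y] (EFin \o (fun=> r)).
Proof.
apply: measurable_bounded_integrable => //=.
- by rewrite [X in (X < _)%E](lebesgue_measure_itv `[x, y])/=; case: ifP => // _; rewrite -EFinB ltry.
- by exists `|r|; split => [|M /ltW + t _]; rewrite ?num_real.
Qed.

Lemma le_subset_Rintegral h x y : 0 <= x -> y <= 1 ->
  mu.-integrable I (EFin \o h) -> (forall t, 0 <= h t) ->
  \int[mu]_(t in `[x, y]) h t <= \int[mu]_(t in I) h t.
Proof.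
move=> x0 y1 ih h0; rewrite /Rintegral fine_le//.
- by apply: integrable_fin_num => //; exact: integrable_sub_itv.
- by apply: integrable_fin_num.
- apply: ge0_subset_integral => //; first by move/integrableP : ih => [].
  + by move=> t _; rewrite lee_fin.
  + exact: sub_itv_I01.
Qed.

(** Pointwise Young inequality under the integral; the weight s stays free so that it can be
    optimised afterwards. *)
Lemma edge_osc f g x y s : edge2 f g -> 0 <= x -> x <= y -> y <= 1 -> 0 < s ->
  `|f y - f x| <= 2^-1 * (s * (y - x) + s^-1 * \int[mu]_(t in I) g t ^+ 2).
Proof.
move=> h x0 xy y1 s0; have ig2 := edge2_sqr h; have [h1 _] := h.
have ig : mu.-integrable I (EFin \o g) by case: h1.
rewrite (edge_incr h1)//.
apply: (le_trans (le_normr_Rintegral _ _)) => //; first exact: integrable_sub_itv.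
apply: (@le_trans _ _ (\int[mu]_(t in `[x, y]) (2^-1 * s + (2^-1 * s^-1) * g t ^+ 2))).
  apply: le_Rintegral => //.
  - by apply/integrable_norm/integrable_sub_itv.
  - apply: rintegrableD => //; first exact: integrable_cst_itv.
    by apply: rintegrableZ => //; exact: integrable_sub_itv.
  - move=> t _; have : 0 <= (s - `|g t|) ^+ 2 by exact: sqr_ge0.
    rewrite -[g t ^+ 2]real_normK ?num_real//; set a := `|g t| => hh.
    have -> : 2^-1 * s + 2^-1 / s * a ^+ 2 = a + (s - a) ^+ 2 / (2 * s).
      by field; rewrite gt_eqF.
    by rewrite lerDl divr_ge0// mulr_ge0// ltW.
rewrite RintegralD//; last 2 first.
  - exact: integrable_cst_itv.
  - by apply: rintegrableZ => //; exact: integrable_sub_itv.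
rewrite Rintegral_cst_itv// RintegralZl//; last exact: integrable_sub_itv.
rewrite -!mulrA -mulrDr ler_pM2l ?invr_gt0// lerD2l ler_pM2l ?invr_gt0//.
by apply: le_subset_Rintegral => // t; exact: sqr_ge0.
Qed.

Lemma edge_osc_sqr f g x y : edge2 f g -> 0 <= x -> x <= y -> y <= 1 ->
  (f y - f x) ^+ 2 <= (y - x) * \int[mu]_(t in I) g t ^+ 2.
Proof.
move=> h x0 xy y1; rewrite -real_normK ?num_real//.
have osc := edge_osc h x0 xy y1.
move: (`|f y - f x|) (normr_ge0 (f y - f x)) osc => a.
have : 0 <= \int[mu]_(t in I) g t ^+ 2 by apply: Rintegral_ge0 => t _; exact: sqr_ge0.
have : 0 <= y - x by rewrite subr_ge0.
move: (y - x) (Rintegral _ _ _) => l D l0 D0.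
rewrite le_eqVlt => /predU1P[<- _|a0 osc]; first by rewrite expr0n/= mulr_ge0.
move: l0; rewrite le_eqVlt => /predU1P[l0|l0].
  (* On an interval of length 0 a large weight leaves less than a / 2 on the right, contradicting a
     > 0. *)
  have /osc : 0 < (D + 1) / a by rewrite divr_gt0// ltr_wpDl.
  rewrite -l0 mulr0 add0r invf_div mulrAC => h1.
  have : 2^-1 * (a * D / (D + 1)) <= 2^-1 * a.
    rewrite ler_pM2l ?invr_gt0// ler_pdivrMr ?ltr_wpDl// ler_pM2l//.
    by rewrite lerDl.
  move=> h2; lra.
(* The optimal weight: the bound becomes a <= (a + l D / a) / 2. *)
have /osc : 0 < a / l by rewrite divr_gt0.
rewrite divfK ?gt_eqF// invf_div => h1.
have h2 : a <= l * D / a by rewrite mulrAC; lra.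
by rewrite expr2 -ler_pdivlMr.
Qed.

Lemma edge_H1_measurable f g : edge_H1 f g -> measurable_fun I f.
Proof.
move=> h; have [_ ig _] := h.
have c := @parameterized_integral_continuous R 0 1 g ler01 ig.
have mc := @subspace_continuous_measurable_fun R I _ mI01 c.
apply: (@eq_measurable_fun _ _ _ _ _ (fun x => parameterized_integral mu 0 x g + f 0)).
  by move=> x /set_mem /inI01 x01; rewrite /parameterized_integral/= -(edge_H1_Rint h)// subrK.
by apply: measurable_funD => //; exact: measurable_cst.
Qed.

Lemma edge2_bounded f g : edge2 f g -> [bounded f t | t in I].
Proof.
move=> h; exists (`|f 0| + (1 + \int[mu]_(t in I) g t ^+ 2)).
split; first exact: num_real.
move=> M hM t /inI01 /andP[t0 t1] /=; apply: le_trans (ltW hM).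
have -> : f t = f 0 + (f t - f 0) by ring.
apply: (le_trans (ler_normD _ _)); rewrite lerD2l.
apply: (le_trans (edge_osc h (lexx 0) t0 t1 ltr01)).
have : 0 <= \int[mu]_(t in I) g t ^+ 2 by apply: Rintegral_ge0 => *; exact: sqr_ge0.
rewrite subr0 invr1 !mul1r; move: (Rintegral _ _ _) => D; lra.
Qed.

(** Telescoping over a fine partition bounds the total increment by e times the increment of G, for
    every e > 0. This replaces differentiation almost everywhere in the product rule. *)
Lemma increment_domination (Phi G : R -> R) x : 0 <= x ->
  (forall e, 0 < e -> exists n, forall i, (i < n.+1)%N ->
     `|Phi (x * i.+1%:R / n.+1%:R) - Phi (x * i%:R / n.+1%:R)| <=
     e * (G (x * i.+1%:R / n.+1%:R) - G (x * i%:R / n.+1%:R))) ->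
  Phi x = Phi 0.
Proof.
move=> x0 H; apply/eqP; rewrite -subr_eq0 -normr_le0; apply/ler_addgt0Pr => e e0.
have G1 : 0 < `|G x - G 0| + 1 by rewrite ltr_wpDl.
have [n Hn] := H (e / (`|G x - G 0| + 1)) (divr_gt0 e0 G1).
have tel (F : R -> R) : F x - F 0 =
    \sum_(0 <= i < n.+1) (F (x * i.+1%:R / n.+1%:R) - F (x * i%:R / n.+1%:R)).
  rewrite (telescope_sumr (fun i => F (x * i%:R / n.+1%:R)))//.
  by rewrite mulfK ?pnatr_eq0// mulr0 mul0r.
rewrite add0r (tel Phi); apply: (le_trans (ler_norm_sum _ _ _)).
apply: (@le_trans _ _ (\sum_(0 <= i < n.+1) e / (`|G x - G 0| + 1) *
    (G (x * i.+1%:R / n.+1%:R) - G (x * i%:R / n.+1%:R)))).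
  by rewrite !big_mkord; apply: ler_sum => i _; exact: Hn.
rewrite -mulr_sumr -tel mulrAC ler_pdivrMr// ler_pM2l//.
by rewrite (le_trans (ler_norm _))// lerDl.
Qed.

(** On a short interval [a, b] the increment of f1 f2 is f1 b times that of f2 plus f2 a times that
    of f1. Its defect from the integral of the claimed derivative is at most the oscillation of f1
    and f2 there times the integral of |g1| + |g2|, so [increment_domination] applies. *)
Lemma edge2_mul f1 g1 f2 g2 : edge2 f1 g1 -> edge2 f2 g2 ->
  edge_H1 (fun t => f1 t * f2 t) (fun t => f1 t * g2 t + f2 t * g1 t).
Proof.
move=> h1 h2; have [e1 _] := h1; have [e2 _] := h2.
have [mg1 ig1 _] := e1; have [mg2 ig2 _] := e2.
have mf1 := edge_H1_measurable e1; have mf2 := edge_H1_measurable e2.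
have i12 : mu.-integrable I (EFin \o (fun t => f1 t * g2 t)).
  by apply: rintegrableM => //; exact: edge2_bounded h1.
have i21 : mu.-integrable I (EFin \o (fun t => f2 t * g1 t)).
  by apply: rintegrableM => //; exact: edge2_bounded h2.
set k := (fun t => f1 t * g2 t + f2 t * g1 t).
have ik : mu.-integrable I (EFin \o k) by exact: rintegrableD.
split => //.
  by apply: measurable_funD; apply: measurable_funM.
move=> x /andP[x0 x1].
pose Phi z := f1 z * f2 z - \int[mu]_(t in `[0, z]) k t.
pose G z := \int[mu]_(t in `[0, z]) (`|g1 t| + `|g2 t|).
have iG : mu.-integrable I (EFin \o (fun t => `|g1 t| + `|g2 t|)).
  by apply: rintegrableD => //; exact: integrable_norm.
suff : Phi x = Phi 0.
  rewrite /Phi set_itv1 Rintegral_set1 subr0 => /eqP.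
  rewrite subr_eq addrC -subr_eq => /eqP ->.
  rewrite /Rintegral fineK//; apply: integrable_fin_num => //.
  exact: integrable_sub_itv.
apply: (increment_domination (G := G)) => // e e0.
pose D := \int[mu]_(t in I) g1 t ^+ 2 + \int[mu]_(t in I) g2 t ^+ 2.
have D0 : 0 <= D by rewrite addr_ge0//; apply: Rintegral_ge0 => *; exact: sqr_ge0.
(* By [edge_osc_sqr], cells of length at most e ^ 2 / D make both oscillations at most e. *)
exists (Num.truncn (D / e ^+ 2)) => i ilt; set n := Num.truncn _ in ilt *.
have nD : D / n.+1%:R <= e ^+ 2.
  rewrite ler_pdivrMr ?ltr0n// mulrC -ler_pdivrMr ?exprn_gt0//.
  by rewrite ltW// truncnS_gt.
set a := x * i%:R / _; set b := x * i.+1%:R / _.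
have a0 : 0 <= a by rewrite divr_ge0// mulr_ge0.
have ab : a <= b by rewrite ler_pM2r ?invr_gt0 ?ltr0n// ler_wpM2l// ler_nat.
have b1 : b <= 1.
  rewrite ler_pdivrMr ?ltr0n// mul1r (@le_trans _ _ (1 * i.+1%:R))//.
    by rewrite ler_wpM2r.
  by rewrite mul1r ler_nat.
have ba : b - a <= n.+1%:R^-1.
  rewrite -mulrBl -mulrBr -natrB// subSnn mulr1.
  by rewrite ler_piMl// invr_ge0.
have osc f g y z : edge2 f g -> \int[mu]_(t in I) g t ^+ 2 <= D ->
    a <= y -> y <= z -> z <= b -> `|f z - f y| <= e.
  move=> h gD ay yz zb; rewrite -(@ler_pXn2r _ 2)// ?nnegrE ?(ltW e0)// real_normK ?num_real//.
  apply: le_trans (edge_osc_sqr h (le_trans a0 ay) yz (le_trans zb b1)) _.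
  apply: le_trans nD; rewrite mulrC ler_pM//.
  - by apply: Rintegral_ge0 => *; exact: sqr_ge0.
  - by rewrite subr_ge0.
  - by apply: le_trans ba; rewrite lerB.
have gD1 : \int[mu]_(t in I) g1 t ^+ 2 <= D.
  by rewrite lerDl; apply: Rintegral_ge0 => *; exact: sqr_ge0.
have gD2 : \int[mu]_(t in I) g2 t ^+ 2 <= D.
  by rewrite lerDr; apply: Rintegral_ge0 => *; exact: sqr_ge0.
rewrite /G Rintegral_itv_diff//.
have -> : Phi b - Phi a =
    \int[mu]_(t in `[a, b]) ((f1 b * g2 t + f2 a * g1 t) - k t).
  rewrite RintegralB//; last 2 first.
    by apply: integrable_sub_itv => //; apply: rintegrableD => //; exact: rintegrableZ.
    exact: integrable_sub_itv.
  rewrite RintegralD//; last 2 first.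
    by apply: integrable_sub_itv => //; exact: rintegrableZ.
    by apply: integrable_sub_itv => //; exact: rintegrableZ.
  rewrite !RintegralZl//; try exact: integrable_sub_itv.
  rewrite -(edge_incr e1)// -(edge_incr e2)// -Rintegral_itv_diff//.
  by rewrite /Phi; ring.
apply: (le_trans (le_normr_Rintegral _ _)) => //.
  apply: integrable_sub_itv => //; apply: rintegrableB => //.
  by apply: rintegrableD => //; exact: rintegrableZ.
rewrite -RintegralZl//; last exact: integrable_sub_itv.
apply: le_Rintegral => //.
- apply: integrable_sub_itv => //; apply: integrable_norm; apply: rintegrableB => //.
  by apply: rintegrableD => //; exact: rintegrableZ.
- by apply: integrable_sub_itv => //; exact: rintegrableZ.
- move=> t; rewrite /= in_itv/= => /andP[ta tb].
  have -> : f1 b * g2 t + f2 a * g1 t - k t =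
    (f1 b - f1 t) * g2 t + - (f2 t - f2 a) * g1 t by rewrite /k; ring.
  apply: le_trans (ler_normD _ _) _; rewrite !normrM normrN mulrDr addrC.
  rewrite lerD// ler_wpM2r//; first exact: (osc f2 g2).
  exact: (osc f1 g1).
Qed.

Lemma edge2_sqr_integrable f g : edge2 f g ->
  mu.-integrable I (EFin \o (fun t => f t ^+ 2)).
Proof.
move=> h; have mf := edge_H1_measurable h.1.
apply: measurable_bounded_integrable => //.
- by rewrite [X in (X < _)%E]muI01 ltry.
- exact: measurable_funX.
- have [M [Mr hM]] := edge2_bounded h.
  exists (`|M| ^+ 2 + 2 * `|M| + 1); split; first exact: num_real.
  move=> r hr t It /=; rewrite normrX; apply: le_trans (ltW hr).
  have : `|f t| <= `|M| + 1 by apply: hM => //; rewrite (le_lt_trans (ler_norm _))// ltrDl.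
  have : 0 <= `|f t| by [].
  move: `|f t| `|M| => a b a0 ab.
  have : a ^+ 2 <= (b + 1) ^+ 2 by rewrite ler_pXn2r ?nnegrE// (le_trans a0).
  by rewrite sqrrD expr1n mulr1 -mulr_natl.
Qed.

Lemma integrable_young f g s : edge2 f g ->
  mu.-integrable I (EFin \o (fun t => s * f t ^+ 2 + s^-1 * g t ^+ 2)).
Proof.
move=> h; apply: rintegrableD => //; apply: rintegrableZ => //.
  exact: edge2_sqr_integrable h.
exact: edge2_sqr h.
Qed.

Lemma edge_sqr_diff f g x y s : edge2 f g -> 0 <= x <= 1 -> 0 <= y <= 1 -> 0 < s ->
  `|f y ^+ 2 - f x ^+ 2| <= \int[mu]_(t in I) (s * f t ^+ 2 + s^-1 * g t ^+ 2).
Proof.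
move=> h x01 y01 s0; wlog xy : x y x01 y01 / x <= y => [W|].
  by have [|/ltW] := leP x y; [|rewrite distrC]; exact: W.
move: x01 y01 => /andP[x0 x1] /andP[y0 y1].
have h2 := edge2_mul h h; rewrite !expr2 (edge_incr h2)//.
have [_ i2 _] := h2.
apply: le_trans (le_normr_Rintegral _ _) _ => //; first exact: integrable_sub_itv.
have iy := integrable_young s h.
apply: (@le_trans _ _ (\int[mu]_(t in `[x, y]) (s * f t ^+ 2 + s^-1 * g t ^+ 2))).
  apply: le_Rintegral => //.
  - by apply: integrable_norm; exact: integrable_sub_itv.
  - exact: integrable_sub_itv.
  - move=> t _; have s0' := ltW s0.
    rewrite -mulr2n -mulr_natl ler_norml; apply/andP; split; rewrite -subr_ge0 ?opprK.
      have -> : 2 * (f t * g t) + (s * f t ^+ 2 + s^-1 * g t ^+ 2) = s^-1 * (s * f t + g t) ^+ 2.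
        by field; rewrite gt_eqF.
      by rewrite mulr_ge0 ?invr_ge0// sqr_ge0.
    have -> : (s * f t ^+ 2 + s^-1 * g t ^+ 2) - 2 * (f t * g t) = s^-1 * (s * f t - g t) ^+ 2.
      by field; rewrite gt_eqF.
    by rewrite mulr_ge0 ?invr_ge0// sqr_ge0.
apply: le_subset_Rintegral => // t.
by rewrite addr_ge0// mulr_ge0 ?invr_ge0 ?sqr_ge0 ?(ltW s0).
Qed.

(** Compare f x ^ 2 with f t ^ 2 by [edge_sqr_diff] at s = 1 and average over t. *)
Lemma edge_sup f g x : edge2 f g -> 0 <= x <= 1 ->
  f x ^+ 2 <= 2 * \int[mu]_(t in I) f t ^+ 2 + \int[mu]_(t in I) g t ^+ 2.
Proof.
move=> h x01; have if2 := edge2_sqr_integrable h; have ig2 := edge2_sqr h.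
pose K := \int[mu]_(t in I) (1 * f t ^+ 2 + 1^-1 * g t ^+ 2).
have KE : K = \int[mu]_(t in I) f t ^+ 2 + \int[mu]_(t in I) g t ^+ 2.
  by rewrite -RintegralD//; apply: eq_Rintegral => t _; rewrite invr1 !mul1r.
have : \int[mu]_(t in I) f x ^+ 2 <= \int[mu]_(t in I) (f t ^+ 2 + K).
  apply: le_Rintegral => //.
  - exact: integrable_cst_itv.
  - by apply: rintegrableD => //; exact: integrable_cst_itv.
  - move=> t /inI01 t01; rewrite -lerBlDl (le_trans (ler_norm _))//.
    exact: (edge_sqr_diff h t01 x01 ltr01).
rewrite RintegralD//; last exact: integrable_cst_itv.
rewrite !Rintegral_cst_itv// subr0 !mulr1 KE.
by rewrite addrA -mulr2n mulr_natl.
Qed.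

End Edge.
#[global] Hint Extern 0 (measurable _) => exact: mI01 : core.

(** * Integration over the ladder *)

Section GraphIntegral.
Variable R : realType.
Local Notation mu := (@lebesgue_measure R).
Local Notation I := (@I01 R).
Implicit Types (F G u v g : gfun R) (c : R) (e : edge).

Definition gint F : \bar R := gsum (fun e => edge_int (F e)).

Definition gnn F := forall e, measurable_fun I (F e) /\
  forall t, 0 <= t <= 1 -> 0 <= F e t.

Definition gfin F := gnn F /\ (gint F < +oo)%E.

(** [fine] would send an infinite integral to 0, hence the [gfin] hypotheses of the comparisons
    below. *)
Definition gJ F : R := fine (gint F).

Definition gE F e : R := \int[mu]_(t in I) F e t.

Lemma edge_int_ge0 F e : gnn F -> (0 <= edge_int (F e))%E.
Proof.
move=> h; apply: integral_ge0 => t /inI01 t01; rewrite lee_fin.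
by have [_ ->] := h e.
Qed.

Lemma gint_ge0 F : gnn F -> (0 <= gint F)%E.
Proof. by move=> h; apply: esum_ge0 => e _; exact: edge_int_ge0. Qed.

Lemma gJ_ge0 F : gnn F -> 0 <= gJ F.
Proof. by move=> h; rewrite fine_ge0// gint_ge0. Qed.

Lemma gJE F : gfin F -> gint F = (gJ F)%:E.
Proof. by move=> [h hf]; rewrite fineK// ge0_fin_numE// gint_ge0. Qed.

Lemma measurable_EFin_edge F e : gnn F -> measurable_fun I (EFin \o F e).
Proof. by move=> h; apply/measurable_EFinP; have [] := h e. Qed.

Lemma gint_le F G : gnn F -> gnn G ->
  (forall e t, 0 <= t <= 1 -> F e t <= G e t) -> (gint F <= gint G)%E.
Proof.
move=> hF hG FG; apply: le_esum => e _; apply: ge0_le_integral => //.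
- by move=> t /inI01 t01; rewrite lee_fin; have [_ ->] := hF e.
- exact: measurable_EFin_edge.
- exact: measurable_EFin_edge.
- by move=> t /inI01 t01; rewrite lee_fin FG.
Qed.

Lemma gint_eq F G : (forall e t, 0 <= t <= 1 -> F e t = G e t) -> gint F = gint G.
Proof.
move=> FG; apply: eq_esum => e _; apply: eq_integral => t /set_mem /inI01 t01.
by rewrite FG.
Qed.

Lemma gJ_eq F G : (forall e t, 0 <= t <= 1 -> F e t = G e t) -> gJ F = gJ G.
Proof. by move=> FG; rewrite /gJ (gint_eq FG). Qed.

Lemma gnn_eq F G : (forall e t, 0 <= t <= 1 -> F e t = G e t) -> gnn F -> gnn G.
Proof.
move=> FG h e; have [m p] := h e; split; last by move=> t t01; rewrite -FG// p.
by apply: eq_measurable_fun m => t /set_mem /inI01 t01; rewrite FG.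
Qed.

Lemma gfin_eq F G : (forall e t, 0 <= t <= 1 -> F e t = G e t) -> gfin F -> gfin G.
Proof.
by move=> FG [h hf]; split; [exact: gnn_eq h|rewrite -(gint_eq FG)].
Qed.

Lemma gnn0 : gnn (fun _ _ => 0).
Proof. by move=> e; split => // _; exact: measurable_cst. Qed.

Lemma gnnD F G : gnn F -> gnn G -> gnn (fun e t => F e t + G e t).
Proof.
move=> hF hG e; have [mF pF] := hF e; have [mG pG] := hG e.
split; first exact: measurable_funD.
by move=> t t01; rewrite addr_ge0 ?pF ?pG.
Qed.

Lemma gnnZ c F : 0 <= c -> gnn F -> gnn (fun e t => c * F e t).
Proof.
move=> c0 hF e; have [mF pF] := hF e.
split; last by move=> t t01; rewrite mulr_ge0 ?pF.
by apply: measurable_funM => //; exact: measurable_cst.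
Qed.

Lemma gintD F G : gnn F -> gnn G ->
  gint (fun e t => F e t + G e t) = (gint F + gint G)%E.
Proof.
move=> hF hG; rewrite /gint /gsum -esumD; try by move=> *; exact: edge_int_ge0.
apply: eq_esum => e _; rewrite /edge_int -ge0_integralD//.
- by move=> t /inI01 t01; rewrite lee_fin; have [_ ->] := hF e.
- exact: measurable_EFin_edge.
- by move=> t /inI01 t01; rewrite lee_fin; have [_ ->] := hG e.
- exact: measurable_EFin_edge.
Qed.

Lemma gfinP F : gnn F -> (forall e, (edge_int (F e) < +oo)%E) ->
  forall e, edge_int (F e) = (gE F e)%:E.
Proof.
by move=> hF hf e; rewrite /gE /Rintegral fineK// ge0_fin_numE; [exact: hf|exact: edge_int_ge0].
Qed.

Lemma gfin_edge F e : gfin F -> (edge_int (F e) <= gint F)%E.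
Proof.
move=> [h _]; apply: esum_ge; exists [set e].
  by split => //; exact: finite_set1.
by rewrite fsbig_set1.
Qed.

Lemma gfin_edge_lty F e : gfin F -> (edge_int (F e) < +oo)%E.
Proof. by move=> h; apply: le_lt_trans (gfin_edge e h) _; case: h. Qed.

Lemma gfin_gE F e : gfin F -> edge_int (F e) = (gE F e)%:E.
Proof. by move=> h; apply: gfinP => [|e']; [case: h|exact: gfin_edge_lty]. Qed.

Lemma gfin_integrable F e : gfin F -> mu.-integrable I (EFin \o F e).
Proof.
move=> h; apply/integrableP; split; first by apply: measurable_EFin_edge; case: h.
apply: le_lt_trans (gfin_edge_lty e h); rewrite le_eqVlt; apply/orP; left.
apply/eqP; apply: eq_integral => t /set_mem /inI01 t01 /=.
by rewrite ger0_norm//; have [/(_ e)[_ ->]] := h.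
Qed.

Lemma gE_ge0 F e : gnn F -> 0 <= gE F e.
Proof. by move=> h; apply: Rintegral_ge0 => t /inI01; have [_] := h e; exact. Qed.

Lemma gsum_le_gJ F (s : seq edge) : gfin F -> uniq s ->
  \sum_(e <- s) gE F e <= gJ F.
Proof.
move=> h us; rewrite -lee_fin -gJE// -sumEFin.
apply: esum_ge; exists [set` s]; first by split => //; exact: finite_seq.
rewrite fsbig_finite ?finite_seq//=.
rewrite [X in (_ <= X)%E](perm_big s)/=.
  by apply: lee_sum => e _; rewrite gfin_gE.
apply: uniq_perm => // [|e]; first exact: finmap.fset_uniq.
rewrite in_fset_set; last exact: finite_seq.
by apply/idP/idP => [/set_mem//|/mem_set].
Qed.

Lemma gE_le_gJ F e : gfin F -> gE F e <= gJ F.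
Proof. by move=> h; have := gsum_le_gJ h (isT : uniq [:: e]); rewrite big_seq1. Qed.

(** With [gsum_le_gJ], this reduces statements on the sum over infinitely many edges to finite lists
    without repetition. *)
Lemma gint_le_fin F c : gnn F -> (forall e, (edge_int (F e) < +oo)%E) ->
  (forall s : seq edge, uniq s -> \sum_(e <- s) gE F e <= c) ->
  (gint F <= c%:E)%E.
Proof.
move=> h hf H; apply: ge_ereal_sup => _ [A [finA _] <-].
rewrite fsbig_finite//=; under eq_bigr do rewrite (gfinP h hf).
by rewrite sumEFin lee_fin; apply: H; exact: finmap.fset_uniq.
Qed.

Lemma gfinD F G : gfin F -> gfin G -> gfin (fun e t => F e t + G e t).
Proof.
move=> [hF fF] [hG fG]; split; first exact: gnnD.
by rewrite gintD// lte_add_pinfty.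
Qed.

Lemma gJD F G : gfin F -> gfin G ->
  gJ (fun e t => F e t + G e t) = gJ F + gJ G.
Proof.
move=> hF hG; rewrite {1}/gJ gintD; [|by case: hF|by case: hG].
by rewrite (gJE hF) (gJE hG).
Qed.

Lemma gintZ c F : 0 <= c -> gfin F -> gint (fun e t => c * F e t) = (c * gJ F)%:E.
Proof.
move=> c0 h; have [hF fF] := h.
have h1 e : edge_int (fun t => c * F e t) = (c * gE F e)%:E.
  rewrite EFinM -gfin_gE// /edge_int -integralZl//.
  exact: gfin_integrable.
have nnc := gnnZ c0 hF.
have fc e : (edge_int (fun t => (c * F e t)%R) < +oo)%E by rewrite h1 ltry.
have gEc e : gE (fun e t => c * F e t) e = c * gE F e.
  by apply: EFin_inj; rewrite -h1 -(gfinP nnc fc).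
have le1 : (gint (fun e t => c * F e t)%R <= (c * gJ F)%:E)%E.
  apply: gint_le_fin => // s us; under eq_bigr do rewrite gEc.
  by rewrite -mulr_sumr ler_wpM2l// gsum_le_gJ.
have fin' : gfin (fun e t => c * F e t).
  by split => //; apply: le_lt_trans le1 (ltry _).
apply/eqP; rewrite eq_le le1/=.
have [c00|cN0] := eqVneq c 0.
  by rewrite {1}c00 mul0r; apply: gint_ge0.
have {}c0 : 0 < c by rewrite lt_def cN0.
rewrite (gJE fin') lee_fin -ler_pdivlMl// -lee_fin -(gJE h).
apply: gint_le_fin => // [e|s us]; first exact: gfin_edge_lty.
rewrite ler_pdivlMl// mulr_sumr; under eq_bigr do rewrite -gEc.
exact: gsum_le_gJ.
Qed.

Lemma gfinZ c F : 0 <= c -> gfin F -> gfin (fun e t => c * F e t).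
Proof.
move=> c0 h; split; first by apply: gnnZ => //; case: h.
by rewrite gintZ// ltry.
Qed.

Lemma gJZ c F : 0 <= c -> gfin F -> gJ (fun e t => c * F e t) = c * gJ F.
Proof. by move=> c0 h; rewrite /gJ gintZ. Qed.

Lemma gfin_le F G : gnn F -> gfin G ->
  (forall e t, 0 <= t <= 1 -> F e t <= G e t) -> gfin F.
Proof.
move=> hF [hG fG] FG; split => //; exact: le_lt_trans (gint_le hF hG FG) fG.
Qed.

Lemma gJ_le F G : gnn F -> gfin G ->
  (forall e t, 0 <= t <= 1 -> F e t <= G e t) -> gJ F <= gJ G.
Proof.
move=> hF hG FG; rewrite -lee_fin -!gJE//; last exact: gfin_le hG FG.
by apply: gint_le => //; case: hG.
Qed.

Lemma gJ_le_fin F c : gnn F -> (forall e, (edge_int (F e) < +oo)%E) ->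
  (forall s : seq edge, uniq s -> \sum_(e <- s) gE F e <= c) ->
  gfin F /\ gJ F <= c.
Proof.
move=> h hf H; have le1 := gint_le_fin h hf H.
have fin' : gfin F by split => //; apply: le_lt_trans le1 (ltry _).
by split => //; rewrite -lee_fin -gJE.
Qed.

Lemma gnn_if (P : pred edge) F : gnn F ->
  gnn (fun e t => if P e then F e t else 0).
Proof. by move=> h e; case: (P e); [exact: h|exact: (gnn0 e)]. Qed.

Lemma gfin_if (P : pred edge) F : gfin F ->
  gfin (fun e t => if P e then F e t else 0).
Proof.
move=> h; apply: (gfin_le _ h); first by apply: gnn_if; case: h.
by move=> e t t01; case: ifP => // _; have [/(_ e)[_ ->]] := h.
Qed.

End GraphIntegral.

(** * H^1 functions and pointwise bounds *)

Section H1Functions.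
Variable R : realType.
Local Notation mu := (@lebesgue_measure R).
Local Notation I := (@I01 R).
Implicit Types (F G u v g : gfun R) (c s p M : R) (e : edge) (k : int).

Definition gsq u : gfun R := fun e t => u e t ^+ 2.
Definition gpow p u : gfun R := fun e t => `|u e t| `^ p.

Lemma L2sqE u : L2sq u = gint (gsq u). Proof. by []. Qed.
Lemma dirsqE u : dirsq u = gint (gsq u). Proof. by []. Qed.
Lemma gnn_sq u : (forall e, measurable_fun I (u e)) -> gnn (gsq u).
Proof.
move=> mu_ e; split; first exact: measurable_funX.
by move=> t _; exact: sqr_ge0.
Qed.

Lemma gnn_pow p u : (forall e, measurable_fun I (u e)) -> gnn (gpow p u).
Proof.
move=> mu_ e; split; last by move=> t _; exact: powR_ge0.
apply: (@measurableT_comp _ _ _ _ _ _ (fun x : R => x `^ p)).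
  exact: measurable_powR.
exact: measurableT_comp.
Qed.

Section isH1.
Variables (u g : gfun R).
Hypothesis h : isH1 u g.

Lemma isH1_edge_H1 e : edge_H1 (u e) (g e). Proof. by case: h. Qed.

Lemma isH1_measurable e : measurable_fun I (u e).
Proof. exact: edge_H1_measurable (isH1_edge_H1 e). Qed.

Lemma isH1_measurable_der e : measurable_fun I (g e).
Proof. by case: (isH1_edge_H1 e). Qed.

Lemma isH1_gnn : gnn (gsq u). Proof. by apply: gnn_sq => e; exact: isH1_measurable. Qed.
Lemma isH1_gnn_der : gnn (gsq g). Proof. by apply: gnn_sq => e; exact: isH1_measurable_der. Qed.

Lemma isH1_fin : gfin (gsq u).
Proof.
split; first exact: isH1_gnn.
case: h => _ _; apply: le_lt_trans; rewrite L2sqE leeDl//.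
exact: (gint_ge0 isH1_gnn_der).
Qed.

Lemma isH1_fin_der : gfin (gsq g).
Proof.
split; first exact: isH1_gnn_der.
case: h => _ _; apply: le_lt_trans; rewrite dirsqE leeDr//.
exact: (gint_ge0 isH1_gnn).
Qed.

Lemma isH1_edge2 e : edge2 (u e) (g e).
Proof.
by split; [exact: isH1_edge_H1|exact: (gfin_edge_lty e isH1_fin_der)].
Qed.

Lemma isH1_right x k : x != Vert -> u (x, k) 1 = u (x, k + 1) 0.
Proof.
by case: h => /(_ (k + 1))[+ _ + _] _ _; rewrite addrK; case: x.
Qed.

Lemma isH1_rung0 k : u (Vert, k) 0 = u (Bot, k) 0.
Proof. by case: h => /(_ k)[_ -> _ _]. Qed.

Lemma isH1_rung1 k : u (Vert, k) 1 = u (Top, k) 0.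
Proof. by case: h => /(_ k)[_ _ _ ->]. Qed.

Definition gyoung s : gfun R := fun e t => s * gsq u e t + s^-1 * gsq g e t.

Lemma gfin_young s : 0 < s -> gfin (gyoung s).
Proof.
move=> s0; apply: gfinD; apply: gfinZ; rewrite ?invr_ge0 ?ltW//.
  exact: isH1_fin.
exact: isH1_fin_der.
Qed.

Lemma gJ_young s : 0 < s -> gJ (gyoung s) = s * gJ (gsq u) + s^-1 * gJ (gsq g).
Proof.
move=> s0; rewrite gJD ?gJZ ?invr_ge0 ?ltW//.
- exact: isH1_fin_der.
- exact: isH1_fin.
- by apply: gfinZ; rewrite ?ltW//; exact: isH1_fin.
- by apply: gfinZ; rewrite ?invr_ge0 ?ltW//; exact: isH1_fin_der.
Qed.

End isH1.

Lemma isH1_intro u g : ladder_continuous u -> (forall e, edge_H1 (u e) (g e)) ->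
  gfin (gsq u) -> gfin (gsq g) -> isH1 u g.
Proof.
move=> cu eu [_ fu] [_ fg]; split => //.
by rewrite L2sqE dirsqE lte_add_pinfty.
Qed.

(** The partial sums of h are bounded while h dominates x, so x cannot stay above a positive number;
    what x 0 loses along the chain is paid by the c n. Applied to u ^ 2 along rails going to
    infinity. *)
Lemma chain_bound (x c h : nat -> R) H T :
  (forall n, x n <= x n.+1 + c n) -> (forall n, x n <= h n) ->
  (forall n, \sum_(i < n) h i <= H) -> (forall n, \sum_(i < n) c i <= T) ->
  x 0%N <= T.
Proof.
move=> xc xh hH cT; rewrite leNgt; apply/negP => Tx.
have xn n : x 0%N <= x n + \sum_(i < n) c i.
  elim: n => [|n IH]; first by rewrite big_ord0 addr0.
  rewrite big_ord_recr/=; move: IH (xc n).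
  by move: (\sum_(i < n) c i) (x 0%N) (x n) (x n.+1) (c n) => a b d f j; lra.
have e0 : 0 < x 0%N - T by rewrite subr_gt0.
have xe n : x 0%N - T <= h n.
  rewrite (le_trans _ (xh n))// lerBlDr (le_trans (xn n))// lerD2l; exact: cT.
have := hH (Num.truncn (H / (x 0%N - T))).+1.
apply/negP; rewrite -ltNge.
apply: (@lt_le_trans _ _ (\sum_(i < (Num.truncn (H / (x 0%N - T))).+1) (x 0%N - T))).
  rewrite sumr_const card_ord -mulr_natl -ltr_pdivrMr//; exact: truncnS_gt.
by apply: ler_sum => i _; exact: xe.
Qed.

Lemma sum_inj_le_gJ (P : pred edge) F (f : nat -> edge) n : gfin F -> injective f ->
  (forall i, P (f i)) ->
  \sum_(i < n) gE F (f i) <= gJ (fun e t => if P e then F e t else 0).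
Proof.
move=> hF inj_f Pf.
have := gsum_le_gJ (gfin_if P hF) (_ : uniq [seq f i | i <- iota 0 n]).
rewrite map_inj_uniq// iota_uniq => /(_ isT); apply: le_trans.
rewrite big_map -[X in iota 0 X]subn0 -/(index_iota 0 n) big_mkord le_eqVlt.
apply/orP; left; apply/eqP; apply: eq_bigr => i _.
by apply: eq_Rintegral => t _; rewrite Pf.
Qed.

(** Four half-rails, which share no edge, leave the two vertices of column k. Along each of them u ^
    2 descends to 0, and its total variation is bounded by the Young integrand. The gain of a factor
    2 over a single line is what separates spread from concentrated functions. *)
Lemma vertex_bound u g k s : isH1 u g -> 0 < s ->
  2 * (u (Bot, k) 0 ^+ 2 + u (Top, k) 0 ^+ 2) <= s * gJ (gsq u) + s^-1 * gJ (gsq g).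
Proof.
move=> h s0; rewrite -gJ_young//; set Y := gyoung u g s.
have fY : gfin Y by exact: gfin_young.
have nY : gnn Y by case: fY.
pose P x (b : bool) : pred edge := fun e => (e.1 == x) && ((k <= e.2) == b).
pose Q x b := gJ (fun e t => if P x b e then Y e t else 0).
have fQ x b : gfin (fun e t => if P x b e then Y e t else 0) by exact: gfin_if.
have QY : Q Bot true + Q Bot false + (Q Top true + Q Top false) <= gJ Y.
  have fD x := gfinD (fQ x true) (fQ x false).
  rewrite /Q -(gJD (fQ Bot true) (fQ Bot false)) -(gJD (fQ Top true) (fQ Top false)).
  rewrite -(gJD (fD Bot) (fD Top)).
  apply: gJ_le => //; first by apply: gnnD; apply: gnnD; apply: gnn_if.
  move=> [x j] t t01; have := (nY (x, j)).2 t t01; rewrite /P /=.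
  by case: x; case: (k <= j) => /=; rewrite ?addr0 ?add0r.
pose H : gfun R := fun e t => 2 * gsq u e t + gsq g e t.
have fH : gfin H.
  by apply: gfinD; [apply: gfinZ => //; exact: isH1_fin h|exact: isH1_fin_der h].
have HE e t : 0 <= t <= 1 -> u e t ^+ 2 <= gE H e.
  move=> t01; apply: le_trans (edge_sup (isH1_edge2 h e) t01) _.
  have i1 := gfin_integrable e (isH1_fin h).
  have i2 := gfin_integrable e (isH1_fin_der h).
  rewrite /gE RintegralD//; first by rewrite RintegralZl.
  exact: rintegrableZ.
have YE e : `|u e 1 ^+ 2 - u e 0 ^+ 2| <= gE Y e.
  by apply: (edge_sqr_diff (isH1_edge2 h e)) => //; rewrite ?lexx ?ler01.
have inj1 (x : ekind) : injective (fun n : nat => (x, k + n%:Z)).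
  by move=> m n [/addrI[]].
have inj2 (x : ekind) : injective (fun n : nat => (x, k - n%:Z - 1)).
  by move=> m n [/addIr/addrI/oppr_inj[]].
have inj3 (x : ekind) : injective (fun n : nat => (x, k - n%:Z)).
  by move=> m n [/addrI/oppr_inj[]].
have z01 : 0 <= (0 : R) <= 1 by rewrite lexx ler01.
have s1 x : x != Vert -> forall n : nat,
    u (x, k + n%:Z) 0 ^+ 2 <= u (x, k + n.+1%:Z) 0 ^+ 2 + gE Y (x, k + n%:Z).
  move=> xV n; rewrite -lerBlDl -(addn1 n) PoszD addrA -(isH1_right h)//.
  by rewrite (le_trans _ (YE _))// distrC ler_norm.
have s2 x : x != Vert -> forall n : nat,
    u (x, k - n%:Z) 0 ^+ 2 <= u (x, k - n.+1%:Z) 0 ^+ 2 + gE Y (x, k - n%:Z - 1).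
  move=> xV n; rewrite -lerBlDl -(addn1 n) PoszD opprD addrA.
  rewrite -[in u (x, k - n%:Z)](subrK 1 (k - n%:Z)) -(isH1_right h)//.
  by rewrite (le_trans _ (YE _))// ler_norm.
pose X x n := u (x, k + n%:Z) 0 ^+ 2 + u (x, k - n%:Z) 0 ^+ 2.
(* An edge is indexed by its left end, so the step from column k - n to k - n - 1 uses edge k - n -
   1. *)
pose C x n := gE Y (x, k + n%:Z) + gE Y (x, k - n%:Z - 1).
pose Z x n := gE H (x, k + n%:Z) + gE H (x, k - n%:Z).
have /= := @chain_bound (fun n => X Bot n + X Top n) (fun n => C Bot n + C Top n)
   (fun n => Z Bot n + Z Top n) (4 * gJ H) (gJ Y).
have -> : X Bot 0%N + X Top 0%N = 2 * (u (Bot, k) 0 ^+ 2 + u (Top, k) 0 ^+ 2).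
  have kE : k + 0%:Z = k by exact: addr0.
  by rewrite /X !kE; ring.
apply.
- move=> n; have := s1 Bot isT n; have := s2 Bot isT n.
  have := s1 Top isT n; have := s2 Top isT n; rewrite /X /C.
  by move=> *; lra.
- by move=> n; rewrite /X /Z !lerD// HE.
- move=> n; rewrite /Z !big_split/=.
  have le1 (f : nat -> edge) : injective f -> \sum_(i < n) gE H (f i) <= gJ H.
    by move=> injf; have := sum_inj_le_gJ (P := xpredT) n fH injf (fun _ => isT).
  have := le1 _ (inj1 Bot); have := le1 _ (inj1 Top).
  have := le1 _ (inj3 Bot); have := le1 _ (inj3 Top).
  by move=> *; lra.
- move=> n; apply: le_trans QY; rewrite /C !big_split/=.
  have P1 x i : P x true (x, k + i%:Z) by rewrite /P/= eqxx lerDl.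
  have P2 x i : P x false (x, k - i%:Z - 1).
    by rewrite /P/= eqxx/= eqbF_neg -ltNge; lia.
  have S1 x := sum_inj_le_gJ n fY (inj1 x) (P1 x).
  have S2 x := sum_inj_le_gJ n fY (inj2 x) (P2 x).
  exact: lerD (lerD (S1 Bot) (S2 Bot)) (lerD (S1 Top) (S2 Top)).
Qed.

(** Half of the Young integral bounds the value at the initial vertex, and one more copy the
    variation along the edge. *)
Lemma sup_bound u g e t s : isH1 u g -> 0 < s -> 0 <= t <= 1 ->
  u e t ^+ 2 <= 3 / 2 * (s * gJ (gsq u) + s^-1 * gJ (gsq g)).
Proof.
move=> h s0 t01; have Y := gJ_young h s0.
have z01 : 0 <= (0 : R) <= 1 by rewrite lexx ler01.
have : `|u e t ^+ 2 - u e 0 ^+ 2| <= gE (gyoung u g s) e.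
  exact: (edge_sqr_diff (isH1_edge2 h e)).
move=> /(le_trans (ler_norm _)).
have := gE_le_gJ e (gfin_young h s0); rewrite Y.
have : 2 * u e 0 ^+ 2 <= s * gJ (gsq u) + s^-1 * gJ (gsq g).
  case: e => x k; have := vertex_bound k h s0.
  have := sqr_ge0 (u (Bot, k) 0); have := sqr_ge0 (u (Top, k) 0).
  move: (_ + s^-1 * _) => B.
  case: x; rewrite ?(isH1_rung0 h); move: (u (Bot, k) 0 ^+ 2) (u (Top, k) 0 ^+ 2);
    by move=> a b *; lra.
by move: (u e t ^+ 2) (u e 0 ^+ 2) (_ + _) (gE _ _) => *; lra.
Qed.

Lemma edge_osc_gJ u g e t1 t2 : isH1 u g -> 0 <= t1 <= 1 -> 0 <= t2 <= 1 ->
  (u e t2 - u e t1) ^+ 2 <= gJ (gsq g).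
Proof.
move=> h; wlog t12 : t1 t2 / t1 <= t2 => [W|].
  have [le12|/ltW le21] := leP t1 t2; first exact: W.
  by move=> a b; rewrite -sqrrN opprB; exact: W.
move=> /andP[a1 b1] /andP[a2 b2].
apply: le_trans (edge_osc_sqr (isH1_edge2 h e) a1 t12 b2) _.
apply: le_trans (gE_le_gJ e (isH1_fin_der h)).
rewrite ler_piMl//; last by lra.
exact: (gE_ge0 e (isH1_gnn_der h)).
Qed.

Lemma ler_sqr_norm (x y : R) : 0 <= y -> x ^+ 2 <= y ^+ 2 -> `|x| <= y.
Proof. by move=> y0; rewrite -[x ^+ 2]real_normK ?num_real// ler_pXn2r ?nnegrE. Qed.

(* Both rails through a pair of opposite vertices carry nearly equal values
   when the Dirichlet norm [q ^+ 2] is small, so the smaller one is controlled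
   by half of the one-dimensional bound of [sup_bound]. *)
Lemma sup_bound_spread u g e t s r q : isH1 u g -> 0 < s -> 0 <= r -> 0 <= q ->
  0 <= t <= 1 -> gJ (gsq g) <= q ^+ 2 ->
  s * gJ (gsq u) + s^-1 * gJ (gsq g) <= 4 * r ^+ 2 -> `|u e t| <= r + 2 * q.
Proof.
move=> h s0 r0 q0 t01 Dq Yr.
have z01 : 0 <= (0 : R) <= 1 by rewrite lexx ler01.
have o01 : 0 <= (1 : R) <= 1 by rewrite lexx ler01.
have osc e' t1 t2 : 0 <= t1 <= 1 -> 0 <= t2 <= 1 -> `|u e' t2 - u e' t1| <= q.
  move=> h1 h2; apply: ler_sqr_norm => //.
  exact: le_trans (edge_osc_gJ e' h h1 h2) Dq.
have key k : `|u (Bot, k) 0| <= r + q /\ `|u (Top, k) 0| <= r + q.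
  have := osc (Vert, k) 0 1 z01 o01; rewrite (isH1_rung0 h) (isH1_rung1 h).
  have := vertex_bound k h s0.
  move: (u (Bot, k) 0) (u (Top, k) 0) => a b ab dab.
  (* The smaller square is at most half the sum, hence at most r ^ 2; the other vertex differs by at
     most q across the rung. *)
  have [le_ab|lt_ba] := leP (a ^+ 2) (b ^+ 2).
    have ar : `|a| <= r by apply: ler_sqr_norm => //; lra.
    split; first by lra.
    by have := ler_normD a (b - a); rewrite addrC subrK; lra.
  have br : `|b| <= r by apply: ler_sqr_norm => //; lra.
  split; last by lra.
  by have := ler_normB b (b - a); rewrite opprB addrC subrK; lra.
have u0 : `|u e 0| <= r + q.
  by case: e => -[] k; rewrite ?(isH1_rung0 h); have [] := key k.
have := ler_normD (u e 0) (u e t - u e 0); rewrite addrC subrK.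
by have := osc e 0 t z01 t01; lra.
Qed.

End H1Functions.

(** * Elementary inequalities for real powers *)

Section Powers.
Variable R : realType.
Implicit Types (a b x M p s : R).

Lemma powR_sqr_le p M x : 2 < p -> `|x| <= M ->
  `|x| `^ p <= M `^ (p - 2) * x ^+ 2.
Proof.
move=> p2 xM; have -> : p = (p - 2) + 2%:R by rewrite subrK.
rewrite powRD; last by rewrite subrK gt_eqF// (lt_trans _ p2).
rewrite powR_mulrn// real_normK ?num_real// addrK ler_wpM2r ?sqr_ge0//.
by rewrite ge0_ler_powR ?nnegrE ?subr_ge0 ?(ltW p2)// (le_trans _ xM).
Qed.

(** After division by a ^ p and with x = b / a in [0, 1], p <= 6 gives 1 - x ^ p <= 1 - x ^ 6 <= 6
    (1 - x), which avoids derivatives of real powers. *)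
Lemma powR_diff_le p a b : 0 <= p -> p <= 6 -> 0 <= b -> b <= a ->
  a `^ p - b `^ p <= 6 * a `^ p * (1 - b / a).
Proof.
move=> p0 p6 b0 ba.
have [a0|aN0] := eqVneq a 0.
  have {ba}-> : b = a by apply/eqP; rewrite eq_le ba a0.
  by rewrite subrr a0 invr0 mulr0 subr0 mulr1 mulr_ge0// powR_ge0.
have a0 : 0 < a by rewrite lt_def aN0 (le_trans b0).
pose x := b / a; have x0 : 0 <= x by rewrite divr_ge0// ltW.
have x1 : x <= 1 by rewrite ler_pdivrMr// mul1r.
have -> : b = x * a by rewrite divfK.
rewrite powRM// ?(ltW a0)// mulfK// -/x.
have -> : a `^ p - x `^ p * a `^ p = a `^ p * (1 - x `^ p) by ring.
rewrite -mulrA mulrCA ler_wpM2l ?powR_ge0//.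
have x6 : x ^+ 6 <= x `^ p.
  have [->|xN0] := eqVneq x 0; first by rewrite expr0n/= powR_ge0.
  rewrite -powR_mulrn//; apply: ger_powR => //.
  by rewrite x1 lt_def xN0 x0.
have x12 : 0 <= x ^+ 2 <= 1 by rewrite exprn_ge0// exprn_ile1.
have : 1 - x ^+ 6 <= 6 * (1 - x).
  have -> : 1 - x ^+ 6 = (1 - x) * (1 + x + x ^+ 2 + x ^+ 3 + x ^+ 4 + x ^+ 5) by ring.
  rewrite mulrC ler_wpM2r ?subr_ge0//.
  have h n : x ^+ n <= 1 by rewrite exprn_ile1.
  by have := h 2%N; have := h 3%N; have := h 4%N; have := h 5%N; lra.
by lra.
Qed.

(** Local Lipschitz bound for the power, with the product |a| |a - b| split by Young, so that after
    integration only squared L^2 norms of u and u - v remain. *)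
Lemma powR_lip p M a b s : 2 < p -> p <= 6 -> `|a| <= M -> 0 < s ->
  `|a| `^ p <= `|b| `^ p + 3 * M `^ (p - 2) * (s * a ^+ 2 + s^-1 * (a - b) ^+ 2).
Proof.
move=> p2 p6 aM s0.
have M0 : 0 <= M by apply: le_trans aM.
have K0 : 0 <= M `^ (p - 2) by exact: powR_ge0.
have young : 2 * `|a| * `|a - b| <= s * a ^+ 2 + s^-1 * (a - b) ^+ 2.
  rewrite -(real_normK (num_real a)) -(real_normK (num_real (a - b))) -subr_ge0.
  have -> : s * `|a| ^+ 2 + s^-1 * `|a - b| ^+ 2 - 2 * `|a| * `|a - b| =
      s^-1 * (s * `|a| - `|a - b|) ^+ 2 by field; rewrite gt_eqF.
  by rewrite mulr_ge0 ?invr_ge0 ?sqr_ge0// ltW.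
have Y0 : 0 <= s * a ^+ 2 + s^-1 * (a - b) ^+ 2.
  by apply: le_trans young; rewrite !mulr_ge0.
have [ab|/ltW ba] := leP `|a| `|b|.
  apply: (@le_trans _ _ (`|b| `^ p)).
    by rewrite ge0_ler_powR ?nnegrE// (le_trans _ (ltW p2)).
  by rewrite lerDl !mulr_ge0.
rewrite -lerBlDl.
apply: le_trans (powR_diff_le _ p6 _ ba) _ => //; first by lra.
have [a0|aN0] := eqVneq `|a| 0.
  rewrite a0 powR0 ?mulr0 ?mul0r; last by rewrite gt_eqF// (lt_trans _ p2).
  by rewrite !mulr_ge0.
have -> : 6 * `|a| `^ p * (1 - `|b| / `|a|) = 6 * `|a| `^ p / `|a| * (`|a| - `|b|).
  by field.
apply: (@le_trans _ _ (6 * (M `^ (p - 2) * a ^+ 2) / `|a| * `|a - b|)).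
  apply: ler_pM.
  - by rewrite !mulr_ge0 ?invr_ge0 ?powR_ge0.
  - by rewrite subr_ge0.
  - by rewrite ler_wpM2r ?invr_ge0// ler_wpM2l// powR_sqr_le.
  - exact: lerB_dist.
rewrite -(real_normK (num_real a)).
have -> : 6 * (M `^ (p - 2) * `|a| ^+ 2) / `|a| * `|a - b| =
   3 * M `^ (p - 2) * (2 * `|a| * `|a - b|) by field.
by rewrite ler_wpM2l ?mulr_ge0// real_normK ?num_real.
Qed.

End Powers.

(** * Linear combinations, scaling and Lipschitz dependence of the potential term *)

Section H1Algebra.
Variable R : realType.
Local Notation mu := (@lebesgue_measure R).
Local Notation I := (@I01 R).
Implicit Types (F G u v g h : gfun R) (c s p M : R) (e : edge) (k : int).

Lemma edge_H1_intro (f g : R -> R) : measurable_fun I g ->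
  mu.-integrable I (EFin \o g) ->
  (forall x, 0 <= x <= 1 -> f x - f 0 = \int[mu]_(t in `[0, x]) g t) -> edge_H1 f g.
Proof.
move=> mg ig H; split => // x x01; rewrite H// /Rintegral fineK//.
have /andP[_ x1] := x01.
by apply: integrable_fin_num => //; exact: integrable_sub_itv.
Qed.

Lemma edge_H1_lin (f1 g1 f2 g2 : R -> R) a b : edge_H1 f1 g1 -> edge_H1 f2 g2 ->
  edge_H1 (fun t => a * f1 t + b * f2 t) (fun t => a * g1 t + b * g2 t).
Proof.
move=> [m1 i1 F1] [m2 i2 F2].
have i12 : mu.-integrable I (EFin \o (fun t => a * g1 t + b * g2 t)).
  by apply: rintegrableD => //; apply: rintegrableZ.
apply: edge_H1_intro => //.
  by apply: measurable_funD; apply: measurable_funM => //; exact: measurable_cst.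
move=> x x01; have /andP[x0 x1] := x01.
have i1' := integrable_sub_itv (lexx 0) x1 i1.
have i2' := integrable_sub_itv (lexx 0) x1 i2.
have i12' := integrable_sub_itv (lexx 0) x1 i12.
rewrite RintegralD//; try exact: rintegrableZ.
rewrite !RintegralZl//.
have e1 := edge_H1_Rint (And3 m1 i1 F1) x01.
have e2 := edge_H1_Rint (And3 m2 i2 F2) x01.
by rewrite -e1 -e2; ring.
Qed.

Lemma gfin_sq_lin u v a b : (forall e, measurable_fun I (u e)) ->
  (forall e, measurable_fun I (v e)) -> gfin (gsq u) -> gfin (gsq v) ->
  gfin (gsq (fun e t => a * u e t + b * v e t)).
Proof.
move=> m1 m2 fu fv.
have f2 : gfin (fun e t => (2 * a ^+ 2) * gsq u e t + (2 * b ^+ 2) * gsq v e t).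
  by apply: gfinD; apply: gfinZ => //; rewrite mulr_ge0 ?sqr_ge0.
apply: (gfin_le _ f2).
  apply: gnn_sq => e; apply: measurable_funD; apply: measurable_funM => //;
  exact: measurable_cst.
move=> e t _; rewrite /gsq -subr_ge0.
have -> : 2 * a ^+ 2 * u e t ^+ 2 + 2 * b ^+ 2 * v e t ^+ 2 -
  (a * u e t + b * v e t) ^+ 2 = (a * u e t - b * v e t) ^+ 2 by ring.
exact: sqr_ge0.
Qed.

Lemma isH1_lin u g v h a b : isH1 u g -> isH1 v h ->
  isH1 (fun e t => a * u e t + b * v e t) (fun e t => a * g e t + b * h e t).
Proof.
move=> hu hv; apply: isH1_intro.
- move=> k; have [+ _ _] := hu; have [+ _ _] := hv => /(_ k)[-> -> -> ->].
  by move=> /(_ k)[-> -> -> ->].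
- by move=> e; apply: edge_H1_lin; exact: isH1_edge_H1.
- apply: gfin_sq_lin; [exact: isH1_measurable hu|exact: isH1_measurable hv|
    exact: isH1_fin hu|exact: isH1_fin hv].
- apply: gfin_sq_lin; [exact: isH1_measurable_der hu|exact: isH1_measurable_der hv|
    exact: isH1_fin_der hu|exact: isH1_fin_der hv].
Qed.

Lemma isH1_scale u g c : isH1 u g ->
  isH1 (fun e t => c * u e t) (fun e t => c * g e t).
Proof.
move=> hu; have := isH1_lin c 0 hu hu.
suff E f : (fun e t => c * f e t + 0 * f e t) = (fun (e : edge) (t : R) => c * f e t).
  by rewrite !E.
by apply/funext => e; apply/funext => t; rewrite mul0r addr0.
Qed.

Lemma gJ_sq_scale u c : gfin (gsq u) ->
  gJ (gsq (fun e t => c * u e t)) = c ^+ 2 * gJ (gsq u).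
Proof.
move=> fu; rewrite -gJZ ?sqr_ge0//.
by apply: gJ_eq => e t _; rewrite /gsq exprMn.
Qed.

Lemma gpow_bound p M u : 2 < p -> (forall e t, 0 <= t <= 1 -> `|u e t| <= M) ->
  (forall e, measurable_fun I (u e)) -> gfin (gsq u) ->
  gfin (gpow p u) /\ gJ (gpow p u) <= M `^ (p - 2) * gJ (gsq u).
Proof.
move=> p2 uM m fu; have K0 : 0 <= M `^ (p - 2) by exact: powR_ge0.
have le1 e t : 0 <= t <= 1 -> gpow p u e t <= M `^ (p - 2) * gsq u e t.
  by move=> t01; apply: powR_sqr_le => //; exact: uM.
have fZ := gfinZ K0 fu; have n := gnn_pow p m.
by split; [exact: gfin_le n fZ le1|rewrite -gJZ//; exact: gJ_le].
Qed.

Definition gsup u g : R := Num.sqrt (3 / 2 * (gJ (gsq u) + gJ (gsq g))).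

Lemma isH1_sup u g e t : isH1 u g -> 0 <= t <= 1 -> `|u e t| <= gsup u g.
Proof.
move=> hu t01; apply: ler_sqr_norm; first exact: sqrtr_ge0.
have := sup_bound e hu ltr01 t01; rewrite invr1 !mul1r => h.
by rewrite sqr_sqrtr// (le_trans _ h)// sqr_ge0.
Qed.

Lemma isH1_fin_pow p u g : 2 < p -> isH1 u g -> gfin (gpow p u).
Proof.
move=> p2 hu; have [] // := @gpow_bound p (gsup u g) u p2.
- by move=> e t; exact: isH1_sup.
- exact: isH1_measurable hu.
- exact: isH1_fin hu.
Qed.

Lemma gJ_pow_scale p u g c : 2 < p -> isH1 u g -> 0 <= c ->
  gJ (gpow p (fun e t => c * u e t)) = c `^ p * gJ (gpow p u).
Proof.
move=> p2 hu c0; rewrite -gJZ ?powR_ge0//; last exact: isH1_fin_pow hu.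
by apply: gJ_eq => e t _; rewrite /gpow normrM (ger0_norm c0) powRM.
Qed.

Lemma gJ_pow_lip p M u g v h s : 2 < p -> p <= 6 -> isH1 u g -> isH1 v h ->
  (forall e t, 0 <= t <= 1 -> `|u e t| <= M) -> 0 < s ->
  gJ (gpow p u) <= gJ (gpow p v) + 3 * M `^ (p - 2) *
    (s * gJ (gsq u) + s^-1 * gJ (gsq (fun e t => u e t - v e t))).
Proof.
move=> p2 p6 hu hv uM s0.
have fu := isH1_fin hu.
have fd : gfin (gsq (fun e t => u e t - v e t)).
  apply: gfin_eq (isH1_fin (isH1_lin 1 (-1) hu hv)) => e t _.
  by rewrite /gsq mul1r mulN1r.
have K0 : 0 <= 3 * M `^ (p - 2) by rewrite mulr_ge0// powR_ge0.
have f1 := gfinZ (ltW s0) fu.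
have si0 : 0 <= s^-1 by rewrite invr_ge0 ltW.
have f2 := gfinZ si0 fd.
rewrite -(gJZ (ltW s0) fu) -(gJZ si0 fd) -gJD// -(gJZ K0 (gfinD f1 f2)).
rewrite -gJD; [|exact: isH1_fin_pow hv|exact: gfinZ K0 (gfinD f1 f2)].
apply: gJ_le.
- by apply: gnn_pow; exact: isH1_measurable hu.
- by apply: gfinD; [exact: isH1_fin_pow hv|exact: gfinZ K0 (gfinD f1 f2)].
- by move=> e t t01; apply: powR_lip => //; exact: uM.
Qed.

End H1Algebra.

(** * Energy estimates *)

Section Coercivity.
Variable R : realType.
Implicit Types (u v g : gfun R) (c s p r M x : R) (e : edge) (k : int).

Lemma EnergyE p u g : Energy p u g = 2^-1 * gJ (gsq g) - p^-1 * gJ (gpow p u).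
Proof. by []. Qed.

(** At the threshold T the slope c T ^ (r - 1) equals 1 / 2: below T the left side is bounded by its
    value at T, above T it is at most x / 2. *)
Lemma powR_sublinear c r : 0 < c -> 0 <= r -> r < 1 ->
  exists2 K, 0 <= K & forall x, 0 <= x -> c * x `^ r <= 2^-1 * x + K.
Proof.
move=> c0 r0 r1; pose T := (2 * c) `^ (1 - r)^-1.
have T0 : 0 < T by apply: powR_gt0; rewrite mulr_gt0.
have TE : c * T `^ (r - 1) = 2^-1.
  have -> : r - 1 = - (1 - r) by rewrite opprB.
  have c20 : 0 <= 2 * c by rewrite mulr_ge0 ?ltW.
  rewrite powRN -powRrM mulVf ?subr_eq0 ?gt_eqF// powRr1//.
  by field; rewrite gt_eqF.
exists (c * T `^ r); first by rewrite mulr_ge0 ?powR_ge0 ?ltW.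
move=> x x0; have [xT|Tx] := leP x T.
  rewrite ler_wpDl ?mulr_ge0 ?invr_ge0// ler_wpM2l ?(ltW c0)//.
  by rewrite ge0_ler_powR ?nnegrE ?(ltW T0).
have {}x0 : 0 < x by apply: lt_trans Tx.
rewrite ler_wpDr ?mulr_ge0 ?powR_ge0 ?(ltW c0)//.
have -> : x `^ r = x * x `^ (r - 1).
  by rewrite -{2}[x]powRr1 ?(ltW x0)// -powRD ?(gt_eqF x0) ?implybT// subrKC.
rewrite mulrCA mulrC ler_wpM2r ?(ltW x0)// -TE ler_wpM2l ?(ltW c0)//.
have -> : r - 1 = - (1 - r) by rewrite opprB.
rewrite !powRN lef_pV2 ?posrE ?(powR_gt0 _ T0) ?(powR_gt0 _ x0)//.
by rewrite ge0_ler_powR ?nnegrE ?subr_ge0 ?(ltW r1) ?(ltW T0) ?(ltW x0) ?(ltW Tx).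
Qed.

(** A Gagliardo-Nirenberg inequality: the weight s = sqrt (d / m) balances the two terms of
    [sup_bound], giving a uniform bound M with M ^ 4 = 9 m d. *)
Lemma gJ_pow_GN p u g m d : 2 < p -> isH1 u g -> 0 < m -> 0 < d ->
  gJ (gsq u) <= m -> gJ (gsq g) <= d ->
  gJ (gpow p u) <= m * (9 * m * d) `^ ((p - 2) / 4).
Proof.
move=> p2 hu m0 d0 um gd.
have md0 : 0 <= m * d by rewrite mulr_ge0 ?ltW.
pose s := Num.sqrt (d / m).
have s0 : 0 < s by rewrite sqrtr_gt0 divr_gt0.
have s2 : s ^+ 2 = d / m by rewrite sqr_sqrtr// ltW// divr_gt0.
pose M := Num.sqrt (3 * (s * m)).
have sm0 : 0 < 3 * (s * m) by rewrite !mulr_gt0.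
have M2 : M ^+ 2 = 3 * (s * m) by rewrite sqr_sqrtr// ltW.
have dE : s^-1 * d = s * m.
  have dE : d = s ^+ 2 * m by rewrite s2 divfK// gt_eqF.
  by rewrite {1}dE expr2 -mulrA mulKf// gt_eqF.
have uM e t : 0 <= t <= 1 -> `|u e t| <= M.
  move=> t01; apply: ler_sqr_norm; first exact: sqrtr_ge0.
  rewrite M2; apply: le_trans (sup_bound e hu s0 t01) _.
  have h1 : s * gJ (gsq u) <= s * m by rewrite ler_wpM2l// ltW.
  have h2 : s^-1 * gJ (gsq g) <= s * m by rewrite -dE ler_wpM2l// invr_ge0 ltW.
  by lra.
have [_ h] := gpow_bound p2 uM (isH1_measurable hu) (isH1_fin hu).
apply: le_trans h _.
have -> : M `^ (p - 2) = (9 * m * d) `^ ((p - 2) / 4).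
  have -> : 9 * m * d = M `^ 4%:R.
    rewrite powR_mulrn ?sqrtr_ge0// (exprM M 2 2) M2 !exprMn s2.
    by field; rewrite gt_eqF.
  by rewrite -powRrM; congr (_ `^ _); field.
by rewrite mulrC ler_wpM2r ?powR_ge0.
Qed.

(** The exponent (p - 2) / 4 of the Dirichlet term is below 1 exactly when p < 6. *)
Lemma coercive p mb : 2 < p -> p < 6 -> 0 < mb -> exists2 K, 0 <= K &
  forall u g, isH1 u g -> gJ (gsq u) <= mb ->
    gJ (gpow p u) <= 2^-1 * gJ (gsq g) + K.
Proof.
move=> p2 p6 mb0; pose r := (p - 2) / 4.
have r0 : 0 <= r by rewrite /r; lra.
have r1 : r < 1 by rewrite /r; lra.
have c0 : 0 < mb * (9 * mb) `^ r by rewrite mulr_gt0// powR_gt0// mulr_gt0.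
have [K K0 HK] := powR_sublinear c0 r0 r1.
exists (K + 2^-1) => [|u g hu um]; first by rewrite addr_ge0.
have D0 := gJ_ge0 (isH1_gnn_der hu).
have D1 : 0 < gJ (gsq g) + 1 by rewrite ltr_wpDl.
have gd : gJ (gsq g) <= gJ (gsq g) + 1 by rewrite lerDl.
apply: le_trans (gJ_pow_GN p2 hu mb0 D1 um gd) _.
have mb90 : 0 <= 9 * mb by rewrite mulr_ge0// ltW.
rewrite -/r powRM// ?(ltW D1)// mulrA.
by have := HK _ (ltW D1); lra.
Qed.

(** A power with exponent in [0, 1] is at most 1 plus its base, so the potential is at most m + 9 m
    ^ 2 D. With m <= d / 2 <= D / 2 and m <= 1 / 18 this is at most D, and 1 / p <= 1 / 2. *)
Lemma small_mass_energy p d : 2 < p -> p < 6 -> 0 < d -> exists2 m, 0 < m &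
  forall u g, isH1 u g -> gJ (gsq u) <= m -> d <= gJ (gsq g) -> 0 <= Energy p u g.
Proof.
move=> p2 p6 d0; pose m := Num.min (d / 2) (1 / 18).
have m0 : 0 < m by rewrite lt_min !divr_gt0.
exists m => // u g hu um dg; rewrite EnergyE.
have D0 : 0 < gJ (gsq g) by apply: lt_le_trans dg.
have P1 := gJ_pow_GN p2 hu m0 D0 um (lexx _).
move: (gJ (gpow p u)) (gJ (gsq g)) (gJ_ge0 (gnn_pow p (isH1_measurable hu))) P1 D0 dg => P D P0 P1 D0 dD.
have md : m <= d / 2 by rewrite ge_min lexx.
have m1 : m <= 1 / 18 by rewrite ge_min lexx orbT.
have r0 : 0 <= (p - 2) / 4 by lra.
have r1 : (p - 2) / 4 <= 1 by lra.
have mD0 : 0 < 9 * m * D by rewrite !mulr_gt0.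
have h : (9 * m * D) `^ ((p - 2) / 4) <= 1 + 9 * m * D.
  have [le1|/ltW ge1] := leP (9 * m * D) 1.
    rewrite (@le_trans _ _ 1) ?lerDl ?(ltW mD0)//.
    have := @ge0_ler_powR R _ r0 (9 * m * D) 1.
    by rewrite !nnegrE (ltW mD0) ler01 powR1; exact.
  by rewrite (le_trans (ler1_powR ge1 r1))// lerDr.
have PD : P <= D.
  apply: le_trans P1 _; apply: le_trans (ler_wpM2l (ltW m0) h) _.
  have : m * (9 * m * D) <= 2^-1 * D.
    by rewrite mulrA ler_wpM2r ?(ltW D0)//; nra.
  by lra.
rewrite subr_ge0 ler_pM// ?invr_ge0; try lra.
by rewrite lef_pV2 ?posrE; lra.
Qed.

End Coercivity.

(** * Strict subadditivity of the level in quantified form *)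

Section Scaling.
Variable R : realType.
Variables (p mu e0 : R).
Hypotheses (p4 : 4 <= p) (mu0 : 0 < mu) (e0lt0 : e0 < 0).
Hypothesis Hinf : forall u g : gfun R, isH1 u g -> gJ (gsq u) = mu -> e0 <= Energy p u g.
Implicit Types (u v w g : gfun R).

Let p2 : 2 < p. Proof. by apply: lt_le_trans p4; rewrite ltr_nat. Qed.

(* Scaling u up to mass mu gains from p > 2, whence strict subadditivity of the
   level, quantified by the potential term. *)
Lemma energy_scaled u g : isH1 u g -> gJ (gsq u) <= mu ->
  gJ (gsq u) / mu * e0 + (mu - gJ (gsq u)) / (p * mu) * gJ (gpow p u) <= Energy p u g.
Proof.
move=> hu um; set m := gJ (gsq u) in um *.
have p0 : 0 < p by apply: lt_trans p2.
have m0 : 0 <= m by exact: gJ_ge0 (isH1_gnn hu).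
have P0 := gJ_ge0 (gnn_pow p (isH1_measurable hu)).
have D0 := gJ_ge0 (isH1_gnn_der hu).
rewrite EnergyE.
have [mz|mN0] := eqVneq m 0.
  have [_ h] := gpow_bound p2 (fun e t => isH1_sup e hu (t := t)) (isH1_measurable hu) (isH1_fin hu).
  have -> : gJ (gpow p u) = 0.
    by apply/eqP; rewrite eq_le P0 andbT (le_trans h)// -/m mz mulr0.
  by rewrite mz mul0r !mulr0 mul0r subr0 addr0 mulr_ge0.
have {mN0}m0 : 0 < m by rewrite lt_def mN0.
pose th := mu / m; have th1 : 1 <= th by rewrite ler_pdivlMr// mul1r.
have th0 : 0 < th by apply: lt_le_trans th1.
pose c := Num.sqrt th; have c0 : 0 <= c by exact: sqrtr_ge0.
have c2 : c ^+ 2 = th by rewrite sqr_sqrtr// ltW.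
have c1 : 1 <= c by rewrite -sqrtr1 ler_wsqrtr.
have := Hinf (isH1_scale c hu).
rewrite EnergyE (gJ_sq_scale _ (isH1_fin hu)) (gJ_sq_scale _ (isH1_fin_der hu)).
rewrite (gJ_pow_scale p2 hu c0) c2 -/m divfK ?gt_eqF// => /(_ erefl) h.
(* Here 4 <= p enters: c >= 1, so c ^ p >= c ^ 4 = th ^ 2. *)
have cp : th ^+ 2 <= c `^ p.
  by rewrite -c2 -exprM -powR_mulrn//; apply: ler_powR.
move: (gJ (gsq g)) (gJ (gpow p u)) P0 D0 h => D P P0 D0 h.
have h2 : e0 <= 2^-1 * (th * D) - p^-1 * (th ^+ 2 * P).
  apply: le_trans h _; rewrite lerD2l lerN2 ler_wpM2l ?invr_ge0 ?(ltW p0)//.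
  by rewrite ler_wpM2r.
have thm : m / mu * th = 1 by rewrite /th; field; rewrite !gt_eqF.
have := ler_wpM2l (ltW (divr_gt0 m0 mu0)) h2.
have -> : m / mu * (2^-1 * (th * D) - p^-1 * (th ^+ 2 * P)) =
  (m / mu * th) * (2^-1 * D - p^-1 * (th * P)) by ring.
rewrite thm mul1r => h3; apply: le_trans (lerD h3 (lexx _)) _.
have key : (mu - m) / (p * mu) <= p^-1 * (th - 1).
  have -> : th - 1 = (mu - m) / m by rewrite /th; field; rewrite gt_eqF.
  rewrite invfM [p^-1 * _ in leLHS]mulrC mulrA mulrC ler_wpM2l ?invr_ge0 ?(ltW p0)//.
  by rewrite ler_wpM2l ?subr_ge0// lef_pV2.
have := ler_wpM2r P0 key.
by move: (_ / (p * mu)) => A hA; lra.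
Qed.

End Scaling.

(** * Cutting a function along the two rails of a cell *)

Section Cut.
Variable R : realType.
Local Notation mu := (@lebesgue_measure R).
Local Notation I := (@I01 R).
Implicit Types (u v w g : gfun R) (e : edge) (k : int) (M p : R).

Lemma measurable_affine (a b : R) : measurable_fun I (fun t => a + b * t).
Proof. exact: measurable_funD. Qed.

Lemma edge2_affine (a b : R) : edge2 (fun t => a + b * t) (fun=> b).
Proof.
split.
  apply: edge_H1_intro.
  - exact: measurable_cst.
  - exact: integrable_cst_itv.
  - move=> x /andP[x0 _]; rewrite Rintegral_cst_itv// subr0; ring.
have -> : edge_int (fun=> b ^+ 2) = ((b ^+ 2)%:E * mu I)%E.
  by rewrite /edge_int integral_cst.
by rewrite [mu I]muI01 mule1 ltry.
Qed.

Lemma edge_H1_mul_affine (f g : R -> R) (a b : R) : edge2 f g ->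
  edge_H1 (fun t => (a + b * t) * f t) (fun t => (a + b * t) * g t + b * f t).
Proof.
move=> h; have := edge2_mul (edge2_affine a b) h.
suff -> : (fun t => (a + b * t) * g t + f t * b) =
  (fun t => (a + b * t) * g t + b * f t) by [].
by apply/funext => t; rewrite [f t * b]mulrC.
Qed.

Definition is_rail k : pred edge := fun e => (e.1 != Vert) && (e.2 == k).

Definition rail_norm u g k : R :=
  gJ (fun e t => if is_rail k e then gsq u e t + gsq g e t else 0).

(** The distribution function of the mass along the ladder; rung k counts as lying up to k. *)
Definition mass_upto u k : R := gJ (fun e t => if e.2 <= k then gsq u e t else 0).

Lemma mul_affine_isH1 u g (a b : edge -> R) : isH1 u g ->
  (forall e t, 0 <= t <= 1 -> 0 <= a e + b e * t <= 1) ->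
  (forall e, b e ^+ 2 <= 1) ->
  ladder_continuous (fun e t => (a e + b e * t) * u e t) ->
  isH1 (fun e t => (a e + b e * t) * u e t)
       (fun e t => (a e + b e * t) * g e t + b e * u e t).
Proof.
move=> h ab01 b1 cont.
have H e := edge_H1_mul_affine (a e) (b e) (isH1_edge2 h e).
have m1 e : measurable_fun I (fun t => (a e + b e * t) * g e t + b e * u e t).
  by case: (H e).
have m0 e := edge_H1_measurable (H e).
apply: isH1_intro => //.
- apply: (gfin_le _ (isH1_fin h)); first exact: gnn_sq.
  move=> e t t01; have /andP[c0 c1] := ab01 e t t01.
  by rewrite /gsq exprMn ler_piMl ?sqr_ge0// exprn_ile1.
- have f2 := gfinD (gfinZ (ler0n _ 2) (isH1_fin h)) (gfinZ (ler0n _ 2) (isH1_fin_der h)).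
  apply: (gfin_le _ f2); first exact: gnn_sq.
  move=> e t t01; have /andP[c0 c1] := ab01 e t t01.
  rewrite /gsq; set c := a e + _ in c0 c1 *.
  have -> : 2 * u e t ^+ 2 + 2 * g e t ^+ 2 = (c * g e t + b e * u e t) ^+ 2 +
     ((c * g e t - b e * u e t) ^+ 2 + 2 * ((1 - c ^+ 2) * g e t ^+ 2) +
      2 * ((1 - b e ^+ 2) * u e t ^+ 2)) by ring.
  have s1 : 0 <= 1 - c ^+ 2 by rewrite subr_ge0 exprn_ile1.
  have s2 : 0 <= 1 - b e ^+ 2 by rewrite subr_ge0.
  rewrite lerDl; apply: addr_ge0; first apply: addr_ge0; first exact: sqr_ge0.
    by apply: mulr_ge0 => //; apply: mulr_ge0 => //; exact: sqr_ge0.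
  by apply: mulr_ge0 => //; apply: mulr_ge0 => //; exact: sqr_ge0.
Qed.

(* Cut u along the rails of cell k with the partition of unity 1 - t, t. *)
Lemma cut_at u g k M p : 2 < p -> isH1 u g ->
  (forall e t, 0 <= t <= 1 -> `|u e t| <= M) ->
  exists v gv w gw, [/\ isH1 v gv, isH1 w gw,
    gJ (gsq v) <= mass_upto u k, gJ (gsq w) <= gJ (gsq u) - mass_upto u (k - 1) &
    [/\ gJ (gsq v) + gJ (gsq w) <= gJ (gsq u),
    gJ (gsq gv) + gJ (gsq gw) <= gJ (gsq g) + 3 * rail_norm u g k,
    gJ (gpow p u) <= gJ (gpow p v) + gJ (gpow p w) + M `^ (p - 2) * rail_norm u g k,
    (forall e t, 0 <= t <= 1 -> `|v e t| <= M) &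
    (forall e t, 0 <= t <= 1 -> `|w e t| <= M)]].
Proof.
move=> p2 h uM.
(* The multiplier a + b t is 1 on all edges before cell k and on rung k, 1 - t on the two rails of
   cell k, and 0 beyond. *)
pose a e : R := if e.2 <= k then 1 else 0.
pose b e : R := if is_rail k e then -1 else 0.
have b1 e : b e ^+ 2 <= 1 by rewrite /b; case: ifP; rewrite ?sqrrN ?expr1n ?expr0n.
have ab e : [\/ [/\ a e = 1, b e = 0, is_rail k e = false & e.2 <= k],
    [/\ a e = 1, b e = -1, is_rail k e = true & e.2 = k] |
    [/\ a e = 0, b e = 0, is_rail k e = false & (e.2 <= k) = false]].
  rewrite /a /b; case E: (is_rail k e).
    by move: E => /andP[_ /eqP ->]; rewrite lexx; apply: Or32.
  by case: (e.2 <= k); [apply: Or31|apply: Or33].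
have c01 e t : 0 <= t <= 1 -> 0 <= a e + b e * t <= 1.
  by move=> /andP[t0 t1]; case: (ab e) => -[-> -> _ _]; lra.
have c01' e t : 0 <= t <= 1 -> 0 <= (1 - a e) + (- b e) * t <= 1.
  by move=> /(c01 e); rewrite mulNr; lra.
have [ct _ _] := h.
have contv : ladder_continuous (fun e t => (a e + b e * t) * u e t).
  move=> j; have [h1 h2 h3 h4] := ct j; rewrite /a /b /is_rail/=.
  rewrite !mulr0 !addr0 !mulr1 -h1 -h2 -h3 -h4.
  (* Rails arriving at column j have index j - 1; the column to check is k + 1, where 1 - t has
     reached 0. *)
  have -> : (j - 1 <= k) = (j - 1 == k) || (j <= k) by lia.
  case: (j - 1 =P k) => [jk|_] /=; last by rewrite addr0.
  have -> : (j <= k) = false by lia.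
  by rewrite subrr addr0.
have contw : ladder_continuous (fun e t => ((1 - a e) + - b e * t) * u e t).
  move=> j; have [h1 h2 h3 h4] := ct j; have [i1 i2 i3 i4] := contv j.
  move: i1 i2 i3 i4; rewrite -h1 -h2 -h3 -h4 => i1 i2 i3 i4.
  by split; lra.
have hv := mul_affine_isH1 h c01 b1 contv.
have b1' e : (- b e) ^+ 2 <= 1 by rewrite sqrrN.
have hw := mul_affine_isH1 h c01' b1' contw.
set v := (fun e t => _) in hv; set w := (fun e t => _) in hw.
set gv := (fun e t => _) in hv; set gw := (fun e t => _) in hw.
exists v, gv, w, gw.
have fu := isH1_fin h; have fg := isH1_fin_der h.
have nu := isH1_gnn h; have ng := isH1_gnn_der h.
have fr := gfin_if (is_rail k) (gfinD fu fg).
have K0 : 0 <= M `^ (p - 2) by exact: powR_ge0.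
split => //; [| |split].
- apply: gJ_le; [exact: isH1_gnn hv|exact: (gfin_if (fun e => e.2 <= k) fu)|].
  move=> e t t01; have /andP[c0 c1] := c01 e t t01; rewrite /gsq /v.
  move: c0 c1; case: (ab e) => -[-> -> _ ek].
  + by rewrite ek mul0r addr0 mul1r.
  + move=> c0 c1; rewrite ek lexx exprMn ler_piMl ?sqr_ge0//.
    by apply: exprn_ile1; lra.
  + by rewrite ek mul0r addr0 mul0r expr0n.
- have fm := gfin_if (fun e => e.2 <= k - 1) fu.
  rewrite lerBrDr /mass_upto -(gJD (isH1_fin hw) fm); apply: gJ_le => //.
    by apply: gnnD; [exact: isH1_gnn hw|case: fm].
  move=> e t t01; have /andP[c0 c1] := c01' e t t01; rewrite /gsq /w.
  move: c0 c1; case: (ab e) => -[-> -> _ ek].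
  + rewrite subrr oppr0 mul0r add0r mul0r expr0n add0r => _ _.
    by case: ifP => // _; exact: sqr_ge0.
  + move=> c0 c1; have -> : (e.2 <= k - 1) = false by rewrite ek; lia.
    by rewrite addr0 exprMn ler_piMl ?sqr_ge0//; apply: exprn_ile1; lra.
  + have -> : (e.2 <= k - 1) = false by move: ek; lia.
    by rewrite subr0 oppr0 mul0r !addr0 mul1r.
- rewrite -(gJD (isH1_fin hv) (isH1_fin hw)); apply: gJ_le => //.
    by apply: gnnD; [exact: isH1_gnn hv|exact: isH1_gnn hw].
  move=> e t t01; have /andP[c0 c1] := c01 e t t01; rewrite /gsq /v /w.
  set c := a e + _ in c0 c1 *.
  have -> : 1 - a e + - b e * t = 1 - c by rewrite /c; ring.
  rewrite -subr_ge0.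
  have -> : u e t ^+ 2 - ((c * u e t) ^+ 2 + ((1 - c) * u e t) ^+ 2) =
     2 * (c * (1 - c)) * u e t ^+ 2 by ring.
  by apply: mulr_ge0; rewrite ?sqr_ge0// !mulr_ge0// subr_ge0.
- have f3 : gfin (fun e t => 3 * (if is_rail k e then gsq u e t + gsq g e t else 0)).
    exact: gfinZ (ler0n _ 3) fr.
  rewrite -(gJD (isH1_fin_der hv) (isH1_fin_der hw)).
  rewrite /rail_norm -(gJZ (ler0n _ 3) fr) -(gJD fg f3); apply: gJ_le.
  + by apply: gnnD; [exact: isH1_gnn_der hv|exact: isH1_gnn_der hw].
  + exact: gfinD.
  move=> e t t01; have /andP[c0 c1] := c01 e t t01; rewrite /gsq /gv /gw.
  set c := a e + _ in c0 c1 *.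
  have -> : 1 - a e + - b e * t = 1 - c by rewrite /c; ring.
  case: (ab e) => -[ae be -> _].
  + have -> : c = 1 by rewrite /c ae be; ring.
    rewrite be -subr_ge0 (_ : _ - _ = 0)//; ring.
  + rewrite be -subr_ge0; move: (u e t) (g e t) => x y.
    (* With the constant 3 the deficit is an explicit sum of nonnegative terms, since c (1 - c) >=
       0. *)
    have -> : y ^+ 2 + 3 * (x ^+ 2 + y ^+ 2) -
        ((c * y + -1 * x) ^+ 2 + ((1 - c) * y + - -1 * x) ^+ 2) =
      (y - (1 - 2 * c) * x) ^+ 2 + 2 * y ^+ 2 + 2 * (c * (1 - c)) * y ^+ 2 +
      4 * (c * (1 - c)) * x ^+ 2 by ring.
    have cc : 0 <= c * (1 - c) by rewrite mulr_ge0// subr_ge0.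
    have x2 := sqr_ge0 x; have y2 := sqr_ge0 y.
    by rewrite !addr_ge0 ?sqr_ge0// mulr_ge0// mulr_ge0.
  + have -> : c = 0 by rewrite /c ae be; ring.
    rewrite be -subr_ge0 (_ : _ - _ = 0)//; ring.
- have fpv := isH1_fin_pow p2 hv; have fpw := isH1_fin_pow p2 hw.
  rewrite /rail_norm -(gJZ K0 fr) -(gJD fpv fpw) -(gJD (gfinD fpv fpw) (gfinZ K0 fr)).
  apply: gJ_le.
  + by apply: gnn_pow; exact: isH1_measurable h.
  + exact: gfinD (gfinD fpv fpw) (gfinZ K0 fr).
  have pN0 : p != 0 by rewrite gt_eqF// (lt_trans _ p2).
  move=> e t t01; rewrite /gpow /v /w; case: (ab e) => -[-> -> -> _].
  + by rewrite mul0r addr0 mul1r subrr oppr0 mul0r addr0 mul0r normr0 powR0// mulr0 !addr0.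
  + apply: ler_wpDl; first by rewrite addr_ge0 ?powR_ge0.
    apply: le_trans (powR_sqr_le p2 (uM e t t01)) _; rewrite ler_wpM2l//.
    by rewrite lerDl sqr_ge0.
  + by rewrite mul0r addr0 mul0r normr0 powR0// subr0 oppr0 mul0r addr0 mul1r mulr0 addr0 add0r.
- move=> e t t01; have /andP[c0 c1] := c01 e t t01.
  apply: le_trans (uM e t t01); rewrite /v normrM (ger0_norm c0).
  by rewrite ler_piMl.
- move=> e t t01; have /andP[c0 c1] := c01' e t t01.
  apply: le_trans (uM e t t01); rewrite /w normrM (ger0_norm c0).
  by rewrite ler_piMl.
Qed.

End Cut.

(** * Tightness of minimizing sequences *)

Section MassDistribution.
Variable R : realType.
Implicit Types (F u v w g : gfun R) (e : edge) (j k : int) (M p : R).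

Lemma mass_upto_mono u j k : gfin (gsq u) -> j <= k -> mass_upto u j <= mass_upto u k.
Proof.
move=> fu jk; apply: gJ_le.
- by have [] := gfin_if (fun e => e.2 <= j) fu.
- exact: (gfin_if (fun e => e.2 <= k) fu).
- move=> e t _; case: (leP e.2 j) => [ej|_]; first by rewrite (le_trans ej jk).
  by case: ifP => // _; exact: sqr_ge0.
Qed.

Lemma mass_upto_split u k : gfin (gsq u) ->
  gJ (gsq u) = mass_upto u k + gJ (fun e t => if k < e.2 then gsq u e t else 0).
Proof.
move=> fu; rewrite /mass_upto.
rewrite -(gJD (gfin_if (fun e => e.2 <= k) fu) (gfin_if (fun e => k < e.2) fu)).
by apply: gJ_eq => e t _; case: leP; rewrite ?addr0 ?add0r.
Qed.

Lemma gsum_le_gJ_if (P : pred edge) F (s : seq edge) : gfin F -> uniq s ->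
  {in s, forall e, P e} ->
  \sum_(e <- s) gE F e <= gJ (fun e t => if P e then F e t else 0).
Proof.
move=> fF us sP; apply: le_trans (gsum_le_gJ (gfin_if P fF) us).
rewrite le_eqVlt; apply/orP; left; apply/eqP.
by apply: eq_big_seq => e es; apply: eq_Rintegral => t _; rewrite sP.
Qed.

Lemma gJ_approx F c : gfin F -> c < gJ F ->
  exists2 s : seq edge, uniq s & c < \sum_(e <- s) gE F e.
Proof.
move=> fF cF; apply: contrapT => H.
have [nF _] := fF.
have [] := @gJ_le_fin R F c nF; first by move=> e; exact: gfin_edge_lty.
  by move=> s us; rewrite leNgt; apply/negP => cs; apply: H; exists s.
by move=> _; rewrite leNgt cF.
Qed.

(** Finitely many edges carry three quarters of the mass, so the distribution function crosses one
    half between two explicit columns; the least crossing is taken. *)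
Lemma exists_median u : gfin (gsq u) -> 0 < gJ (gsq u) ->
  exists k, mass_upto u (k - 1) < gJ (gsq u) / 2 /\ gJ (gsq u) / 2 <= mass_upto u k.
Proof.
move=> fu; set m := gJ (gsq u) => m0.
have cm : 3 / 4 * m < m by lra.
have [s us hs] := gJ_approx fu cm.
pose N := (\sum_(e <- s) `|e.2|)%N.
have eN e : e \in s -> (`|e.2| <= N)%N.
  by move=> es; rewrite /N (big_rem e)//= leq_addr.
have up : m / 2 <= mass_upto u N.
  have /= h1 := @gsum_le_gJ_if (fun e => e.2 <= N) _ s fu us _.
  apply: le_trans (h1 _); last by move=> e /eN; lia.
  by apply: ltW; apply: lt_trans hs; lra.
have lo : mass_upto u (- N%:Z - 1) < m / 2.
  have /= h1 := @gsum_le_gJ_if (fun e => - N%:Z - 1 < e.2) _ s fu us _.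
  have {}h1 := h1 _; have := mass_upto_split (- N%:Z - 1) fu; rewrite -/m => sp.
  suff : 3 / 4 * m < gJ (fun e t => if - N%:Z - 1 < e.2 then gsq u e t else 0).
    by move: sp; move: (mass_upto _ _) (gJ _) => a b; lra.
  by apply: lt_le_trans hs (h1 _) => e /eN; lia.
have ex : exists n : nat, m / 2 <= mass_upto u (n%:Z - N%:Z - 1).
  exists (N + N + 1)%N; apply: le_trans up _; apply: mass_upto_mono => //; lia.
case: (ex_minnP ex) => n hn minn.
exists (n%:Z - N%:Z - 1); split; last exact: hn.
case: n hn minn => [|n] _ minn.
  by apply: le_lt_trans lo; apply: mass_upto_mono => //; lia.
rewrite ltNge; apply/negP => h.
suff : (n.+1 <= n)%N by rewrite ltnn.
apply: minn.
by apply: le_trans h _; apply: mass_upto_mono => //; lia.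
Qed.

Definition gshift u j : gfun R := fun e t => u (e.1, e.2 + j) t.

Lemma gint_shift F j : gint (gshift F j) = gint F.
Proof.
rewrite /gint /gsum [RHS](reindex_esum [set: edge] _ (fun e => (e.1, e.2 + j)))//.
split => //.
- by move=> [x1 k1] [x2 k2] _ _ /= [-> /addIr ->].
- by move=> [x k] _; exists (x, k - j) => //=; rewrite subrK.
Qed.

Lemma gJ_shift F j : gJ (gshift F j) = gJ F.
Proof. by rewrite /gJ gint_shift. Qed.

Lemma isH1_shift u g j : isH1 u g -> isH1 (gshift u j) (gshift g j).
Proof.
move=> h; have [cu eu fin] := h; split.
- move=> k; have := cu (k + j); rewrite /gshift/=.
  by rewrite addrAC.
- by move=> e; exact: eu.
- have sE w : gint (gsq (gshift w j)) = gint (gsq w) := gint_shift (gsq w) j.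
  by rewrite L2sqE dirsqE !sE.
Qed.

Lemma mass_upto_shift u j k : mass_upto (gshift u j) k = mass_upto u (k + j).
Proof.
rewrite /mass_upto -[RHS](gJ_shift _ j); apply: gJ_eq => e t _.
by rewrite /gshift /= lerD2r.
Qed.

Lemma sum_rail_norm u g k n : isH1 u g ->
  \sum_(i < n) rail_norm u g (k + i%:Z) <= gJ (gsq u) + gJ (gsq g).
Proof.
move=> h; have fu := isH1_fin h; have fg := isH1_fin_der h.
have fD := gfinD fu fg; have nD : gnn (fun e t => gsq u e t + gsq g e t) by case: fD.
rewrite -(gJD fu fg).
apply: (@le_trans _ _ (gJ (fun e t => if e.2 < k + n%:Z then gsq u e t + gsq g e t else 0))).
  elim: n => [|n IH].
    rewrite big_ord0; apply: gJ_ge0.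
    by have [] := gfin_if (fun e => e.2 < k + 0%:Z) fD.
  rewrite big_ord_recr/=; apply: le_trans (lerD IH (lexx _)) _.
  have f1 := gfin_if (fun e => e.2 < k + n%:Z) fD.
  have f2 := gfin_if (is_rail (k + n%:Z)) fD.
  rewrite /rail_norm -(gJD f1 f2); apply: gJ_le.
  - by apply: gnnD; [case: f1|case: f2].
  - exact: (gfin_if (fun e => e.2 < k + n.+1%:Z) fD).
  - move=> e t t01; have := (nD e).2 t t01; rewrite /is_rail.
    have [lt1|ge1] := ltP e.2 (k + n%:Z).
      have -> : (e.2 < k + n.+1%:Z) by lia.
      rewrite (_ : (e.2 == k + n%:Z) = false) ?andbF ?addr0//; lia.
    have -> : (e.2 < k + n.+1%:Z) = (e.2 == k + n%:Z) by lia.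
    by case: (e.2 == _); case: (e.1 != Vert); rewrite /= add0r.
apply: gJ_le => //; first by have [] := gfin_if (fun e => e.2 < k + n%:Z) fD.
by move=> e t t01; case: ifP => // _; exact: (nD e).2.
Qed.

(* Pigeonhole: disjoint cells share the total H^1 norm. *)
Lemma exists_good_cell u g k (J : nat) (eta : R) : isH1 u g ->
  gJ (gsq u) + gJ (gsq g) < J%:R * eta ->
  exists2 i : nat, (i < J)%N & rail_norm u g (k + i%:Z) <= eta.
Proof.
move=> h hJ; apply: contrapT => H.
have : \sum_(i < J) eta <= \sum_(i < J) rail_norm u g (k + i%:Z).
  apply: ler_sum => i _; rewrite leNgt; apply/negP => /ltW le_i.
  by apply: H; exists i.
rewrite sumr_const card_ord -mulr_natl.
by move=> /le_trans /(_ (sum_rail_norm k J h)); rewrite leNgt hJ.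
Qed.

End MassDistribution.

Section Tightness.
Variable R : realType.
Variables (p mu e0 Dm : R).
Hypotheses (p4 : 4 <= p) (mu0 : 0 < mu) (e0lt0 : e0 < 0) (Dm0 : 0 <= Dm).
Hypothesis Hinf : forall u g : gfun R, isH1 u g -> gJ (gsq u) = mu -> e0 <= Energy p u g.
Implicit Types (u v w g : gfun R).

Let p2 : 2 < p. Proof. by apply: lt_le_trans p4; rewrite ltr_nat. Qed.
Let p0 : 0 < p. Proof. by apply: lt_trans p2. Qed.

(* Cutting at a cell where u is small in H^1 costs little energy, so by strict
   subadditivity one of the two pieces carries almost no mass. *)
Lemma cut_dichotomy (dl : R) : 0 < dl -> exists eps eta : R, [/\ 0 < eps, 0 < eta &
  forall u g k, isH1 u g -> gJ (gsq u) = mu -> gJ (gsq g) <= Dm ->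
    Energy p u g <= e0 + eps -> rail_norm u g k <= eta ->
    mu - dl <= mass_upto u k \/ mass_upto u (k - 1) <= dl].
Proof.
move=> dl0.
pose M := Num.sqrt (3 / 2 * (mu + Dm)); pose K := M `^ (p - 2).
have K0 : 0 <= K by exact: powR_ge0.
(* Energy at most e0 / 2 forces a potential term of at least 4 c. The cut loses at most 2 c of it,
   so one of the two pieces keeps potential at least c, and its missing mass is then at most
   [dl]. *)
pose c := p * - e0 / 8.
have c0 : 0 < c by rewrite divr_gt0// mulr_gt0// oppr_gt0.
pose eps := Num.min (- e0 / 2) (c * dl / (p * mu) / 2).
pose C := 3 / 2 + K.
have C0 : 0 < C by rewrite /C; lra.
pose eta := Num.min (2 * c / (K + 1)) (c * dl / (p * mu) / 2 / C).
have pmu0 : 0 < p * mu by rewrite mulr_gt0.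
have cd0 : 0 < c * dl / (p * mu) by rewrite divr_gt0// mulr_gt0.
exists eps, eta; split.
- by rewrite lt_min; apply/andP; split; apply: divr_gt0 => //; rewrite oppr_gt0.
- rewrite lt_min; apply/andP; split; last by do 2 apply: divr_gt0 => //.
  by apply: divr_gt0; [exact: mulr_gt0|exact: ltr_wpDl].
move=> u g k h um gD Eu rk.
have eps1 : eps <= - e0 / 2 by rewrite ge_min lexx.
have eps2 : eps <= c * dl / (p * mu) / 2 by rewrite ge_min lexx orbT.
have r0 : 0 <= rail_norm u g k.
  have fD := gfinD (isH1_fin h) (isH1_fin_der h).
  by apply: gJ_ge0; have [] := gfin_if (is_rail k) fD.
have rk1 : K * rail_norm u g k <= 2 * c.
  apply: (@le_trans _ _ ((K + 1) * (2 * c / (K + 1)))).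
    apply: ler_pM => //; first by rewrite lerDl.
    by apply: le_trans rk _; rewrite ge_min lexx.
  by rewrite mulrC divfK// gt_eqF// ltr_wpDl.
have rk2 : C * rail_norm u g k <= c * dl / (p * mu) / 2.
  rewrite mulrC -ler_pdivlMr//; apply: le_trans rk _.
  by rewrite ge_min lexx orbT.
have uM e t : 0 <= t <= 1 -> `|u e t| <= M.
  move=> t01; apply: le_trans (isH1_sup e h t01) _.
  by rewrite ler_wsqrtr// ler_wpM2l// um lerD2l.
have [v [gv [w [gw [hv hw mv mw [mvw dvw pvw _ _]]]]]] := cut_at k p2 h uM.
have P0 := gJ_ge0 (gnn_pow p (isH1_measurable h)).
have Pv0 := gJ_ge0 (gnn_pow p (isH1_measurable hv)).
have Pw0 := gJ_ge0 (gnn_pow p (isH1_measurable hw)).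
have mv0 := gJ_ge0 (isH1_gnn hv); have mw0 := gJ_ge0 (isH1_gnn hw).
have vmu : gJ (gsq v) <= mu by rewrite -um (le_trans _ mvw)// lerDl.
have wmu : gJ (gsq w) <= mu by rewrite -um (le_trans _ mvw)// lerDr.
have Ev := energy_scaled p4 mu0 Hinf hv vmu.
have Ew := energy_scaled p4 mu0 Hinf hw wmu.
have D0 := gJ_ge0 (isH1_gnn_der h).
rewrite -/K in pvw; rewrite um in mw mvw.
move: Eu Ev Ew; rewrite !EnergyE.
move: (gJ (gpow p u)) (gJ (gsq g)) (gJ (gsq gv)) (gJ (gsq gw)) (gJ (gpow p v))
  (gJ (gpow p w)) (gJ (gsq v)) (gJ (gsq w)) (rail_norm u g k) (mass_upto u k)
  (mass_upto u (k - 1)) P0 Pv0 Pw0 mv0 mw0 vmu wmu mv mw mvw dvw pvw r0 rk1 rk2 gD D0.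
move=> P D Dv Dw Pv Pw m1 m2 r A1 A2 P0 Pv0 Pw0 m10 m20 m1mu m2mu mA1 mA2 m12 D12 P12 r0
  rk1 rk2 gD D0 Eu Ev Ew.
have P4c : 4 * c <= P.
  have : - e0 / 2 <= p^-1 * P by lra.
  by rewrite ler_pdivlMl// /c; lra.
have Esum : 2^-1 * Dv - p^-1 * Pv + (2^-1 * Dw - p^-1 * Pw) <= e0 + eps + C * r.
  have : p^-1 * P <= p^-1 * (Pv + Pw + K * r) by rewrite ler_wpM2l// invr_ge0 ltW.
  have : p^-1 * (K * r) <= K * r.
    apply: ler_piMl; first exact: mulr_ge0.
    by rewrite invf_le1//; apply: le_trans p4; rewrite ler1n.
  by rewrite /C; lra.
have gain : (mu - m1) / (p * mu) * Pv + (mu - m2) / (p * mu) * Pw <= c * dl / (p * mu).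
  have : e0 <= m1 / mu * e0 + m2 / mu * e0.
    rewrite -mulrDl -mulrDl -{1}[e0]mul1r ler_wnM2r ?(ltW e0lt0)//.
    by rewrite ler_pdivrMr// mul1r.
  by lra.
have g1 : (mu - m1) * Pv <= c * dl.
  have : (mu - m1) / (p * mu) * Pv <= c * dl / (p * mu).
    apply: le_trans gain; rewrite lerDl mulr_ge0// divr_ge0 ?(ltW pmu0)//.
    by rewrite subr_ge0.
  by rewrite mulrAC ler_pM2r ?invr_gt0.
have g2 : (mu - m2) * Pw <= c * dl.
  have : (mu - m2) / (p * mu) * Pw <= c * dl / (p * mu).
    apply: le_trans gain; rewrite lerDr mulr_ge0// divr_ge0 ?(ltW pmu0)//.
    by rewrite subr_ge0.
  by rewrite mulrAC ler_pM2r ?invr_gt0.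
have [cPv|Pvc] := leP c Pv.
  left; have : (mu - m1) * c <= c * dl.
    by apply: le_trans g1; rewrite ler_wpM2l// subr_ge0.
  by rewrite mulrC ler_pM2l//; lra.
have cPw : c <= Pw by lra.
right; have : (mu - m2) * c <= c * dl.
  by apply: le_trans g2; rewrite ler_wpM2l// subr_ge0.
by rewrite mulrC ler_pM2l//; lra.
Qed.

(** Among J consecutive cells on each side of the median one is cheap to cut. At least half of the
    mass lies on the median's side of that cut, so the dichotomy leaves at most [dl] beyond it. *)
Lemma tightness (dl : R) : 0 < dl -> exists (eps : R) (J : nat), 0 < eps /\
  forall u g k, isH1 u g -> gJ (gsq u) = mu -> gJ (gsq g) <= Dm ->
    Energy p u g <= e0 + eps ->
    mass_upto u (k - 1) < mu / 2 -> mu / 2 <= mass_upto u k ->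
    mu - dl <= mass_upto u (k + J%:Z) /\ mass_upto u (k - J%:Z - 1) <= dl.
Proof.
(* The cap mu / 3 ensures dl' < mu / 2 < mu - dl', which excludes the wrong alternative of the
   dichotomy. *)
move=> dl0; pose dl' := Num.min dl (mu / 3).
have dl'0 : 0 < dl' by rewrite lt_min dl0 divr_gt0.
have dl1 : dl' <= dl by rewrite ge_min lexx.
have dl2 : dl' <= mu / 3 by rewrite ge_min lexx orbT.
have [eps [eta [eps0 eta0 H]]] := cut_dichotomy dl'0.
have [J hJ] : exists J : nat, mu + Dm < J%:R * eta.
  by exists (Num.truncn ((mu + Dm) / eta)).+1; rewrite -ltr_pdivrMr// truncnS_gt.
exists eps, J; split => //.
move=> u g k h um gD Eu lo up.
have fu := isH1_fin h.
have {}hJ : gJ (gsq u) + gJ (gsq g) < J%:R * eta.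
  by rewrite um; apply: le_lt_trans hJ; rewrite lerD2l.
have [i1 i1J r1] := exists_good_cell (k + 1) h hJ.
have [i2 i2J r2] := exists_good_cell (k - J%:Z) h hJ.
split.
  have [|] := H _ _ _ h um gD Eu r1.
    move=> h1; apply: (@le_trans _ _ (mu - dl')); first by rewrite lerD2l lerN2.
    apply: le_trans h1 _; apply: (mass_upto_mono fu).
    by clear -i1J; lia.
  have : mass_upto u k <= mass_upto u (k + 1 + i1%:Z - 1).
    by apply: (mass_upto_mono fu); clear; lia.
  by lra.
have [|] := H _ _ _ h um gD Eu r2.
  have : mass_upto u (k - J%:Z + i2%:Z) <= mass_upto u (k - 1).
    by apply: (mass_upto_mono fu); clear -i2J; lia.
  by lra.
move=> h1; apply: le_trans dl1; apply: le_trans h1.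
by apply: (mass_upto_mono fu); clear; lia.
Qed.

End Tightness.

(** * Completeness and compactness *)

Lemma measurable_fun_limn_einf d (T : measurableType d) (R : realType) (D : set T)
    (f : (T -> \bar R)^nat) : (forall n, measurable_fun D (f n)) ->
  measurable_fun D (fun x => limn_einf (f ^~ x)).
Proof.
move=> mf; apply: (@measurableT_comp _ _ _ _ _ _ (@oppe R)) => //.
apply: measurable_fun_limn_esup => n.
exact: (@measurableT_comp _ _ _ _ _ _ (@oppe R)).
Qed.

(** * Completeness of L^2 on one edge *)

Section L2Complete.
Variable R : realType.
Local Notation mu := (@lebesgue_measure R).
Local Notation I := (@I01 R).

Lemma limn_einf_le (u : (\bar R)^nat) (c : \bar R) :
  (forall n, (u n <= c)%E) -> (limn_einf u <= c)%E.
Proof.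
move=> uc; apply: le_trans (limn_einf_sup u) _; rewrite limn_esup_lim.
apply: lime_le; first exact: is_cvg_esups.
by apply: nearW => n; apply: ge_ereal_sup => _ [m _ <-].
Qed.

Lemma sum_geometric_half n : \sum_(i < n) 2^-1 ^+ i <= 2 :> R.
Proof.
suff -> : \sum_(i < n) 2^-1 ^+ i = 2 - 2 * 2^-1 ^+ n :> R.
  by rewrite lerBlDr lerDl mulr_ge0// exprn_ge0.
elim: n => [|n IH]; first by rewrite big_ord0 expr0; ring.
by rewrite big_ord_recr/= IH exprS; field.
Qed.

Variable h : nat -> R -> R.
Hypothesis mh : forall k, measurable_fun I (h k).
Hypothesis ch : forall k l, (k <= l)%N ->
  (edge_int (fun t => ((h l t - h k t) ^+ 2)%R) <= (4^-1 ^+ k)%:E)%E.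

Let d k t := `|h k.+1 t - h k t|.

Let md k : measurable_fun I (d k).
Proof. by apply: measurableT_comp => //; exact: measurable_funB. Qed.

(** Young's inequality with weight 2 ^ -k turns the L^2 bound into a summable L^1 bound. *)
Let int_d k : (\int[mu]_(t in I) (d k t)%:E <= (2^-1 ^+ k)%:E)%E.
Proof.
have mB : measurable_fun I (fun t => h k.+1 t - h k t) by exact: measurable_funB.
have fin : (edge_int (fun t => ((h k.+1 t - h k t) ^+ 2)%R) < +oo)%E.
  by apply: le_lt_trans (ch (leqnSn k)) (ltry _).
have i2 := integrable_sqr mB fin.
have E2 : edge_int (fun t => (h k.+1 t - h k t) ^+ 2) =
    (\int[mu]_(t in I) (h k.+1 t - h k t) ^+ 2)%:E.
  by rewrite /Rintegral fineK//; exact: integrable_fin_num.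
have := ch (leqnSn k); rewrite E2 lee_fin => hk.
pose c : R := 2^-1 ^+ k.
have c0 : 0 < c by rewrite exprn_gt0.
have ic : mu.-integrable I (EFin \o (fun t => 2^-1 * c^-1 * (h k.+1 t - h k t) ^+ 2)).
  exact: rintegrableZ.
have i3 : mu.-integrable I (EFin \o (fun t => 2^-1 * c + 2^-1 * c^-1 * (h k.+1 t - h k t) ^+ 2)).
  by apply: rintegrableD => //; exact: integrable_cst_itv.
apply: (@le_trans _ _ (\int[mu]_(t in I) (2^-1 * c + 2^-1 * c^-1 * (h k.+1 t - h k t) ^+ 2)%:E)%E).
  apply: ge0_le_integral => //.
  - by move=> t _; rewrite lee_fin; exact: normr_ge0.
  - by apply/measurable_EFinP; exact: md.
  - by have /integrableP[] := i3.
  - move=> t _; rewrite lee_fin /d -[(_ - _) ^+ 2]real_normK ?num_real//.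
    move: `|_| => a; rewrite -subr_ge0.
    have -> : 2^-1 * c + 2^-1 * c^-1 * a ^+ 2 - a = 2^-1 * c^-1 * (a - c) ^+ 2.
      by field; rewrite gt_eqF.
    by rewrite mulr_ge0 ?sqr_ge0// mulr_ge0// invr_ge0 ltW.
have -> : (\int[mu]_(t in I) (2^-1 * c + 2^-1 * c^-1 * (h k.+1 t - h k t) ^+ 2)%:E)%E
   = (\int[mu]_(t in I) (2^-1 * c + 2^-1 * c^-1 * (h k.+1 t - h k t) ^+ 2))%:E.
  by rewrite /Rintegral fineK//; exact: integrable_fin_num.
rewrite RintegralD//; last exact: integrable_cst_itv.
rewrite Rintegral_cst_itv// subr0 mulr1 RintegralZl// lee_fin.
have c2 : c ^+ 2 = 4^-1 ^+ k.
  by rewrite /c -exprM mulnC exprM; congr (_ ^+ _); field.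
have : 2^-1 * c^-1 * \int[mu]_(t in I) (h k.+1 t - h k t) ^+ 2 <= 2^-1 * c^-1 * c ^+ 2.
  by rewrite ler_wpM2l ?c2// mulr_ge0// invr_ge0 ltW.
have -> : 2^-1 * c^-1 * c ^+ 2 = 2^-1 * c by field; rewrite gt_eqF.
by rewrite -/c; move: (_ * Rintegral _ _ _) => a; move: (c) => b; lra.
Qed.

Let S t := (\sum_(k <oo) (d k t)%:E)%E.

Let int_S : mu.-integrable I S.
Proof.
have d0 k t : (0 <= (d k t)%:E)%E by rewrite lee_fin; exact: normr_ge0.
have S0 t : (0 <= S t)%E by apply: nneseries_ge0 => n _ _; exact: d0.
apply/integrableP; split.
  apply: (@ge0_emeasurable_sum _ _ _ _ (fun k t => (d k t)%:E) xpredT) => //.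
  by move=> k _; apply/measurable_EFinP; exact: md.
under eq_integral do rewrite gee0_abs//.
rewrite /S integral_nneseries//; last by move=> k; apply/measurable_EFinP; exact: md.
apply: (@le_lt_trans _ _ 2%:E); last exact: ltry.
apply: lime_le.
  by apply: is_cvg_nneseries => k _ _; apply: integral_ge0 => t _; exact: d0.
apply: nearW => n; rewrite big_mkord.
apply: (@le_trans _ _ (\sum_(k < n) (2^-1 ^+ k)%:E)%E).
  by apply: lee_sum => k _; exact: int_d.
by rewrite sumEFin lee_fin sum_geometric_half.
Qed.

Let cvg_h t : S t \is a fin_num -> cvgn (h ^~ t).
Proof.
move=> fS.
have : cvgn (series (telescope (h ^~ t))).
  apply: normed_cvg; apply: nondecreasing_is_cvgn.
    by apply: nondecreasing_series => n _ _; exact: normr_ge0.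
  exists (fine (S t)) => _ [n _ <-]; rewrite -lee_fin fineK//.
  rewrite /normed_series_of seriesEnat/= -sumEFin.
  apply: (@nneseries_lim_ge _ (fun k => (d k t)%:E) xpredT) => k _ _.
  by rewrite lee_fin; exact: normr_ge0.
move=> ct; have -> : h ^~ t = (fun n => h 0%N t + series (telescope (h ^~ t)) n).
  by apply/funext => n; rewrite [LHS](eq_sum_telescope (h ^~ t)).
by apply: is_cvgD => //; exact: is_cvg_cst.
Qed.

(** Riesz-Fischer: the increments are summable in L^1, so the sequence converges almost everywhere,
    and Fatou's lemma carries the Cauchy bound to the limit. The upper limit is measurable, and
    [fine] makes it real-valued everywhere. *)
Lemma L2_complete : exists g : R -> R, measurable_fun I g /\
  forall k, (edge_int (fun t => ((g t - h k t) ^+ 2)%R) <= (4^-1 ^+ k)%:E)%E.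
Proof.
pose g t := fine (limn_esup (fun l => (h l t)%:E)).
have mg : measurable_fun I g.
  apply: (@measurableT_comp _ _ _ _ _ _ (@fine R)) => //.
  by apply: measurable_fun_limn_esup => l; apply/measurable_EFinP.
move: g mg (fun t => erefl (g t) : g t = fine (limn_esup (fun l => (h l t)%:E))) => g mg gE.
exists g; split => // k.
pose f l t := (((h (l + k)%N t - h k t) ^+ 2)%:E : \bar R).
have mf l : measurable_fun I (f l).
  by apply/measurable_EFinP; apply: measurable_funX; exact: measurable_funB.
have -> : edge_int (fun t => (g t - h k t) ^+ 2) =
    (\int[mu]_(t in I) limn_einf (f ^~ t))%E.
  apply: ae_eq_integral => //.
  - apply/measurable_EFinP; apply: measurable_funX.
    exact: measurable_funB mg (mh k).
  - exact: measurable_fun_limn_einf.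
  - have aeS : {ae mu, forall x, I x -> S x \is a fin_num} by exact: integrable_ae.
    case: aeS => N [mN N0 subN]; exists N; split => // t /= nE.
    apply: subN => /= hS; apply: nE => It.
    have ct := cvg_h (hS It).
    have cE : (fun l => (h l t)%:E) @ \oo --> (limn (h ^~ t))%:E.
      by apply: cvg_EFin => //; apply: nearW.
    have -> : g t = limn (h ^~ t) by rewrite gE (cvg_limn_einf_sup cE).2.
    apply/esym; suff /cvg_limn_einf_sup[-> //] :
      f ^~ t @ \oo --> ((limn (h ^~ t) - h k t) ^+ 2)%:E.
    apply: cvg_EFin; first by apply: nearW.
    have c1 : (fun l => h (l + k)%N t - h k t) @ \oo --> limn (h ^~ t) - h k t.
      apply: cvgB; last exact: cvg_cst.
      by rewrite (cvg_shiftn k (h ^~ t)).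
    by rewrite expr2; apply: cvgM.
apply: (@le_trans _ _ (limn_einf (fun l => (\int[mu]_(t in I) f l t)%E))).
  by apply: fatou => // l t _; rewrite lee_fin sqr_ge0.
apply: limn_einf_le => l; apply: ch; exact: leq_addl.
Qed.

End L2Complete.

(** * Completeness of H^1 on the ladder *)

Section GraphComplete.
Variable R : realType.
Local Notation mu := (@lebesgue_measure R).
Local Notation I := (@I01 R).
Implicit Types (F G u v w g : gfun R) (e : edge).

Definition gdist u v : R := gJ (gsq (fun e t => u e t - v e t)).

Lemma isH1_sub u g v h : isH1 u g -> isH1 v h ->
  isH1 (fun e t => u e t - v e t) (fun e t => g e t - h e t).
Proof.
move=> hu hv; have := isH1_lin 1 (-1) hu hv.
suff E (f k : gfun R) : (fun e t => 1 * f e t + -1 * k e t) = (fun e t => f e t - k e t).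
  by rewrite !E.
by apply/funext => e; apply/funext => t; rewrite mul1r mulN1r.
Qed.

Lemma quarter_small (x : R) : 0 < x -> exists N : nat, forall n, (N <= n)%N -> 4^-1 ^+ n < x.
Proof.
move=> x0; exists (Num.truncn x^-1).+1 => n Nn.
rewrite exprVn invf_plt ?posrE ?exprn_gt0//.
apply: lt_le_trans (truncnS_gt _) _.
rewrite -natrX ler_nat; apply: leq_trans Nn _.
by apply: ltnW; apply: ltn_expl.
Qed.

Lemma half_sqr k : 4^-1 ^+ k = (2^-1 ^+ k) ^+ 2 :> R.
Proof. by rewrite -exprM mulnC exprM; congr (_ ^+ _); field. Qed.

Lemma half_le0 (x C : R) : (forall k, x <= C * 2^-1 ^+ k) -> x <= 0.
Proof.
move=> H; rewrite leNgt; apply/negP => x0.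
have C0 : 0 < C by move: (H 0%N); rewrite expr0 mulr1; exact: lt_le_trans.
have [N HN] := quarter_small (divr_gt0 x0 C0).
have := H (N + N)%N; apply/negP; rewrite -ltNge mulrC -ltr_pdivlMr//.
apply: le_lt_trans (HN N _) => //.
by rewrite half_sqr -exprM addnn muln2.
Qed.

(** Each lower bound x l - C 2 ^ -l lies below each upper bound x k + C 2 ^ -k; the supremum of the
    lower bounds therefore comes with an error estimate at every k. *)
Lemma cauchy_limit (x : nat -> R) (C : R) : 0 <= C ->
  (forall k l, (k <= l)%N -> (x l - x k) ^+ 2 <= C ^+ 2 * 4^-1 ^+ k) ->
  exists y, forall k, `|y - x k| <= C * 2^-1 ^+ k.
Proof.
move=> C0 H.
have q0 k : 0 <= C * 2^-1 ^+ k by rewrite mulr_ge0 ?exprn_ge0.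
have H1 k l : (k <= l)%N -> `|x l - x k| <= C * 2^-1 ^+ k.
  by move=> kl; apply: ler_sqr_norm => //; rewrite exprMn -half_sqr H.
pose a l := x l - C * 2^-1 ^+ l.
have ax k l : a l <= x k + C * 2^-1 ^+ k.
  have [kl|/ltnW lk] := leqP k l.
    have := H1 _ _ kl; have := q0 l; rewrite /a ler_norml.
    by move: (_ * 2^-1 ^+ l) (_ * 2^-1 ^+ k) => b c; lra.
  have := H1 _ _ lk; have := q0 k; rewrite /a ler_norml.
  by move: (_ * 2^-1 ^+ l) (_ * 2^-1 ^+ k) => b c; lra.
exists (sup (range a)) => k.
have ub : sup (range a) <= x k + C * 2^-1 ^+ k.
  by apply: ge_sup; [exists (a 0%N), 0%N|move=> _ [l _ <-]].
have lb : a k <= sup (range a).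
  apply: ub_le_sup; last by exists k.
  by exists (x 0%N + C * 2^-1 ^+ 0) => _ [l _ <-].
by move: ub lb; rewrite /a ler_norml; move: (sup _) (_ * _) => b c; lra.
Qed.

Lemma sqr_integrable_L1 (f : R -> R) : measurable_fun I f ->
  mu.-integrable I (EFin \o (fun t => f t ^+ 2)) -> mu.-integrable I (EFin \o f).
Proof.
move=> mf i2.
have i3 : mu.-integrable I (EFin \o (fun t => 1 + f t ^+ 2)).
  by apply: rintegrableD => //; exact: integrable_cst_itv.
apply: le_integrable i3 => //; first by apply/measurable_EFinP.
move=> t _; rewrite /= lee_fin [X in _ <= X]ger0_norm ?addr_ge0 ?sqr_ge0//.
rewrite -[f t ^+ 2]real_normK ?num_real//; move: `|f t| => a.
have : 0 <= (2 * a - 1) ^+ 2 by exact: sqr_ge0.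
by rewrite !expr2; lra.
Qed.

Lemma norm_Rintegral_young (f : R -> R) x s : measurable_fun I f ->
  mu.-integrable I (EFin \o (fun t => f t ^+ 2)) -> 0 < s -> 0 <= x <= 1 ->
  `|\int[mu]_(t in `[0, x]) f t| <= 2^-1 * (s + s^-1 * \int[mu]_(t in I) f t ^+ 2).
Proof.
move=> mf i2 s0 /andP[x0 x1]; have i1 := sqr_integrable_L1 mf i2.
have i3 : mu.-integrable I (EFin \o (fun t => 2^-1 * s + 2^-1 * s^-1 * f t ^+ 2)).
  by apply: rintegrableD => //; [exact: integrable_cst_itv|exact: rintegrableZ].
apply: le_trans (le_normr_Rintegral _ _) _ => //; first exact: integrable_sub_itv.
apply: le_trans (le_subset_Rintegral (lexx 0) x1 (integrable_norm _) _) _ => //.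
  by move=> t; exact: normr_ge0.
apply: (@le_trans _ _ (\int[mu]_(t in I) (2^-1 * s + 2^-1 * s^-1 * f t ^+ 2))).
  apply: le_Rintegral => //; first exact: integrable_norm.
  move=> t _ /=; rewrite -[f t ^+ 2]real_normK ?num_real//; move: `|f t| => a.
  rewrite -subr_ge0.
  have -> : 2^-1 * s + 2^-1 * s^-1 * a ^+ 2 - a = 2^-1 * s^-1 * (a - s) ^+ 2.
    by field; rewrite gt_eqF.
  by rewrite mulr_ge0 ?sqr_ge0// mulr_ge0// invr_ge0 ltW.
rewrite RintegralD//; [|exact: integrable_cst_itv|exact: rintegrableZ].
by rewrite Rintegral_cst_itv// subr0 mulr1 RintegralZl// mulrDr mulrA.
Qed.

Lemma edge_int_le_cst (f : R -> R) c : measurable_fun I f ->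
  (forall t, 0 <= t <= 1 -> 0 <= f t <= c) -> (edge_int f <= c%:E)%E.
Proof.
move=> mf fc; have -> : c%:E = edge_int (fun=> c).
  have -> : edge_int (fun=> c) = (c%:E * mu I)%E by rewrite /edge_int integral_cst.
  by rewrite [mu I]muI01 mule1.
apply: ge0_le_integral => //.
- by move=> t /inI01 /fc /andP[h _]; rewrite lee_fin.
- exact/measurable_EFinP.
- by move=> t /inI01 /fc /andP[_ h]; rewrite lee_fin.
Qed.

Variables (v h : nat -> gfun R).
Hypothesis hv : forall k, isH1 (v k) (h k).
Hypothesis cv : forall k l, (k <= l)%N -> gdist (v l) (v k) <= 4^-1 ^+ k.
Hypothesis ch : forall k l, (k <= l)%N -> gdist (h l) (h k) <= 4^-1 ^+ k.

Let limit_values : exists u : gfun R, forall e t, 0 <= t <= 1 ->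
  forall k, `|u e t - v k e t| <= 2 * 2^-1 ^+ k.
Proof.
have H (et : edge * R) : exists y, 0 <= et.2 <= 1 ->
    forall k, `|y - v k et.1 et.2| <= 2 * 2^-1 ^+ k.
  case: et => e t /=; have [t01|] := boolP (0 <= t <= 1); last by exists 0.
  (* [sup_bound] with s = 1 gives squared differences of at most 3 times 4 ^ -k, hence the constant
     2. *)
  have [|y Hy] := @cauchy_limit (fun k => v k e t) 2 (ler0n _ 2); last by exists y.
  move=> k l kl.
  have := sup_bound e (isH1_sub (hv l) (hv k)) ltr01 t01.
  rewrite invr1 !mul1r -/(gdist _ _) -/(gdist _ _).
  have := cv kl; have := ch kl; have : 0 <= 4^-1 ^+ k :> R by rewrite exprn_ge0.
  by move: (gdist _ _) (gdist _ _) (4^-1 ^+ k) ((_ - _) ^+ 2) => *; lra.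
have [f Hf] := choice H.
by exists (fun e t => f (e, t)) => e t t01; exact: Hf (e, t) t01.
Qed.

Let limit_derivative : exists g : gfun R, forall e, measurable_fun I (g e) /\
  forall k, (edge_int (fun t => ((g e t - h k e t) ^+ 2)%R) <= (4^-1 ^+ k)%:E)%E.
Proof.
have H e : exists ge : R -> R, measurable_fun I ge /\
  forall k, (edge_int (fun t => ((ge t - h k e t) ^+ 2)%R) <= (4^-1 ^+ k)%:E)%E.
  apply: (L2_complete (h := fun k => h k e)) => [k|k l kl].
    exact: isH1_measurable_der (hv k) e.
  have fd := isH1_fin_der (isH1_sub (hv l) (hv k)).
  apply: le_trans (gfin_edge e fd) _; rewrite (gJE fd) lee_fin.
  exact: ch.
have [g Hg] := choice H.
by exists g => e; exact: Hg.
Qed.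

(** The edgewise bounds do not sum over infinitely many edges. On a finite list u is replaced by w
    l, with l so large, depending on the list, that the error is negligible; the global Cauchy bound
    handles the rest. The factor 2 comes from squaring a sum. *)
Let global_dist u (w : nat -> gfun R) (C : R) k : (forall e, measurable_fun I (u e)) ->
  (forall j, forall e, measurable_fun I (w j e)) ->
  (forall j e, (edge_int (fun t => ((u e t - w j e t) ^+ 2)%R) <= (C * 4^-1 ^+ j)%:E)%E) ->
  (forall j, gfin (gsq (fun e t => w j e t - w k e t))) ->
  (forall j, (k <= j)%N -> gdist (w j) (w k) <= 4^-1 ^+ k) ->
  gfin (gsq (fun e t => u e t - w k e t)) /\ gdist u (w k) <= 2 * 4^-1 ^+ k.
Proof.
move=> mu_ mw Hw fw cw.
have nn j : gnn (gsq (fun e t => u e t - w j e t)).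
  by apply: gnn_sq => e; exact: measurable_funB.
have ff j e : (edge_int (gsq (fun e t => (u e t - w j e t)%R) e) < +oo)%E.
  by apply: le_lt_trans (Hw j e) (ltry _).
apply: gJ_le_fin; [exact: nn|exact: ff|move=> s us].
apply/ler_addgt0Pr => x x0.
have C1 : 0 < 2 * (size s)%:R * `|C| + 1 by rewrite ltr_wpDl// !mulr_ge0.
have [N HN] := quarter_small (divr_gt0 x0 C1).
pose l := (N + k)%N.
have e1 e : gE (gsq (fun e t => u e t - w k e t)) e <=
    2 * gE (gsq (fun e t => u e t - w l e t)) e + 2 * gE (gsq (fun e t => w l e t - w k e t)) e.
  have i0 := integrable_sqr (measurable_funB (mu_ e) (mw k e)) (ff k e).
  have i1 := integrable_sqr (measurable_funB (mu_ e) (mw l e)) (ff l e).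
  have i2 := gfin_integrable e (fw l).
  rewrite /gE -!RintegralZl// -RintegralD//; [|exact: rintegrableZ..].
  apply: le_Rintegral => //; first by apply: rintegrableD => //; exact: rintegrableZ.
  move=> t _; rewrite /gsq -subr_ge0; move: (u e t) (w l e t) (w k e t) => a b c.
  have -> : 2 * (a - b) ^+ 2 + 2 * (b - c) ^+ 2 - (a - c) ^+ 2 = (a - b - (b - c)) ^+ 2 by ring.
  exact: sqr_ge0.
apply: le_trans (ler_sum _ (fun e _ => e1 e)) _.
rewrite big_split/= -!mulr_sumr.
have h1 : \sum_(e <- s) gE (gsq (fun e t => w l e t - w k e t)) e <= 4^-1 ^+ k.
  by apply: le_trans (gsum_le_gJ (fw l) us) _; apply: cw; exact: leq_addl.
have h2 : \sum_(e <- s) gE (gsq (fun e t => u e t - w l e t)) e <= (size s)%:R * (`|C| * 4^-1 ^+ l).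
  apply: (@le_trans _ _ (\sum_(e <- s) (`|C| * 4^-1 ^+ l))).
    apply: ler_sum => e _; rewrite -lee_fin -(gfinP (nn l) (ff l)).
    apply: le_trans (Hw l e) _; rewrite lee_fin ler_wpM2r ?exprn_ge0//.
    exact: ler_norm.
  by rewrite big_const_seq count_predT iter_addr addr0 mulr_natl.
have h3 : 2 * ((size s)%:R * (`|C| * 4^-1 ^+ l)) <= x.
  have := HN l (leq_addr _ _); rewrite ltr_pdivlMr// => /ltW.
  have : 0 <= 4^-1 ^+ l :> R by rewrite exprn_ge0.
  set y := _ ^+ l; set n := (size s)%:R; set c := `|C|.
  by move: y n c => y n c *; lra.
move: h1 h2; set b := _ ^+ k; move: b (\sum_(e <- s) _) (\sum_(e <- s) _) h3 => b S1 S2.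
by move: ((size s)%:R * _) => *; lra.
Qed.

Lemma graph_complete : exists u g, isH1 u g /\
  forall k, gdist u (v k) <= 2 * 4^-1 ^+ k /\ gdist g (h k) <= 2 * 4^-1 ^+ k.
Proof.
have [u Hu] := limit_values; have [g Hg] := limit_derivative.
have mg e : measurable_fun I (g e) by have [] := Hg e.
have mh k e : measurable_fun I (h k e) := isH1_measurable_der (hv k) e.
have mv k e : measurable_fun I (v k e) := isH1_measurable (hv k) e.
have z01 : 0 <= (0 : R) <= 1 by rewrite lexx ler01.
have o01 : 0 <= (1 : R) <= 1 by rewrite lexx ler01.
have fgk e k : (edge_int (fun t => (g e t - h k e t) ^+ 2)%R < +oo)%E.
  by apply: le_lt_trans ((Hg e).2 k) (ltry _).
have i2 e k : mu.-integrable I (EFin \o (fun t => (g e t - h k e t) ^+ 2)).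
  exact: (integrable_sqr (measurable_funB (mg e) (mh k e)) (fgk e k)).
have ig e : mu.-integrable I (EFin \o g e).
  have ih : mu.-integrable I (EFin \o h 0%N e) by case: (isH1_edge_H1 (hv 0%N) e).
  have id := sqr_integrable_L1 (measurable_funB (mg e) (mh 0%N e)) (i2 e 0%N).
  have : mu.-integrable I (EFin \o (fun t => h 0%N e t + (g e t - h 0%N e t))).
    exact: rintegrableD.
  suff -> : (fun t => h 0%N e t + (g e t - h 0%N e t)) = g e by [].
  by apply/funext => t; ring.
have eu e : edge_H1 (u e) (g e).
  apply: edge_H1_intro => // x x01; apply/eqP; rewrite -subr_eq0 -normr_le0.
  (* Two endpoint values contribute 2 each and the integral 1, in units of 2 ^ -k. *)
  apply: (@half_le0 _ 6) => k; have /andP[x0 x1] := x01.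
  have hx := Hu e x x01 k; have h0 := Hu e 0 z01 k.
  have q0 : 0 < 2^-1 ^+ k :> R by rewrite exprn_gt0.
  have hi := norm_Rintegral_young (measurable_funB (mg e) (mh k e)) (i2 e k) q0 x01.
  have ihk : mu.-integrable I (EFin \o h k e) by case: (isH1_edge_H1 (hv k) e).
  have := edge_H1_Rint (isH1_edge_H1 (hv k) e) x01.
  move: hi; rewrite /= RintegralB//; [|exact: integrable_sub_itv|exact: integrable_sub_itv].
  have : \int[mu]_(t in I) (g e t - h k e t) ^+ 2 <= (2^-1 ^+ k) ^+ 2.
    rewrite -half_sqr -lee_fin; apply: le_trans ((Hg e).2 k).
    rewrite /Rintegral fineK; first exact: lexx.
    by apply: (integrable_fin_num _ (i2 e k)); exact: mI01.
  move=> hk hi hE.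
  have {hi hk} : `|\int[mu]_(t in `[0, x]) g e t - \int[mu]_(t in `[0, x]) h k e t| <= 2^-1 ^+ k.
    apply: le_trans hi _.
    have : (2^-1 ^+ k)^-1 * \int[mu]_(t in I) (g e t - h k e t) ^+ 2 <= 2^-1 ^+ k.
      by rewrite ler_pdivrMl// -expr2.
    have aux (a b : R) : a <= b -> 2^-1 * (b + a) <= b by lra.
    exact: aux.
  move: (\int[mu]_(t in `[0, x]) g e t) (\int[mu]_(t in `[0, x]) h k e t) hE hx h0 q0.
  move: (u e x) (u e 0) (v k e x) (v k e 0) (2^-1 ^+ k) => a b c d q G H.
  by rewrite !ler_norml => *; lra.
have lim_eq e1 t1 e2 t2 : 0 <= t1 <= 1 -> 0 <= t2 <= 1 ->
    (forall k, v k e1 t1 = v k e2 t2) -> u e1 t1 = u e2 t2.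
  move=> h1 h2 E; apply/eqP; rewrite -subr_eq0 -normr_le0.
  apply: (@half_le0 _ 4) => k; have := Hu e1 t1 h1 k; have := Hu e2 t2 h2 k.
  by rewrite E !ler_norml; move: (u e1 t1) (u e2 t2) (v k e2 t2) (2^-1 ^+ k) => *; lra.
have mu_ e := edge_H1_measurable (eu e).
have fv k := @global_dist u v 4 k mu_ mv.
have fh k := @global_dist g h 1 k mg mh.
have {}fv k : gfin (gsq (fun e t => u e t - v k e t)) /\ gdist u (v k) <= 2 * 4^-1 ^+ k.
  apply: fv => [j e|j|j kj].
  - apply: edge_int_le_cst.
      by apply: measurable_funX; exact: measurable_funB.
    move=> t t01; rewrite sqr_ge0/= -real_normK ?num_real//.
    have -> : 4 * 4^-1 ^+ j = (2 * 2^-1 ^+ j) ^+ 2 :> R by rewrite exprMn -half_sqr; ring.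
    by rewrite ler_pXn2r ?nnegrE ?mulr_ge0 ?exprn_ge0//; exact: Hu.
  - exact: isH1_fin (isH1_sub (hv j) (hv k)).
  - exact: cv.
have {}fh k : gfin (gsq (fun e t => g e t - h k e t)) /\ gdist g (h k) <= 2 * 4^-1 ^+ k.
  apply: fh => [j e|j|j kj].
  - by rewrite mul1r; exact: (Hg e).2.
  - exact: isH1_fin_der (isH1_sub (hv j) (hv k)).
  - exact: ch.
have fsum (f k : gfun R) : (forall e, measurable_fun I (f e)) ->
   (forall e, measurable_fun I (k e)) -> gfin (gsq (fun e t => f e t - k e t)) ->
   gfin (gsq k) -> gfin (gsq f).
  move=> mf mk f1 f2.
  have mB e : measurable_fun I (fun t => f e t - k e t) by exact: measurable_funB.
  apply: gfin_eq (gfin_sq_lin 1 1 mB mk f1 f2) => e t _.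
  by rewrite /gsq; congr (_ ^+ 2); ring.
exists u, g; split; last by move=> k; split; [exact: (fv k).2|exact: (fh k).2].
apply: isH1_intro => //.
- move=> j; split; apply: lim_eq => // k; have [/(_ j)[h1 h2 h3 h4] _ _] := hv k => //.
- exact: (fsum u (v 0%N) mu_ (mv 0%N) (fv 0%N).1 (isH1_fin (hv 0%N))).
- exact: (fsum g (h 0%N) mg (mh 0%N) (fh 0%N).1 (isH1_fin_der (hv 0%N))).
Qed.

End GraphComplete.

(** * Norms under small L^2 perturbations, and finite windows *)

Section DistanceEstimates.
Variable R : realType.
Local Notation I := (@I01 R).
Implicit Types (F G u v w g h : gfun R) (e : edge).

Lemma gdistC u v : gdist u v = gdist v u.
Proof. by apply: gJ_eq => e t _; rewrite /gsq -sqrrN opprB. Qed.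

Lemma gJ_parallelogram u v : (forall e, measurable_fun I (u e)) ->
  (forall e, measurable_fun I (v e)) -> gfin (gsq u) -> gfin (gsq v) ->
  gJ (gsq (fun e t => 2^-1 * u e t + 2^-1 * v e t)) + 4^-1 * gdist u v =
  2^-1 * gJ (gsq u) + 2^-1 * gJ (gsq v).
Proof.
move=> mu mv fu fv.
have h0 : 0 <= 2^-1 :> R by rewrite invr_ge0.
have q0 : 0 <= 4^-1 :> R by rewrite invr_ge0.
have fz := gfin_sq_lin 2^-1 2^-1 mu mv fu fv.
have fd : gfin (gsq (fun e t => u e t - v e t)).
  apply: gfin_eq (gfin_sq_lin 1 (-1) mu mv fu fv) => e t _.
  by rewrite /gsq mul1r mulN1r.
rewrite /gdist -(gJZ q0 fd) -(gJZ h0 fu) -(gJZ h0 fv).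
rewrite -(gJD fz (gfinZ q0 fd)) -(gJD (gfinZ h0 fu) (gfinZ h0 fv)).
by apply: gJ_eq => e t _; rewrite /gsq; field.
Qed.

Lemma gJ_sq_le_dist u v (s : R) : (forall e, measurable_fun I (u e)) ->
  (forall e, measurable_fun I (v e)) -> gfin (gsq u) -> gfin (gsq v) -> 0 < s ->
  gJ (gsq u) <= gJ (gsq v) + s * gJ (gsq v) + (1 + s^-1) * gdist u v.
Proof.
move=> mu mv fu fv s0.
have fd : gfin (gsq (fun e t => u e t - v e t)).
  apply: gfin_eq (gfin_sq_lin 1 (-1) mu mv fu fv) => e t _.
  by rewrite /gsq mul1r mulN1r.
have s1 : 0 <= 1 + s^-1 by rewrite addr_ge0// invr_ge0 ltW.
have s2 : 0 <= 1 + s by rewrite addr_ge0// ltW.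
have -> : gJ (gsq v) + s * gJ (gsq v) = (1 + s) * gJ (gsq v) by ring.
rewrite -(gJZ s2 fv) -(gJZ s1 fd) -(gJD (gfinZ s2 fv) (gfinZ s1 fd)).
apply: gJ_le; [by case: fu|exact: gfinD (gfinZ s2 fv) (gfinZ s1 fd)|].
move=> e t _; rewrite /gsq -subr_ge0; move: (u e t) (v e t) => x y.
have -> : (1 + s) * y ^+ 2 + (1 + s^-1) * (x - y) ^+ 2 - x ^+ 2 =
  s^-1 * (s * y - (x - y)) ^+ 2 by field; rewrite gt_eqF.
by rewrite mulr_ge0 ?sqr_ge0// invr_ge0 ltW.
Qed.

Lemma gJ_sq_near (Dm eps : R) : 0 <= Dm -> 0 < eps -> exists2 tol : R, 0 < tol &
  forall u v, (forall e, measurable_fun I (u e)) ->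
    (forall e, measurable_fun I (v e)) -> gfin (gsq u) -> gfin (gsq v) ->
    gJ (gsq v) <= Dm -> gdist u v <= tol -> `|gJ (gsq u) - gJ (gsq v)| <= eps.
Proof.
move=> Dm0 e0; pose s := eps / (2 * (Dm + eps)).
have De : 0 < Dm + eps by rewrite ltr_wpDl.
have s0 : 0 < s by rewrite divr_gt0// mulr_gt0.
have sD : s * (Dm + eps) = eps / 2 by rewrite /s; field; rewrite gt_eqF.
have s1 : 0 < 1 + s^-1 by rewrite addr_gt0// invr_gt0.
exists (eps / 2 / (1 + s^-1)); first by rewrite !divr_gt0.
move=> u v mu mv fu fv vD; rewrite ler_pdivlMr// mulrC => dl.
have h1 := gJ_sq_le_dist mu mv fu fv s0.
have := gJ_sq_le_dist mv mu fv fu s0; rewrite gdistC => h2.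
have v0 := gJ_ge0 (proj1 fv); have u0 := gJ_ge0 (proj1 fu).
move: (gJ (gsq u)) (gJ (gsq v)) (_ * gdist u v) vD dl h1 h2 v0 u0 => a b d vD dl h1 h2 v0 u0.
have sb : s * b <= s * Dm by rewrite ler_wpM2l// ltW.
have se : 0 <= s * eps by rewrite mulr_ge0// ltW.
have ab : a <= b + eps by lra.
have sa : s * a <= s * (Dm + eps) by rewrite ler_wpM2l ?(ltW s0)//; lra.
by rewrite ler_norml; apply/andP; split; lra.
Qed.

Definition window (J : nat) : seq edge :=
  [seq (x, i%:Z - J%:Z) | x <- [:: Bot; Top; Vert], i <- iota 0 (J + J).+1].

Lemma mem_window J e : (- J%:Z - 1 < e.2) && (e.2 <= J%:Z) -> e \in window J.
Proof.
case: e => x k /= /andP[k1 k2]; apply/allpairsP; exists (x, `|(k + J%:Z)%R|%N) => /=.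
split.
- by case: x.
- by rewrite -[_ :: _]/(iota 0 (J + J).+1) mem_iota; lia.
- by congr pair; lia.
Qed.

Lemma gJ_window J F c : 0 <= c -> gnn F ->
  (forall e t, 0 <= t <= 1 ->
     F e t <= if (- J%:Z - 1 < e.2) && (e.2 <= J%:Z) then c else 0) ->
  gfin F /\ gJ F <= c * (size (window J))%:R.
Proof.
move=> c0 nF Fc; pose inW : pred edge := fun e => (- J%:Z - 1 < e.2) && (e.2 <= J%:Z).
have iF e : (edge_int (F e) <= (if inW e then c else 0)%:E)%E.
  apply: edge_int_le_cst; first by have [] := nF e.
  by move=> t t01; rewrite (nF e).2//= Fc.
have lF e : (edge_int (F e) < +oo)%E by apply: le_lt_trans (iF e) (ltry _).
apply: gJ_le_fin => // s us.
apply: (@le_trans _ _ (\sum_(e <- s) if inW e then c else 0)).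
  by apply: ler_sum => e _; rewrite -lee_fin -(gfinP nF lF).
rewrite -big_mkcond big_const_seq iter_addr addr0 -[X in X <= _]mulr_natr.
apply: ler_wpM2l => //; rewrite ler_nat -size_filter.
apply: uniq_leq_size; first exact: filter_uniq.
by move=> e; rewrite mem_filter => /andP[/mem_window].
Qed.

End DistanceEstimates.

(** * L^2 compactness of tight sequences along an ultrafilter *)

Section UltraCauchy.
Variable R : realType.
Variables (F : set_system nat) (FU : UltraFilter F).
Implicit Types (e : edge).

Let FP : ProperFilter F. Proof. exact: ultra_proper. Qed.

(** If no fibre belonged to the ultrafilter, all complements would, and by induction f would exceed
    every bound on a set of the filter. *)
Lemma ultra_finite (f : nat -> nat) (N : nat) : (forall n, (f n <= N)%N) ->
  exists i, F [set n | f n = i].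
Proof.
move=> fN; apply: contrapT => H.
have HC i : F [set n | f n <> i].
  by have [Fi|//] := in_ultra_setVsetC [set n | f n = i] FU; case: H; exists i.
have HK K : F [set n | (K <= f n)%N].
  elim: K => [|K IH]; first by apply: filterS filterT.
  apply: filterS (filterI IH (HC K)) => n [/= Kn nK].
  by rewrite ltn_neqAle Kn andbT; apply/eqP => E; exact: nK.
have /filter_ex[n /=] := HK N.+1.
by rewrite ltnNge fN.
Qed.

(** Sorting the values into cells of length [tol] gives a bounded integer index, constant on a set
    of the filter; no limit has to be named. *)
Lemma ultra_bounded (x : nat -> R) (M tol : R) : (forall n, `|x n| <= M) -> 0 < tol ->
  exists2 A, F A & forall n m, A n -> A m -> `|x n - x m| <= tol.
Proof.
move=> xM tol0; pose f n := Num.truncn ((x n + M) / tol).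
have x0 n : 0 <= (x n + M) / tol.
  by rewrite divr_ge0 ?(ltW tol0)//; have := xM n; rewrite ler_norml; lra.
have [|i Fi] := @ultra_finite f (Num.truncn (2 * M / tol)).
  move=> n; apply: le_truncn; rewrite ler_wpM2r ?invr_ge0 ?(ltW tol0)//.
  by have := xM n; rewrite ler_norml; lra.
exists [set n | f n = i] => // n m /= fn fm.
have := truncn_itv (x0 n); have := truncn_itv (x0 m); rewrite -/(f n) -/(f m) fn fm.
rewrite !ler_pdivlMr// !ltr_pdivrMr// -natr1 mulrDl mul1r.
by rewrite ler_norml; move: (i%:R * tol) => c *; lra.
Qed.

Lemma ultra_bounded_seq (T : eqType) (s : seq T) (x : T -> nat -> R) (M tol : R) :
  (forall i n, i \in s -> `|x i n| <= M) -> 0 < tol ->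
  exists2 A, F A & forall i n m, i \in s -> A n -> A m -> `|x i n - x i m| <= tol.
Proof.
move=> xM tol0; elim: s xM => [|i s IH] xM; first by exists setT => //; exact: filterT.
have [|A FA HA] := IH; first by move=> j n js; apply: xM; rewrite in_cons js orbT.
have [|B FB HB] := @ultra_bounded (x i) M tol _ tol0.
  by move=> n; apply: xM; rewrite mem_head.
exists (A `&` B); first exact: filterI.
move=> j n m; rewrite in_cons => /predU1P[->|js] [An Bn] [Am Bm]; first exact: HB.
exact: HA.
Qed.

Variables (u g : nat -> gfun R) (mu Dm M : R).
Hypothesis hu : forall n, isH1 (u n) (g n).
Hypothesis Dm0 : 0 <= Dm.
Hypothesis gD : forall n, gJ (gsq (g n)) <= Dm.
Hypothesis uM : forall n e t, 0 <= t <= 1 -> `|u n e t| <= M.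
Hypothesis um : forall n, gJ (gsq (u n)) = mu.
Hypothesis tight : forall dl : R, 0 < dl -> exists J : nat,
  F [set n | mu - dl <= mass_upto (u n) J%:Z /\ mass_upto (u n) (- J%:Z - 1) <= dl].

(** An Arzela-Ascoli argument: the Dirichlet bound gives a common modulus of continuity, so
    closeness at N + 1 grid points per edge extends to all points, at the price of two
    oscillations. *)
Let unif_window J (eta : R) : 0 < eta -> exists2 A, F A & forall n m e t,
  A n -> A m -> e \in window J -> 0 <= t <= 1 -> `|u n e t - u m e t| <= 3 * eta.
Proof.
move=> eta0; pose N := (Num.truncn (Dm / eta ^+ 2)).+1.
have DN : Dm / N%:R <= eta ^+ 2.
  rewrite ler_pdivrMr ?ltr0n// mulrC -ler_pdivrMr ?exprn_gt0//.
  by rewrite ltW// truncnS_gt.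
pose pts := [seq (e, i) | e <- window J, i <- iota 0 N.+1].
have grid01 i : (i <= N)%N -> 0 <= (i%:R / N%:R : R) <= 1.
  by move=> iN; rewrite divr_ge0//= ler_pdivrMr ?ltr0n// mul1r ler_nat.
have [|A FA HA] := @ultra_bounded_seq _ pts (fun ei n => u n ei.1 (ei.2%:R / N%:R)) M eta _ eta0.
  move=> _ n /allpairsP[[e i] [_ iN ->]]; apply: uM; apply: grid01.
  by move: iN; rewrite mem_iota.
exists A => // n m e t An Am eW t01; have /andP[t0 t1] := t01.
pose i := Num.truncn (t * N%:R).
have tN0 : 0 <= t * N%:R by rewrite mulr_ge0.
have /andP[i1 i2] : i%:R <= t * N%:R < i.+1%:R := truncn_itv tN0.
have iN : (i <= N)%N.
  by rewrite -(ler_nat R); apply: le_trans i1 _; rewrite ler_piMl.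
have osc k : `|u k e t - u k e (i%:R / N%:R)| <= eta.
  apply: ler_sqr_norm; first exact: ltW.
  have it : i%:R / N%:R <= t by rewrite ler_pdivrMr ?ltr0n.
  have /andP[g0 _] := grid01 i iN.
  apply: le_trans (edge_osc_sqr (isH1_edge2 (hu k) e) g0 it t1) _.
  apply: le_trans DN; rewrite mulrC ler_pM//.
  - exact: (gE_ge0 e (isH1_gnn_der (hu k))).
  - by rewrite subr_ge0.
  - by apply: le_trans (gD k); exact: (gE_le_gJ e (isH1_fin_der (hu k))).
  - by rewrite lerBlDr addrC -[X in _ + X]mul1r -mulrDl natr1 ler_pdivlMr ?ltr0n// ltW.
have ei : (e, i) \in pts.
  by apply: allpairs_f => //; rewrite mem_iota.
have := HA (e, i) n m ei An Am; rewrite /=; have := osc n; have := osc m.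
by rewrite !ler_norml => *; lra.
Qed.

(* Along an ultrafilter no subsequence extraction is needed: every bounded real
   sequence converges along it. *)
Lemma ultra_gdist_cauchy (tol : R) : 0 < tol ->
  exists2 A, F A & forall n m, A n -> A m -> gdist (u n) (u m) <= tol.
Proof.
(* Outside the window each function contributes at most 4 dl to the distance, in total tol / 2;
   [eta] is chosen so that the window contributes at most the other half. *)
move=> tol0; pose dl := tol / 16; have dl0 : 0 < dl by rewrite divr_gt0.
have [J FJ] := tight dl0.
pose S : R := (size (window J))%:R.
pose eta := Num.sqrt (tol / (2 * (9 * S + 1))).
have S1 : 0 < 9 * S + 1 by rewrite ltr_wpDl// mulr_ge0.
have c0 : 0 < tol / (2 * (9 * S + 1)) by rewrite divr_gt0// mulr_gt0.
have eta0 : 0 < eta by rewrite sqrtr_gt0.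
have eta2 : eta ^+ 2 = tol / (2 * (9 * S + 1)) by rewrite sqr_sqrtr// ltW.
have [A FA HA] := unif_window J eta0.
exists (A `&` [set n | mu - dl <= mass_upto (u n) J%:Z /\ mass_upto (u n) (- J%:Z - 1) <= dl]).
  exact: filterI.
move=> n m [An [n1 n2]] [Am [m1 m2]].
pose inW : pred edge := fun e => (- J%:Z - 1 < e.2) && (e.2 <= J%:Z).
have fd := isH1_fin (isH1_sub (hu n) (hu m)).
have nd : gnn (gsq (fun e t => u n e t - u m e t)) by case: fd.
pose W : gfun R := fun e t => if inW e then gsq (fun e t => u n e t - u m e t) e t else 0.
have fW : gfin W := gfin_if inW fd.
have nW : gnn W by case: fW.
have hW : gJ W <= 9 * eta ^+ 2 * S.
  apply: (gJ_window _ nW _).2; first by rewrite mulr_ge0 ?sqr_ge0.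
  move=> e t t01; rewrite /W -/(inW e); case E: (inW e) => //.
  rewrite /gsq -real_normK ?num_real//.
  have -> : 9 * eta ^+ 2 = (3 * eta) ^+ 2 by ring.
  rewrite ler_pXn2r ?nnegrE ?mulr_ge0 ?(ltW eta0)//.
  by apply: HA => //; exact: mem_window.
have out k : mu - dl <= mass_upto (u k) J%:Z -> mass_upto (u k) (- J%:Z - 1) <= dl ->
   exists G, [/\ gfin G, gJ G <= 2 * dl & forall e t, ~~ inW e -> gsq (u k) e t <= G e t].
  move=> k1 k2; have fu := isH1_fin (hu k).
  have f1 := gfin_if (fun e => e.2 <= - J%:Z - 1) fu.
  have f2 := gfin_if (fun e => J%:Z < e.2) fu.
  exists (fun e t => (if e.2 <= - J%:Z - 1 then gsq (u k) e t else 0) +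
     (if J%:Z < e.2 then gsq (u k) e t else 0)); split.
  - exact: gfinD.
  - rewrite (gJD f1 f2); have := mass_upto_split J%:Z fu; rewrite um => sp.
    move: sp k1 k2; rewrite /mass_upto.
    by move: (gJ _) (gJ _) (gJ _) => a b c; lra.
  - move=> e t; rewrite /inW negb_and -leNgt -ltNge.
    have := sqr_ge0 (u k e t); rewrite /gsq.
    by case: ifP; case: ifP => //= _ _ h _; rewrite ?addr0 ?add0r ?lerDl.
have [G1 [fG1 G1d G1u]] := out n n1 n2.
have [G2 [fG2 G2d G2u]] := out m m1 m2.
have nG1 := proj1 fG1; have nG2 := proj1 fG2.
have z2 : 0 <= 2 :> R by [].
have f12 := gfinD (gfinZ z2 fG1) (gfinZ z2 fG2).
have : gdist (u n) (u m) <= gJ W + (2 * gJ G1 + 2 * gJ G2).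
  rewrite -(gJZ z2 fG1) -(gJZ z2 fG2) -(gJD (gfinZ z2 fG1) (gfinZ z2 fG2)) -(gJD fW f12).
  apply: gJ_le; [exact: nd|exact: gfinD fW f12|].
  move=> e t t01; rewrite /W; have := (nG1 e).2 t t01; have := (nG2 e).2 t t01.
  case E: (inW e) => g1 g2; first by rewrite lerDl addr_ge0// mulr_ge0.
  have := G1u e t (negbT E); have := G2u e t (negbT E); rewrite /gsq add0r.
  move: (u n e t) (u m e t) (G1 e t) (G2 e t) => a b c d h1 h2.
  have : 0 <= (a + b) ^+ 2 by exact: sqr_ge0.
  by rewrite !expr2 in h1 h2 *; lra.
have : 9 * eta ^+ 2 * S <= tol / 2.
  rewrite eta2; have -> : 9 * (tol / (2 * (9 * S + 1))) * S = tol / 2 * (9 * S / (9 * S + 1)).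
    by field; rewrite gt_eqF.
  rewrite ler_piMr ?divr_ge0 ?(ltW tol0)//.
  by rewrite ler_pdivrMr// mul1r lerDl.
move: hW G1d G2d; rewrite /dl.
by move: (gdist _ _) (gJ W) (gJ G1) (gJ G2) (_ * S) => *; lra.
Qed.

End UltraCauchy.

Lemma Energy_shift (R : realType) (p : R) (u g : gfun R) (j : int) :
  Energy p (gshift u j) (gshift g j) = Energy p u g.
Proof.
have E1 : gJ (gsq (gshift g j)) = gJ (gsq g) := gJ_shift (gsq g) j.
have E2 : gJ (gpow p (gshift u j)) = gJ (gpow p u) := gJ_shift (gpow p u) j.
by rewrite !EnergyE E1 E2.
Qed.

Section RealArithmetic.
Variable R : realType.
Implicit Types a b c d e : R.

Lemma midpoint_mass_le a b c : a + 4^-1 * b = 2^-1 * c + 2^-1 * c -> 0 <= b -> a <= c.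
Proof. by move=> *; lra. Qed.

Lemma quarter_le a b : 0 <= a -> a <= b -> 4^-1 * a <= b.
Proof. by move=> *; lra. Qed.

Lemma midpoint_derivative_le Dg Dh Dz d B Pu Pv Pz e0 tol :
  2^-1 * Dg - Pu <= e0 + tol / 16 -> 2^-1 * Dh - Pv <= e0 + tol / 16 ->
  e0 <= 2^-1 * Dz - Pz -> Dz + 4^-1 * d = 2^-1 * Dg + 2^-1 * Dh ->
  B <= tol / 16 -> Pu <= Pz + B -> Pv <= Pz + B -> d <= tol.
Proof. by move=> *; lra. Qed.

Lemma energy_limit_le a b c d e0 e :
  `|a - b| <= e / 4 -> 2^-1 * b - d <= e0 + e / 4 -> d <= c + e / 4 ->
  2^-1 * a - c <= e0 + e.
Proof. by rewrite ler_norml => *; lra. Qed.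

End RealArithmetic.

(** * From minimizing sequences to minimizers *)

Section Compactness.
Variable R : realType.
Variables (p mu e0 Dm : R).
Hypotheses (p4 : 4 <= p) (p6 : p <= 6) (mu0 : 0 < mu) (e0lt0 : e0 < 0) (Dm0 : 0 <= Dm).
Hypothesis Hinf : forall u g : gfun R, isH1 u g -> gJ (gsq u) = mu -> e0 <= Energy p u g.
Implicit Types (u v w g h : gfun R).

Let p2 : 2 < p. Proof. by apply: lt_le_trans p4; rewrite ltr_nat. Qed.
Let p0 : 0 < p. Proof. by apply: lt_trans p2. Qed.

Let M := Num.sqrt (3 / 2 * (mu + Dm)).
Let K := 3 * M `^ (p - 2).

Let K0 : 0 <= K. Proof. by rewrite mulr_ge0// powR_ge0. Qed.

Let sup_M u g e t : isH1 u g -> gJ (gsq u) = mu -> gJ (gsq g) <= Dm -> 0 <= t <= 1 ->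
  `|u e t| <= M.
Proof.
move=> h um gD t01; apply: le_trans (isH1_sup e h t01) _.
by rewrite ler_wsqrtr// ler_wpM2l// um lerD2l.
Qed.

Let pinv_add (x y b : R) : 0 <= b -> x <= y + b -> p^-1 * x <= p^-1 * y + b.
Proof.
move=> b0 xy; apply: (@le_trans _ _ (p^-1 * (y + b))).
  by rewrite ler_wpM2l// invr_ge0 ltW.
rewrite mulrDr lerD2l ler_piMl// invf_le1//.
by apply: le_trans p4; rewrite ler1n.
Qed.

(* The midpoint of two near-minimizers that are close in L^2 has almost the same
   potential energy and, its energy being at least e0, almost the same Dirichlet
   norm; the parallelogram identity then makes the derivatives close. *)
Lemma near_minimizers_derivative_close (tol : R) : 0 < tol ->
  exists eps kap : R, [/\ 0 < eps, 0 < kap &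
  forall u g v h, isH1 u g -> isH1 v h -> gJ (gsq u) = mu -> gJ (gsq v) = mu ->
    gJ (gsq g) <= Dm -> gJ (gsq h) <= Dm ->
    Energy p u g <= e0 + eps -> Energy p v h <= e0 + eps ->
    gdist u v <= kap -> gdist g h <= tol].
Proof.
move=> tol0; have K1 : 0 < K + 1 by rewrite ltr_wpDl.
(* With this weight both terms of [gJ_pow_lip] are at most tol / (32 (K + 1)), so the error B is at
   most tol / 16. *)
pose s := tol / (32 * (K + 1) * mu).
have s0 : 0 < s by rewrite divr_gt0// !mulr_gt0.
pose kap := s * (tol / (32 * (K + 1))).
have kap0 : 0 < kap by rewrite mulr_gt0// divr_gt0// mulr_gt0.
exists (tol / 16), kap; split => //; first by rewrite divr_gt0.
move=> u g v h hu hv um vm gD hD Eu Ev duv.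
have hz := isH1_lin 2^-1 2^-1 hu hv.
set z := (fun e t => _) in hz; set gz := (fun e t => _) in hz.
have par := gJ_parallelogram (isH1_measurable hu) (isH1_measurable hv) (isH1_fin hu) (isH1_fin hv).
have pard := gJ_parallelogram (isH1_measurable_der hu) (isH1_measurable_der hv)
  (isH1_fin_der hu) (isH1_fin_der hv).
rewrite -/z in par; rewrite -/gz in pard.
have dz0 : 0 <= gdist u v by exact: gJ_ge0 (isH1_gnn (isH1_sub hu hv)).
have zmu : gJ (gsq z) <= mu.
  by move: par; rewrite um vm => par; exact: midpoint_mass_le par dz0.
have z0 := gJ_ge0 (isH1_gnn hz).
have Pz0 := gJ_ge0 (gnn_pow p (isH1_measurable hz)).
have Ez : e0 <= Energy p z gz.
  apply: le_trans (energy_scaled p4 mu0 Hinf hz zmu).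
  have t1 : e0 <= gJ (gsq z) / mu * e0.
    rewrite -{1}[e0]mul1r ler_wnM2r ?(ltW e0lt0)//.
    by rewrite ler_pdivrMr// mul1r.
  apply: le_trans t1 _; rewrite lerDl mulr_ge0// divr_ge0 ?subr_ge0//.
  by rewrite mulr_ge0 ?ltW.
have q0 : 0 <= 4^-1 :> R by rewrite invr_ge0.
have fd := isH1_fin (isH1_sub hu hv).
have dU : gJ (gsq (fun e t => u e t - z e t)) = 4^-1 * gdist u v.
  rewrite /gdist -(gJZ q0 fd).
  by apply: gJ_eq => e t _; rewrite /gsq /z; field.
have dV : gJ (gsq (fun e t => v e t - z e t)) = 4^-1 * gdist u v.
  rewrite /gdist -(gJZ q0 fd).
  by apply: gJ_eq => e t _; rewrite /gsq /z; field.
have Pu := gJ_pow_lip p2 p6 hu hz (fun e t => sup_M e hu um gD (t := t)) s0.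
have Pv := gJ_pow_lip p2 p6 hv hz (fun e t => sup_M e hv vm hD (t := t)) s0.
rewrite dU um -/K in Pu; rewrite dV vm -/K in Pv.
set B := K * (s * mu + s^-1 * (4^-1 * gdist u v)) in Pu Pv.
have A0 : 0 <= s * mu + s^-1 * (4^-1 * gdist u v).
  apply: addr_ge0; first exact: mulr_ge0 (ltW s0) (ltW mu0).
  by apply: mulr_ge0; [rewrite invr_ge0 ltW|exact: mulr_ge0].
have B0 : 0 <= B by exact: mulr_ge0.
have Bt : B <= tol / 16.
  have h1 : s * mu = tol / (32 * (K + 1)) by rewrite /s; field; rewrite !gt_eqF.
  have h2 : s^-1 * (4^-1 * gdist u v) <= tol / (32 * (K + 1)).
    by rewrite ler_pdivrMl// -/kap; exact: quarter_le.
  apply: (@le_trans _ _ ((K + 1) * (tol / (32 * (K + 1)) + tol / (32 * (K + 1))))).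
    by apply: ler_pM; [exact: K0|exact: A0|rewrite lerDl|rewrite h1 lerD2l].
  rewrite le_eqVlt; apply/orP; left; apply/eqP; field.
  by rewrite gt_eqF.
have {}Pu := pinv_add B0 Pu; have {}Pv := pinv_add B0 Pv.
move: Eu Ev Ez; rewrite !EnergyE => Eu Ev Ez.
exact: midpoint_derivative_le Eu Ev Ez pard Bt Pu Pv.
Qed.

Variables (un gn : nat -> gfun R).
Hypothesis hn : forall n, isH1 (un n) (gn n).
Hypothesis um : forall n, gJ (gsq (un n)) = mu.
Hypothesis gD : forall n, gJ (gsq (gn n)) <= Dm.
Hypothesis En : forall eps : R, 0 < eps -> exists N, forall n, (N <= n)%N ->
  Energy p (un n) (gn n) <= e0 + eps.

(** The last clause makes the Dirichlet energy of the minimizer a cluster value of those of the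
    sequence. This is how a minimizer remembers the side of d from which it was approached. *)
Lemma minimizing_sequence_compact : exists u g, [/\ isH1 u g, gJ (gsq u) = mu,
  Energy p u g = e0 & forall (eps : R) N, 0 < eps ->
    exists2 n, (N <= n)%N & `|gJ (gsq g) - gJ (gsq (gn n))| <= eps].
Proof.
have med n : exists k, mass_upto (un n) (k - 1) < mu / 2 /\ mu / 2 <= mass_upto (un n) k.
  by have := exists_median (isH1_fin (hn n)); rewrite um; exact.
have [k Hk] := choice med.
pose v n := gshift (un n) (k n); pose h n := gshift (gn n) (k n).
have hv n : isH1 (v n) (h n) by exact: isH1_shift.
have shE (f : gfun R) j : gJ (gsq (gshift f j)) = gJ (gsq f) := gJ_shift (gsq f) j.
have vm n : gJ (gsq (v n)) = mu by rewrite shE.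
have hD n : gJ (gsq (h n)) <= Dm by rewrite shE.
have Ev n : Energy p (v n) (h n) = Energy p (un n) (gn n).
  exact: Energy_shift.
have v1 n : mass_upto (v n) (0 - 1) < mu / 2.
  by rewrite mass_upto_shift sub0r addrC; exact: (Hk n).1.
have v2 n : mu / 2 <= mass_upto (v n) 0.
  by rewrite mass_upto_shift add0r; exact: (Hk n).2.
have vM n e t : 0 <= t <= 1 -> `|v n e t| <= M by exact: sup_M (hv n) (vm n) (hD n).
(* An ultrafilter containing all tails, so that eventual properties hold on its sets. *)
have [F [FU Foo]] := ultraFilterLemma (eventually_filter : ProperFilter (\oo)).
have FP : ProperFilter F by exact: ultra_proper.
have Fge N : F [set n | (N <= n)%N] by apply: Foo; exists N.
have tight (dl : R) : 0 < dl -> exists J : nat,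
    F [set n | mu - dl <= mass_upto (v n) J%:Z /\ mass_upto (v n) (- J%:Z - 1) <= dl].
  move=> dl0.
  have [eps [J [eps0 HJ]]] := @tightness R p mu e0 Dm p4 mu0 e0lt0 Hinf dl dl0.
  have [N HN] := En eps0.
  exists J; apply: filterS (Fge N) => n /= Nn.
  have := HJ (v n) (h n) 0 (hv n) (vm n) (hD n).
  by rewrite Ev add0r sub0r => /(_ (HN n Nn) (v1 n) (v2 n)).
have L2c := ultra_gdist_cauchy FU hv hD vM vm tight.
have both j : exists A, F A /\ forall n m, A n -> A m ->
    gdist (v n) (v m) <= 4^-1 ^+ j /\ gdist (h n) (h m) <= 4^-1 ^+ j.
  have q0 : 0 < 4^-1 ^+ j :> R by rewrite exprn_gt0// invr_gt0.
  have [eps [kap [eps0 kap0 H]]] := near_minimizers_derivative_close q0.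
  have [A FA HA] := L2c _ kap0; have [B FB HB] := L2c _ q0.
  have [N HN] := En eps0.
  exists (A `&` B `&` [set n | (N <= n)%N]); split.
    by apply: filterI => //; exact: filterI.
  move=> n m [[An Bn] Nn] [[Am Bm] Nm]; split; first exact: HB.
  apply: (H (v n) (h n) (v m) (h m)) => //; rewrite ?Ev; [exact: HN|exact: HN|exact: HA].
have [C HC] := choice both.
have inter j : F (\bigcap_(i in [set i | (i <= j)%N]) C i).
  elim: j => [|j IH].
    by apply: filterS (HC 0%N).1 => n Cn i /=; rewrite leqn0 => /eqP ->.
  apply: filterS (filterI IH (HC j.+1).1) => n [H1 H2] i /=.
  by rewrite leq_eqVlt => /predU1P[->//|]; rewrite ltnS => ij; exact: H1.
(* Diagonal choice: the index picked at stage j lies in the Cauchy sets of all stages up to j, which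
   gives a genuine Cauchy sequence. *)
have pick j : exists n, (j <= n)%N /\ forall i, (i <= j)%N -> C i n.
  have [n [nj Cn]] := filter_ex (filterI (Fge j) (inter j)).
  by exists n; split => // i ij; exact: Cn.
have [phi Hphi] := choice pick.
have cau k1 l1 : (k1 <= l1)%N -> gdist (v (phi l1)) (v (phi k1)) <= 4^-1 ^+ k1 /\
    gdist (h (phi l1)) (h (phi k1)) <= 4^-1 ^+ k1.
  by move=> kl; apply: (HC k1).2; [exact: (Hphi l1).2|exact: (Hphi k1).2].
have [u [g [hug lim]]] := graph_complete (fun j => hv (phi j))
  (fun k1 l1 kl => (cau k1 l1 kl).1) (fun k1 l1 kl => (cau k1 l1 kl).2).
have small (tol : R) : 0 < tol -> exists N, forall j, (N <= j)%N ->
    gdist u (v (phi j)) <= tol /\ gdist g (h (phi j)) <= tol.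
  move=> tol0; have [N HN] := quarter_small (divr_gt0 tol0 (ltr0n R 2)).
  exists N => j Nj; have := HN j Nj; have [l1 l2] := lim j.
  rewrite ltr_pdivlMr// mulrC => /ltW q.
  by split; [apply: le_trans l1 _|apply: le_trans l2 _].
have muu := isH1_measurable hug; have mug := isH1_measurable_der hug.
have nearD (eps : R) : 0 < eps -> exists N, forall j, (N <= j)%N ->
    `|gJ (gsq g) - gJ (gsq (h (phi j)))| <= eps.
  move=> eps0; have [tol tol0 H] := gJ_sq_near Dm0 eps0.
  have [N HN] := small _ tol0; exists N => j Nj; apply: H => //.
  - exact: isH1_measurable_der (hv _).
  - exact: isH1_fin_der hug.
  - exact: isH1_fin_der (hv _).
  - exact: (HN j Nj).2.
have um' : gJ (gsq u) = mu.
  apply/eqP; rewrite -subr_eq0 -normr_le0; apply/ler_addgt0Pr => eps eps0.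
  have [tol tol0 H] := gJ_sq_near (ltW mu0) eps0.
  have [N HN] := small _ tol0; rewrite add0r -(vm (phi N)); apply: H => //.
  - exact: isH1_measurable (hv _).
  - exact: isH1_fin hug.
  - exact: isH1_fin (hv _).
  - by rewrite vm.
  - exact: (HN N (leqnn N)).1.
exists u, g; split => //.
- apply/eqP; rewrite eq_le (Hinf hug um') andbT; apply/ler_addgt0Pr => eps eps0.
  have e4 : 0 < eps / 4 by rewrite divr_gt0.
  have [N1 HN1] := nearD _ e4; have [N2 HN2] := En e4.
  have K1 : 0 < K + 1 by rewrite ltr_wpDl.
  pose s := eps / 8 / (K + 1) / mu.
  have s0 : 0 < s by rewrite !divr_gt0.
  have t0 : 0 < s * (eps / 8 / (K + 1)) by rewrite mulr_gt0// !divr_gt0.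
  have [N3 HN3] := small _ t0.
  pose j := (N1 + N2 + N3)%N.
  have D1 := HN1 j ltac:(by rewrite /j -addnA leq_addr).
  have E2 := HN2 (phi j) ltac:(by apply: leq_trans (Hphi j).1; rewrite /j addnAC leq_addl).
  have [d3 _] := HN3 j (leq_addl _ _).
  have PP := gJ_pow_lip p2 p6 (hv (phi j)) hug (vM (phi j)) s0.
  rewrite -/(gdist _ _) gdistC vm -/K in PP.
  have KB : K * (s * mu + s^-1 * gdist u (v (phi j))) <= eps / 4.
    have h1 : s * mu = eps / 8 / (K + 1) by rewrite /s divfK// gt_eqF.
    have h2 : s^-1 * gdist u (v (phi j)) <= eps / 8 / (K + 1) by rewrite ler_pdivrMl.
    rewrite h1; apply: (@le_trans _ _ (K * (eps / 8 / (K + 1) + eps / 8 / (K + 1)))).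
      by rewrite ler_wpM2l// lerD2l.
    have -> : K * (eps / 8 / (K + 1) + eps / 8 / (K + 1)) = eps / 4 * (K / (K + 1)).
      by field; rewrite gt_eqF.
    by rewrite ler_piMr ?(ltW e4)// ler_pdivrMr// mul1r lerDl.
  have {}PP := pinv_add (ltW e4) (le_trans PP (lerD (lexx _) KB)).
  rewrite -Ev EnergyE in E2; rewrite EnergyE.
  exact: energy_limit_le D1 E2 PP.
- move=> eps N eps0; have [N1 HN1] := nearD _ eps0.
  exists (phi (N + N1)%N); first by apply: leq_trans (Hphi _).1; rewrite leq_addr.
  by have := HN1 _ (leq_addl N N1); rewrite /h shE.
Qed.

End Compactness.

(** * Test functions *)

Section Concentrated.
Variable R : realType.
Local Notation mu := (@lebesgue_measure R).
Local Notation I := (@I01 R).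
Implicit Types (F u v g : gfun R) (e : edge).

(** From exp(- e ln c) >= 1 - e ln c and ln c <= c. This crude linear bound controls the passage
    from exponent 6 to p, both for the tall bump and for the small uniform bound. *)
Lemma powRN_ge (c e : R) : 0 < c -> 0 <= e -> 1 - e * c <= c `^ (- e).
Proof.
move=> c0 e0; rewrite /powR gt_eqF//.
apply: le_trans (expR_ge1Dx _); rewrite lerD2l mulNr lerN2 ler_wpM2l//.
exact: ltW (ln_sublinear c0).
Qed.

Lemma gJ_single F (e0 : edge) : gfin F ->
  (forall e t, e != e0 -> 0 <= t <= 1 -> F e t = 0) -> gJ F = gE F e0.
Proof.
move=> fF F0; apply/eqP; rewrite eq_le (gE_le_gJ e0 fF) andbT.
have [nF _] := fF.
have gE0 e : e != e0 -> gE F e = 0.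
  move=> ee; transitivity (\int[mu]_(t in I) (0 : R)).
    by apply: eq_Rintegral => t /set_mem /inI01; exact: F0.
  by rewrite Rintegral_cst_itv// mul0r.
apply: (gJ_le_fin nF (fun e => gfin_edge_lty e fF) _).2 => s us.
have [es|es] := boolP (e0 \in s).
  by rewrite (bigD1_seq e0)//= big1 ?addr0// => e /gE0.
rewrite big1_seq ?gE_ge0// => e /andP[_ ei]; apply: gE0.
by apply: contraNneq es => <-.
Qed.

(** A polynomial vanishing at both ends whose integer powers integrate to Beta values; its
    factorised form lets [edge2_mul] prove it H^1. *)
Definition bump (t : R) : R := (t * (1 - t)) * (t * (1 - t)).
Definition dbump (t : R) : R := 2 * (t * (1 - t)) * (1 - 2 * t).

Lemma beta_edge a b : \int[mu]_(t in I) (t ^+ a * (1 - t) ^+ b) =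
  a`!%:R * b`!%:R / (a + b).+1`!%:R.
Proof.
rewrite -natrM -beta_fun_fact /beta_fun -Rintegral_mkcond; apply: eq_Rintegral => t _.
by rewrite /XMonemX.
Qed.

Lemma id01 (t : R) : 0 <= t <= 1 -> 0 <= t * (1 - t) <= 1.
Proof.
move=> /andP[t0 t1]; rewrite mulr_ge0 ?subr_ge0//= -[leRHS]mulr1.
by rewrite ler_pM// ?subr_ge0// gerBl.
Qed.

Lemma bump01 (t : R) : 0 <= t <= 1 -> 0 <= bump t <= 1.
Proof.
move=> /id01 /andP[h0 h1]; rewrite /bump mulr_ge0//= -[leRHS]mulr1.
by rewrite ler_pM.
Qed.

Lemma edge_H1_bump : edge_H1 bump dbump.
Proof.
have q2 : edge2 (fun t => (0 + 1 * t) * (1 + -1 * t))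
    (fun t => (0 + 1 * t) * -1 + (1 + -1 * t) * 1 : R).
  split; first exact: edge2_mul (edge2_affine 0 1) (edge2_affine 1 (-1)).
  apply: (@le_lt_trans _ _ 1%:E); last exact: ltry.
  apply: edge_int_le_cst.
    apply: measurable_funX; apply: measurable_funD; apply: measurable_funM => //;
    exact: measurable_affine.
  move=> t /andP[t0 t1]; rewrite sqr_ge0/=.
  have -> : (0 + 1 * t) * -1 + (1 + -1 * t) * 1 = 1 - 2 * t by ring.
  by rewrite -real_normK ?num_real// exprn_ile1// ler_norml; lra.
have := edge2_mul q2 q2.
set f := (fun t => _); set g := (fun t => _).
have -> : f = bump by apply/funext => t; rewrite /f /bump; ring.
have -> // : g = dbump by apply/funext => t; rewrite /g /dbump; ring.
Qed.

Definition bump_edge : gfun R := fun e t => if e == (Bot, 0) then bump t else 0.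
Definition dbump_edge : gfun R := fun e t => if e == (Bot, 0) then dbump t else 0.

Lemma edge_H1_bump_edge e : edge_H1 (bump_edge e) (dbump_edge e).
Proof.
rewrite /bump_edge /dbump_edge; case: (e == _); first exact: edge_H1_bump.
have [h _] := edge2_affine (0 : R) 0.
have E : (fun t : R => 0 + 0 * t) = (fun=> 0) by apply/funext => t; ring.
by rewrite E in h.
Qed.

Lemma window0 e : (e == (Bot, 0)) -> (- 0%:Z - 1 < e.2) && (e.2 <= 0%:Z).
Proof. by move=> /eqP ->. Qed.

Lemma isH1_bump_edge : isH1 bump_edge dbump_edge.
Proof.
have b0 : bump 0 = 0 by rewrite /bump mul0r mulr0.
have b1 : bump 1 = 0 by rewrite /bump subrr !mulr0.
have E0 e : bump_edge e 0 = 0 by rewrite /bump_edge b0 if_same.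
have E1 e : bump_edge e 1 = 0 by rewrite /bump_edge b1 if_same.
have md e : measurable_fun I (dbump_edge e) by case: (edge_H1_bump_edge e).
have mb e := edge_H1_measurable (edge_H1_bump_edge e).
apply: isH1_intro.
- by move=> k; rewrite !E0 !E1.
- exact: edge_H1_bump_edge.
- apply: (gJ_window (J := 0) ler01 (gnn_sq mb) _).1 => e t t01.
  rewrite /gsq /bump_edge; have [/window0 ->|_] := boolP (e == _).
    by have /andP[h0 h1] := bump01 t01; rewrite exprn_ile1.
  by rewrite expr0n/=; case: ifP.
- have z4 : 0 <= 4 :> R by [].
  apply: (gJ_window (J := 0) z4 (gnn_sq md) _).1 => e t t01.
  rewrite /gsq /dbump_edge; have [/window0 ->|_] := boolP (e == _).
    have /andP[h0 h1] := id01 t01; have /andP[t0 t1] := t01.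
    have -> : dbump t ^+ 2 = 4 * ((t * (1 - t)) ^+ 2 * (1 - 2 * t) ^+ 2) by rewrite /dbump; ring.
    have s1 : (1 - 2 * t) ^+ 2 <= 1.
      by rewrite -real_normK ?num_real// exprn_ile1// ler_norml; lra.
    have s2 : (t * (1 - t)) ^+ 2 <= 1 by rewrite exprn_ile1.
    by rewrite ler_piMr// mulr_ile1// sqr_ge0.
  by rewrite expr0n/=; case: ifP.
Qed.

Lemma integrable_pow_edge a b :
  mu.-integrable I (EFin \o (fun t : R => t ^+ a * (1 - t) ^+ b)).
Proof.
apply: measurable_bounded_integrable => //.
- by rewrite [X in (X < _)%E]muI01 ltry.
- apply: measurable_funM; apply: measurable_funX => //.
  by apply: measurable_funB.
- exists 1; split; first exact: num_real.
  move=> M M1 t /inI01 /andP[t0 t1] /=; apply: le_trans (ltW M1).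
  rewrite normrM !normrX !ger0_norm ?subr_ge0//.
  by rewrite mulr_ile1 ?exprn_ge0 ?exprn_ile1 ?subr_ge0// gerBl.
Qed.

Lemma bump_mass : gJ (gsq bump_edge) = 630^-1.
Proof.
rewrite (@gJ_single _ (Bot, 0)); [|exact: isH1_fin isH1_bump_edge|]; last first.
  by move=> e t /negbTE ee _; rewrite /gsq /bump_edge ee expr0n.
transitivity (\int[mu]_(t in I) (t ^+ 4 * (1 - t) ^+ 4)).
  by apply: eq_Rintegral => t _; rewrite /gsq /bump_edge eqxx /bump; ring.
by rewrite beta_edge !factS fact0 !natrM; field.
Qed.

Lemma bump_dirichlet : gJ (gsq dbump_edge) = 2 / 105.
Proof.
rewrite (@gJ_single _ (Bot, 0)); [|exact: isH1_fin_der isH1_bump_edge|]; last first.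
  by move=> e t /negbTE ee _; rewrite /gsq /dbump_edge ee expr0n.
transitivity (\int[mu]_(t in I) (4 * (t ^+ 2 * (1 - t) ^+ 2) - 16 * (t ^+ 3 * (1 - t) ^+ 3))).
  by apply: eq_Rintegral => t _; rewrite /gsq /dbump_edge eqxx /dbump; ring.
have i2 := integrable_pow_edge 2 2; have i3 := integrable_pow_edge 3 3.
rewrite RintegralB//; [|exact: rintegrableZ|exact: rintegrableZ].
by rewrite RintegralZl// RintegralZl// !beta_edge !factS fact0 !natrM; field.
Qed.

(* The two sides are 12! 12! / 25! with f the factorial; f is kept abstract because
   unary factorials of this size must not be computed. *)
Lemma central_beta (f : nat -> R) (f0 : f 0%N = 1) (fS : forall n, f n.+1 = n.+1%:R * f n) :
   (25 * (4 * 7 * 13 * 17 * 19 * 23))^-1 = f 12 * f 12 / f 25.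
Proof. 
have h : f 25 = 25 * 24 * 23 * 22 * 21 * 20 * 19 * 18 * 17 * 16 * 15 * 14 * 13 * f 12.
  rewrite (fS 24) (fS 23) (fS 22) (fS 21) (fS 20) (fS 19) (fS 18) (fS 17) (fS 16) (fS 15) (fS 14) (fS 13) (fS 12).
  by rewrite !mulrA.
have h12 : f 12 = 12 * 11 * 10 * 9 * 8 * 7 * 6 * 5 * 4 * 3 * 2.
  rewrite !fS f0 !mulrA !mulr1. by [].
have n12 : f 12 != 0 by rewrite h12; apply/eqP; lra.
rewrite h.
have -> : f 12 * f 12 / (25 * 24 * 23 * 22 * 21 * 20 * 19 * 18 * 17 * 16 * 15 * 14 * 13 * f 12)
 = f 12 / (25 * 24 * 23 * 22 * 21 * 20 * 19 * 18 * 17 * 16 * 15 * 14 * 13) by field.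
rewrite h12.
have -> : 25 * 24 * 23 * 22 * 21 * 20 * 19 * 18 * 17 * 16 * 15 * 14 * 13 = (12 * 11 * 10 * 9 * 8 * 7 * 6 * 5 * 4 * 3 * 2 )* (25 * (4 * 7 * 13 * 17 * 19 * 23)) :> R by ring.
by field.
Qed.

(** As the bump takes values in [0, 1], its powers decrease in the exponent, so p = 6 is the worst
    case and gives the Beta value B(13, 13). *)
Lemma bump_potential p : 2 < p -> p <= 6 ->
  (25 * (4 * 7 * 13 * 17 * 19 * 23))^-1 <= gJ (gpow p bump_edge).
Proof.
move=> p2 p6; have fp := isH1_fin_pow p2 isH1_bump_edge.
apply: le_trans (gE_le_gJ (Bot, 0) fp).
have -> : (25 * (4 * 7 * 13 * 17 * 19 * 23))^-1 = \int[mu]_(t in I) (t ^+ 12 * (1 - t) ^+ 12).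
  rewrite beta_edge.
  have fS n : n.+1`!%:R = n.+1%:R * n`!%:R :> R by rewrite factS natrM.
  exact: (@central_beta (fun n => n`!%:R) (erefl _) fS).
apply: le_Rintegral => //.
- exact: integrable_pow_edge.
- exact: gfin_integrable fp.
- move=> t /inI01 t01; rewrite /gpow /bump_edge eqxx.
  have /andP[b0 b1] := bump01 t01.
  have -> : t ^+ 12 * (1 - t) ^+ 12 = bump t ^+ 6 by rewrite /bump; ring.
  rewrite ger0_norm//; have [->|bN0] := eqVneq (bump t) 0.
    by rewrite expr0n/= powR_ge0.
  rewrite -powR_mulrn//; apply: ger_powR => //.
  by rewrite b1 lt_def bN0 b0.
Qed.

Lemma Energy_scale p u g c : 2 < p -> isH1 u g -> 0 <= c ->
  Energy p (fun e t => c * u e t) (fun e t => c * g e t) =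
  2^-1 * (c ^+ 2 * gJ (gsq g)) - p^-1 * (c `^ p * gJ (gpow p u)).
Proof.
move=> p2 hu c0; rewrite EnergyE (gJ_pow_scale p2 hu c0).
by rewrite (@gJ_sq_scale _ g)//; exact: isH1_fin_der hu.
Qed.

Lemma concentrated_energy p : 6 - 1 / 4000 <= p -> p <= 6 ->
  exists u g, [/\ isH1 u g, gJ (gsq u) = 81 / 25 & Energy p u g <= -1].
Proof.
move=> pG p6; have p2 : 2 < p by lra.
(* The bump has mass 1 / 630, so mass 81 / 25 requires c ^ 2 = 729 (14 / 5). Since c <= 46, the
   exponent loss is at most the factor 1 - 46 / 4000. *)
pose r : R := Num.sqrt (14 / 5); pose c := 27 * r.
have r2 : r ^+ 2 = 14 / 5 by rewrite sqr_sqrtr ?divr_ge0.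
have r0 : 0 < r by rewrite sqrtr_gt0 divr_gt0.
have r17 : r <= 17 / 10.
  by rewrite -(@ler_pXn2r _ 2) ?nnegrE ?divr_ge0 ?(ltW r0)// r2; lra.
have c0 : 0 < c by rewrite mulr_gt0.
have c46 : c <= 46 by rewrite /c; lra.
have c2 : c ^+ 2 = 729 * (14 / 5) by rewrite exprMn r2; ring.
exists (fun e t => c * bump_edge e t), (fun e t => c * dbump_edge e t).
have hb := isH1_bump_edge; split; first exact: isH1_scale.
  by rewrite gJ_sq_scale ?bump_mass ?c2; [field|exact: isH1_fin hb].
rewrite (Energy_scale p2 hb (ltW c0)) bump_dirichlet c2.
have cp : c ^+ 6 * (1 - 46 / 4000) <= c `^ p.
  have -> : p = 6 + - (6 - p) by ring.
  rewrite powRD; last by rewrite (gt_eqF c0) implybT.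
  rewrite powR_mulrn ?(ltW c0)// ler_wpM2l ?exprn_ge0 ?(ltW c0)//.
  apply: le_trans (powRN_ge c0 _); last by lra.
  by rewrite lerD2l lerN2; nra.
have c6 : c ^+ 6 = (729 * (14 / 5)) ^+ 3 by rewrite -c2 -exprM.
have L := bump_potential p2 p6.
rewrite c6 in cp; clear -cp L pG p6.
move: (c `^ p) (gJ _) cp L => X P hX hP.
(* The product is about 125.8 at p = 6. The Dirichlet half is 19.44 and 123 / 6 = 20.5, so the
   energy falls below -1. *)
have XP : 123 <= X * P.
  apply: le_trans (ler_pM _ _ hX hP); [|by lra|by rewrite invr_ge0; lra].
  by rewrite ler_pdivlMr; lra.
have pV : 6^-1 <= p^-1 by rewrite lef_pV2 ?posrE//; lra.
have : 6^-1 * 123 <= p^-1 * (X * P) by apply: ler_pM => //; lra.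
by lra.
Qed.

End Concentrated.

(** * Wide tents and negativity of the level at every mass *)

Section Wide.
Variable R : realType.

Lemma gE_ge (F : gfun R) e c : gfin F -> (forall t, 0 <= t <= 1 -> c <= F e t) -> c <= gE F e.
Proof.
move=> fF cF; rewrite -[leLHS]mulr1 -[X in c * X](subr0 (1 : R)) -Rintegral_cst_itv//.
apply: le_Rintegral => //; first exact: integrable_cst_itv.
exact: gfin_integrable fF.
Qed.

Variable N : nat.

(** Subtraction of natural numbers truncates at 0 and so gives the positive part. *)
Definition tent (k : int) : R := ((N - `|k|)%N)%:R.

Definition tent_fun : gfun R := fun e t =>
  if e.1 is Vert then tent e.2 + 0 * t
  else tent e.2 + (tent (e.2 + 1) - tent e.2) * t.
Definition dtent_fun : gfun R := fun e t =>
  if e.1 is Vert then 0 else tent (e.2 + 1) - tent e.2.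

Lemma tent01 k : 0 <= tent k <= N%:R.
Proof. by rewrite /tent ler0n ler_nat leq_subr. Qed.

Lemma tent_slope (k : int) : -1 <= tent (k + 1) - tent k <= 1.
Proof.
have h1 : tent k <= tent (k + 1) + 1 by rewrite natr1 ler_nat; lia.
have h2 : tent (k + 1) <= tent k + 1 by rewrite natr1 ler_nat; lia.
by move: (tent _) (tent _) h1 h2 => a b; lra.
Qed.

Lemma tent_out (k : int) : ~~ ((- N%:Z - 1 < k) && (k <= N%:Z)) -> tent k = 0 /\ tent (k + 1) = 0.
Proof. by move=> h; rewrite /tent; split; apply/eqP; rewrite pnatr_eq0; lia. Qed.

Lemma edge2_tent e : edge2 (tent_fun e) (dtent_fun e).
Proof. by case: e => -[] k; exact: edge2_affine. Qed.

Lemma tent_fun_bound e t : 0 <= t <= 1 ->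
  0 <= tent_fun e t <= if (- N%:Z - 1 < e.2) && (e.2 <= N%:Z) then N%:R else 0.
Proof.
move=> t01; case: ifPn => h; case: e h => x k /= h.
  have := tent01 k; have := tent01 (k + 1); rewrite /tent_fun /=.
  move: (tent _) (tent _) => a b; case: x; nra.
have [E1 E2] := tent_out h; rewrite /tent_fun/= E1 E2.
by case: x; rewrite ?subrr mul0r addr0 lexx.
Qed.

Lemma tent_mass : gfin (gsq tent_fun) /\
  gJ (gsq tent_fun) <= N%:R ^+ 2 * (size (window N))%:R.
Proof.
apply: gJ_window; first exact: sqr_ge0.
  by apply: gnn_sq => e; case: (edge2_tent e) => /edge_H1_measurable.
move=> e t /(tent_fun_bound e); rewrite /gsq; case: ifP => _ /andP[h0 h1].
  by rewrite lerXn2r ?nnegrE// ler0n.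
by rewrite (le_anti (introT andP (conj h1 h0))) expr0n.
Qed.

Lemma tent_dirichlet : gfin (gsq dtent_fun) /\
  gJ (gsq dtent_fun) <= 1 * (size (window N))%:R.
Proof.
apply: gJ_window => //.
  by apply: gnn_sq => e; case: (edge2_tent e) => -[].
move=> [x k] t _; rewrite /gsq /dtent_fun /=; case: ifPn => h.
  have := tent_slope k; case: x; rewrite ?expr0n//= -ler_norml => h1.
    by rewrite -real_normK ?num_real// exprn_ile1.
  by rewrite -real_normK ?num_real// exprn_ile1.
by have [-> ->] := tent_out h; case: x; rewrite ?subrr expr0n.
Qed.

Lemma isH1_tent : isH1 tent_fun dtent_fun.
Proof.
apply: isH1_intro; [|by move=> e; case: (edge2_tent e)|exact: tent_mass.1|exact: tent_dirichlet.1].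
move=> k; rewrite /tent_fun/= !mulr0 !mul0r !addr0 !mulr1 subrK.
by have -> : tent (k - 1) + (tent k - tent (k - 1)) = tent k by ring.
Qed.

Lemma size_window J : (size (window J) = 3 * (J + J).+1)%N.
Proof. by rewrite size_allpairs size_iota. Qed.

(* The tent is at least n on the n edges (Bot, 0), ..., (Bot, n - 1). *)
Lemma tent_lower (F : gfun R) (n : nat) (c : R) : N = (2 * n)%N -> gfin F ->
  (forall e t, n%:R <= tent_fun e t -> c <= F e t) -> n%:R * c <= gJ F.
Proof.
move=> Nn fF cF; pose s := [seq (Bot, i%:Z) | i <- iota 0 n].
have us : uniq s by rewrite map_inj_uniq ?iota_uniq// => i j [].
apply: le_trans (gsum_le_gJ fF us).
have -> : n%:R * c = \sum_(e <- s) c.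
  by rewrite big_const_seq count_predT size_map size_iota iter_addr_0 mulr_natl.
rewrite [leLHS]big_seq [leRHS]big_seq.
apply: ler_sum => e /mapP[i]; rewrite mem_iota => /andP[_ ni] ->.
apply: gE_ge => // t t01; apply: cF; rewrite /tent_fun /=.
have a1 : n%:R <= tent i by rewrite /tent ler_nat; lia.
have a2 : n%:R <= tent (i%:Z + 1) by rewrite /tent ler_nat; lia.
by move: (tent _) (tent _) a1 a2 => a b; nra.
Qed.

End Wide.

Section WideEnergy.
Variable R : realType.

Lemma powR_unbounded (s K : R) : 0 < s -> exists n : nat, K < n.+1%:R `^ s.
Proof.
move=> s0; pose K1 := `|K| + 1.
have K10 : 0 < K1 by rewrite ltr_wpDl.
have KK1 : K < K1 by rewrite ltr_pwDr// ler_norm.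
exists (Num.trunc (K1 `^ s^-1)); apply: lt_le_trans KK1 _.
have h : K1 `^ s^-1 <= (Num.trunc (K1 `^ s^-1)).+1%:R by apply: ltW; exact: truncnS_gt.
apply: le_trans (ge0_ler_powR (ltW s0) _ _ h); rewrite ?nnegrE ?powR_ge0//.
by rewrite -powRrM mulVf ?gt_eqF// powRr1// ltW.
Qed.

(** Before normalisation a tent of width n has mass of order n ^ 3, Dirichlet energy at most of
    order n and potential at least n ^ (p + 1). At mass mu the Dirichlet term is at most of order n
    ^ -2 and the potential at least of order n ^ (1 - p / 2), which wins because p < 6. *)
Lemma wide_energy (p mu : R) : 2 < p -> p < 6 -> 0 < mu ->
  exists u g, [/\ isH1 u g, gJ (gsq u) = mu & Energy p u g < 0].
Proof.
move=> p2 p6 mu0; pose r := p / 2; pose b := mu / 72.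
have b0 : 0 < b by rewrite divr_gt0.
have r3 : 0 < 3 - r by rewrite /r; lra.
(* After multiplication by x ^ 2, half the Dirichlet term is at most 9 mu and the potential at least
   b ^ r x ^ (3 - r); b = mu / 72 comes from the mass bound 72 x ^ 3. *)
have [n0 hn] := powR_unbounded (9 * mu * p / b `^ r) r3.
rewrite ltr_pdivrMr ?powR_gt0// in hn.
set n := n0.+1 in hn; pose x : R := n%:R.
have x1 : 1 <= x by rewrite ler1n.
have x0 : 0 < x by lra.
have hT := @isH1_tent R (2 * n)%N.
have [fm mle] := @tent_mass R (2 * n)%N.
have [_ Dle] := @tent_dirichlet R (2 * n)%N.
have wE : (size (window (2 * n)))%:R <= 15 * x.
  by rewrite size_window /x -natrM ler_nat; lia.
set u := tent_fun _ in hT fm mle; set g := dtent_fun _ in hT Dle.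
have P0 : gfin (gpow p u) := isH1_fin_pow p2 hT.
have mge : x * x ^+ 2 <= gJ (gsq u).
  apply: (tent_lower (N := (2 * n)%N)) => // e t h; rewrite /gsq lerXn2r// nnegrE ?ler0n//.
  by apply: le_trans h; rewrite ler0n.
have Pge : x * x `^ p <= gJ (gpow p u).
  apply: (tent_lower (N := (2 * n)%N)) => // e t h; rewrite /gpow ge0_ler_powR ?nnegrE ?ler0n//.
    by lra.
  by apply: le_trans h (ler_norm _).
have {}mle : gJ (gsq u) <= 72 * x ^+ 3.
  apply: le_trans mle _; apply: le_trans (ler_wpM2l (sqr_ge0 _) wE) _.
  rewrite natrM -/x; have -> : (2 * x) ^+ 2 * (15 * x) = 60 * x ^+ 3 by ring.
  by rewrite ler_wpM2r ?exprn_ge0 ?(ltW x0)// ler_nat.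
have {}Dle : gJ (gsq g) <= 18 * x.
  by apply: le_trans Dle _; lra.
have m0 : 0 < gJ (gsq u) by apply: lt_le_trans mge; rewrite mulr_gt0// exprn_gt0.
pose c := Num.sqrt (mu / gJ (gsq u)).
have c2 : c ^+ 2 = mu / gJ (gsq u) by rewrite sqr_sqrtr// ltW// divr_gt0.
have c0 : 0 < c by rewrite sqrtr_gt0 divr_gt0.
exists (fun e t => c * u e t), (fun e t => c * g e t); split; first exact: isH1_scale.
  by rewrite gJ_sq_scale// c2 divfK// gt_eqF.
rewrite (Energy_scale p2 hT (ltW c0)).
have cD : x ^+ 2 * (c ^+ 2 * gJ (gsq g)) <= 18 * mu.
  have h1 : c ^+ 2 * x ^+ 3 <= mu.
    by rewrite c2 mulrAC ler_pdivrMr// ler_wpM2l ?(ltW mu0)// exprS.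
  have h2 : x ^+ 2 * (c ^+ 2 * gJ (gsq g)) <= x ^+ 2 * (c ^+ 2 * (18 * x)).
    by rewrite ler_wpM2l ?sqr_ge0// ler_wpM2l ?sqr_ge0.
  apply: le_trans h2 _; have -> : x ^+ 2 * (c ^+ 2 * (18 * x)) = 18 * (c ^+ 2 * x ^+ 3) by ring.
  by rewrite ler_wpM2l.
have cP : b `^ r * x `^ (3 - r) <= x ^+ 2 * (c `^ p * gJ (gpow p u)).
  apply: (@le_trans _ _ (x ^+ 2 * (c `^ p * (x * x `^ p)))); last first.
    by rewrite ler_wpM2l ?sqr_ge0// ler_wpM2l// powR_ge0.
  have -> : c `^ p * (x * x `^ p) = x * (c * x) `^ p by rewrite powRM ?ltW//; ring.
  have -> : (c * x) `^ p = ((c * x) ^+ 2) `^ r.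
    by rewrite -powR_mulrn ?mulr_ge0 ?ltW// -powRrM /r; congr (_ `^ _); field.
  have -> : b `^ r * x `^ (3 - r) = x ^+ 2 * (x * (b / x) `^ r).
    rewrite powRM ?invr_ge0 ?(ltW b0) ?(ltW x0)//.
    rewrite powRD; last by rewrite (gt_eqF x0) implybT.
    rewrite -(powR_inv1 (ltW x0)) -powRrM mulN1r.
    by rewrite powR_mulrn ?(ltW x0)//; ring.
  rewrite ler_wpM2l ?sqr_ge0// ler_wpM2l ?(ltW x0)// ge0_ler_powR ?nnegrE ?sqr_ge0//.
  - by rewrite /r; lra.
  - by rewrite divr_ge0 ?ltW.
  rewrite exprMn c2 /b ler_pdivrMr// mulrAC -mulrA -mulrA ler_wpM2l ?(ltW mu0)//.
  rewrite mulrC ler_pdivlMr// ler_pdivrMl//; move: mle; rewrite exprS; lra.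
have x20 : 0 < x ^+ 2 by rewrite exprn_gt0.
rewrite -(pmulr_rlt0 _ x20) mulrBr subr_lt0.
have p0 : 0 < p by lra.
rewrite [X in _ < X]mulrCA [X in _ < X]mulrC ltr_pdivlMr//.
apply: lt_le_trans cP; rewrite (mulrC (b `^ r)); apply: le_lt_trans hn.
rewrite ler_wpM2r ?(ltW p0)// mulrCA ler_pdivrMl//; apply: le_trans cD _.
by rewrite mulrA -natrM.
Qed.

End WideEnergy.

(** * Two minimizers at a critical mass *)

Section Gap.
Variable R : realType.

(** For 0 <= r <= 3 the power lies between 1 and k ^ 3, and k ^ 2 + k + 1 <= 7 when k <= 2. *)
Lemma powR_near1 (k r : R) : 0 < k -> k <= 2 -> 0 <= r -> r <= 3 ->
  `|k `^ r - 1| <= 7 * `|k - 1|.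
Proof.
move=> k0 k2 r0 r3; have [k1|k1] := leP 1 k.
  have h1 : 1 <= k `^ r.
    have := @ge0_ler_powR R r r0 1 k; rewrite !nnegrE powR1; apply => //.
    exact: ltW.
  have h3 : k `^ r <= k ^+ 3 by rewrite -powR_mulrn ?(ltW k0)// ler_powR.
  have h7 : k ^+ 3 - 1 <= 7 * (k - 1).
    have -> : k ^+ 3 - 1 = (k - 1) * (k * k + k + 1) by ring.
    by rewrite mulrC ler_wpM2r ?subr_ge0//; nra.
  rewrite !ger0_norm ?subr_ge0//; lra.
have h1 : k `^ r <= 1.
  have := @ge0_ler_powR R r r0 k 1; rewrite !nnegrE powR1.
  by apply => //; exact: ltW.
have h3 : k ^+ 3 <= k `^ r by rewrite -powR_mulrn ?(ltW k0)// ger_powR// k0 ltW.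
have h7 : 1 - k ^+ 3 <= 7 * (1 - k).
  have -> : 1 - k ^+ 3 = (1 - k) * (k * k + k + 1) by ring.
  by rewrite mulrC ler_wpM2r ?subr_ge0 ?(ltW k1)//; nra.
rewrite [X in X <= _]distrC [in leRHS]distrC !ger0_norm ?subr_ge0 ?(ltW k1)//; lra.
Qed.

(* With delta = 1/200, a function of mass at most (9/5)^2 and Dirichlet energy at
   most delta^4 is bounded by 0.96 delta, by sup_bound_spread with r = 0.95 delta
   and s = 5/9 delta^2. *)
Definition gap_level : R := (1 / 200) ^+ 4.

Lemma gap_level_gt0 : 0 < gap_level. Proof. by apply: exprn_gt0; rewrite mul1r invr_gt0 ltr0n. Qed.

(** The uniform bound M gives potential at most M ^ (p - 2) times the mass, and M ^ (p - 2) = M ^ 4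
    / M ^ (6 - p) with M ^ (6 - p) >= 1 - 625 / 12000. Numerically 0.96 ^ 4 times 3.24 over that
    factor is about 2.90; the constant 59 / 20 is still below p / 2. *)
Lemma potential_small p (u g : gfun R) : 6 - 1 / 4000 <= p -> p <= 6 -> isH1 u g ->
  gJ (gsq u) <= 81 / 25 -> gJ (gsq g) <= gap_level ->
  gJ (gpow p u) <= 59 / 20 * gap_level.
Proof.
move=> pG p6 hu um gd; have p2 : 2 < p by lra.
pose M : R := 3 / 625; have M0 : 0 < M by apply: divr_gt0; rewrite ltr0n.
have uM e t : 0 <= t <= 1 -> `|u e t| <= M.
  move=> t01; pose s : R := 5 / 9 * (1 / 200) ^+ 2.
  have s0 : 0 < s by rewrite mulr_gt0 ?exprn_gt0 ?divr_gt0.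
  have := @sup_bound_spread _ u g e t s (19 / 4000) ((1 / 200) ^+ 2) hu s0.
  have -> : 19 / 4000 + 2 * (1 / 200) ^+ 2 = M by rewrite /M; field.
  have q0 : 0 <= 19 / 4000 :> R by apply: divr_ge0; rewrite ler0n.
  move=> /(_ q0 (sqr_ge0 _) t01); rewrite -exprM => /(_ gd); apply.
  have h1 : s * gJ (gsq u) <= s * (81 / 25) by rewrite ler_wpM2l ?(ltW s0).
  have h2 : s^-1 * gJ (gsq g) <= s^-1 * gap_level by rewrite ler_wpM2l ?invr_ge0 ?(ltW s0).
  have E : s^-1 * gap_level = 9 / 5 * (1 / 200) ^+ 2 by rewrite /s /gap_level; field.
  by apply: le_trans (lerD h1 h2) _; rewrite E /s; lra.
have [_ PM] := gpow_bound p2 uM (isH1_measurable hu) (isH1_fin hu).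
have e0 : 0 <= 6 - p by lra.
have h := @powRN_ge R M^-1 (6 - p); rewrite invr_gt0 in h; have {}h := h M0 e0.
have MV : M^-1 `^ (- (6 - p)) = M `^ (6 - p).
  by rewrite -(powR_inv1 (ltW M0)) -powRrM mulrNN mul1r.
have M4 : M `^ (p - 2) * M `^ (6 - p) = M ^+ 4.
  rewrite -powRD; last by rewrite (gt_eqF M0) implybT.
  by rewrite -powR_mulrn ?(ltW M0)//; congr (_ `^ _); ring.
rewrite MV in h; apply: le_trans PM _.
apply: le_trans (ler_wpM2l (powR_ge0 _ _) um) _.
have X0 : 0 <= M `^ (p - 2) by exact: powR_ge0.
have h5 : 1 - 625 / 12000 <= M `^ (6 - p).
  by apply: le_trans h; rewrite /M; lra.
have h6 : M `^ (p - 2) * (1 - 625 / 12000) <= M ^+ 4 by rewrite -M4 ler_wpM2l.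
by move: h6; rewrite /gap_level /M; lra.
Qed.

Lemma energy_gap p (u g : gfun R) : 6 - 1 / 4000 <= p -> p <= 6 -> isH1 u g ->
  gJ (gsq u) <= 81 / 25 -> gJ (gsq g) = gap_level -> 0 < Energy p u g.
Proof.
move=> pG p6 hu um gd; have := potential_small pG p6 hu um.
rewrite EnergyE gd lexx => /(_ isT); move: (gJ (gpow p u)) => P PM.
have d0 := gap_level_gt0; rewrite subr_gt0 ltr_pdivrMl; last by lra.
by apply: le_lt_trans PM _; move: gap_level d0 => d d0; nra.
Qed.

(** The bound -1 / 2 stays clear of the energy -1 reached by the bump, which leaves room for
    near-minimizers. *)
Lemma energy_above p (u g : gfun R) : 6 - 1 / 4000 <= p -> p <= 6 -> isH1 u g ->
  gJ (gsq u) <= 81 / 25 -> gJ (gsq g) <= gap_level -> - (1 / 2) < Energy p u g.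
Proof.
move=> pG p6 hu um gd; have := potential_small pG p6 hu um gd.
have D0 := gJ_ge0 (isH1_gnn_der hu).
rewrite EnergyE; move: (gJ _) (gJ (gpow p u)) D0 => D P D0 PM.
have d1 : gap_level <= 1 / 10.
  rewrite /gap_level; lra.
have : p^-1 * P < 1 / 2 by rewrite ltr_pdivrMl; lra.
by lra.
Qed.

End Gap.

(** * Scaling between nearby masses and continuity of the level *)

Section EnergyScaling.
Variable R : realType.

(** Scaling by sqrt k multiplies the Dirichlet term by k and the potential by k ^ (p / 2); both
    factors are within 7 |k - 1| of 1, uniformly for terms bounded by B. *)
Lemma scale_close (p B eps : R) : 4 <= p -> p < 6 -> 0 <= B -> 0 < eps -> exists2 eta, 0 < eta &
  forall k (u g : gfun R), `|k - 1| <= eta -> isH1 u g ->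
    gJ (gsq g) <= B -> gJ (gpow p u) <= B ->
    exists v h, [/\ isH1 v h, gJ (gsq v) = k * gJ (gsq u),
      `|Energy p v h - Energy p u g| <= eps &
      `|gJ (gsq h) - gJ (gsq g)| <= eps].
Proof.
move=> p4 p6 B0 e0; have p2 : 2 < p by lra.
pose eta := Num.min (1 / 2) (eps / (8 * (B + 1))).
have B1 : 0 < 8 * (B + 1) by rewrite mulr_gt0// ltr_wpDl.
exists eta; first by rewrite lt_min !divr_gt0.
move=> k u g; rewrite le_min => /andP[k2 kB] hu DB PB.
have k0 : 0 < k by move: k2; rewrite ler_norml => /andP[]; lra.
have k22 : k <= 2 by move: k2; rewrite ler_norml => /andP[]; lra.
have c0 : 0 <= Num.sqrt k by exact: sqrtr_ge0.
have c2 : Num.sqrt k ^+ 2 = k by rewrite sqr_sqrtr ?(ltW k0).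
exists (fun e t => Num.sqrt k * u e t), (fun e t => Num.sqrt k * g e t).
split; first exact: isH1_scale.
- by rewrite gJ_sq_scale ?c2//; exact: isH1_fin hu.
- rewrite (Energy_scale p2 hu c0) c2 EnergyE.
  have -> : Num.sqrt k `^ p = k `^ (p / 2).
    by rewrite -{2}c2 -powR_mulrn// -powRrM; congr (_ `^ _); field.
  have := @powR_near1 R k (p / 2) k0 k22.
  have D0 := gJ_ge0 (isH1_gnn_der hu).
  have P0 := gJ_ge0 (gnn_pow p (isH1_measurable hu)).
  move: (gJ _) (gJ (gpow p u)) D0 P0 DB PB => D P D0 P0 DB PB.
  have r0 : 0 <= p / 2 by lra.
  have r3 : p / 2 <= 3 by lra.
  move=> /(_ r0 r3); move: (k `^ _) => Q hQ.
  have pV : 0 <= p^-1 <= 1 / 4.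
    by rewrite invr_ge0 -[1 / 4]invrK lef_pV2 ?posrE ?invr_gt0//; lra.
  have -> : 2^-1 * (k * D) - p^-1 * (Q * P) - (2^-1 * D - p^-1 * P) =
     2^-1 * ((k - 1) * D) - p^-1 * ((Q - 1) * P) by ring.
  apply: le_trans (ler_normB _ _) _; rewrite !normrM (ger0_norm D0) (ger0_norm P0).
  move: kB; rewrite ler_pdivlMr//.
  rewrite (ger0_norm (_ : 0 <= p^-1)); last by case/andP: pV.
  rewrite (ger0_norm (_ : 0 <= 2^-1))//.
  have a0 := normr_ge0 (k - 1); have b0 := normr_ge0 (Q - 1).
  move: (`|k - 1|) (`|Q - 1|) (p^-1) a0 b0 hQ pV => a b s a0 b0 ba /andP[s0 s4] aB.
  have h1 : a * D <= a * B by rewrite ler_wpM2l.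
  have h2 : s * (b * P) <= 1 / 4 * (7 * a * B).
    by rewrite ler_pM ?mulr_ge0// ler_pM.
  by nra.
- rewrite gJ_sq_scale ?c2//; last exact: isH1_fin_der hu.
  have -> : k * gJ (gsq g) - gJ (gsq g) = (k - 1) * gJ (gsq g) by ring.
  have D0 := gJ_ge0 (isH1_gnn_der hu).
  rewrite normrM (ger0_norm D0); move: kB; rewrite ler_pdivlMr//.
  move: (gJ _) D0 DB => D D0 DB; have a0 := normr_ge0 (k - 1).
  move: (`|k - 1|) a0 => a a0 aB.
  have h1 : a * D <= a * B by rewrite ler_wpM2l.
  by nra.
Qed.

Lemma energy_bounds (p mb : R) : 4 <= p -> p < 6 -> 0 < mb -> exists2 B, 0 <= B & forall u g : gfun R,
  isH1 u g -> gJ (gsq u) <= mb -> - B <= Energy p u g /\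
    (Energy p u g <= 1 -> gJ (gsq g) <= B /\ gJ (gpow p u) <= B).
Proof.
move=> p4 p6 mb0; have p2 : 2 < p by lra.
have [K K0 HK] := coercive p2 p6 mb0.
exists (4 * (1 + K)) => [|u g hu um]; first by rewrite mulr_ge0// addr_ge0.
have := HK _ _ hu um; rewrite EnergyE.
have D0 := gJ_ge0 (isH1_gnn_der hu).
have P0 := gJ_ge0 (gnn_pow p (isH1_measurable hu)).
have pV : 0 <= p^-1 <= 1 / 4.
  by rewrite invr_ge0 -[1 / 4]invrK lef_pV2 ?posrE ?invr_gt0//; lra.
move: (gJ _) (gJ (gpow p u)) (p^-1) D0 P0 pV => D P s D0 P0 /andP[s0 s4] PK.
have h2 : s * P <= 1 / 4 * P by rewrite ler_wpM2r.
by split; [lra|move=> ?; split; lra].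
Qed.

End EnergyScaling.

Section Level.
Variable R : realType.
Implicit Types (p m eps : R) (u v g h : gfun R).

(** The real counterpart of [Emin]; [level_has_inf] shows that it is not the default value of
    [inf]. *)
Definition level p m : R :=
  inf [set x | exists u g, [/\ isH1 u g, gJ (gsq u) = m & x = Energy p u g]].

Definition near_min p m eps u g : Prop :=
  [/\ isH1 u g, gJ (gsq u) = m & Energy p u g <= level p m + eps].

Lemma level_has_inf p m : 4 <= p -> p < 6 -> 0 < m ->
  has_inf [set x | exists u g, [/\ isH1 u g, gJ (gsq u) = m & x = Energy p u g]].
Proof.
move=> p4 p6 m0; have p2 : 2 < p by lra.
split.
  have [u [g [hu um _]]] := wide_energy p2 p6 m0.
  by exists (Energy p u g), u, g.
have [B _ HB] := energy_bounds p4 p6 m0.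
exists (- B) => _ [u [g [hu um ->]]].
by have [] := HB u g hu; rewrite ?um.
Qed.

Lemma level_le p u g : 4 <= p -> p < 6 -> 0 < gJ (gsq u) -> isH1 u g ->
  level p (gJ (gsq u)) <= Energy p u g.
Proof.
move=> p4 p6 m0 hu; apply: ge_inf; first exact: (level_has_inf p4 p6 m0).2.
by exists u, g.
Qed.

Lemma exists_near_min p m eps : 4 <= p -> p < 6 -> 0 < m -> 0 < eps ->
  exists u g, near_min p m eps u g.
Proof.
move=> p4 p6 m0 e0; have [_ [u [g [hu um ->]]] uE] := inf_adherent e0 (level_has_inf p4 p6 m0).
by exists u, g; split => //; exact: ltW.
Qed.

Lemma level_lt0 p m : 4 <= p -> p < 6 -> 0 < m -> level p m < 0.
Proof.
move=> p4 p6 m0; have p2 : 2 < p by lra.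
have [u [g [hu um uE]]] := wide_energy p2 p6 m0.
by apply: le_lt_trans uE; rewrite -um; apply: level_le; rewrite ?um.
Qed.

Lemma near_min_le p m eps eps' u g : eps <= eps' -> near_min p m eps u g ->
  near_min p m eps' u g.
Proof. by move=> ee [hu um uE]; split => //; apply: le_trans uE _; rewrite lerD2l. Qed.

Lemma near_min_bounds p mb : 4 <= p -> p < 6 -> 0 < mb -> exists2 B, 0 <= B &
  forall m eps u g, 0 < m -> m <= mb -> eps <= 1 -> near_min p m eps u g ->
    gJ (gsq g) <= B /\ gJ (gpow p u) <= B.
Proof.
move=> p4 p6 mb0; have [B B0 HB] := energy_bounds p4 p6 mb0; exists B => //.
move=> m eps u g m0 mm e1 [hu um uE]; apply: (HB u g hu _).2; first by rewrite um.
by have := level_lt0 p4 p6 m0; lra.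
Qed.

(** Here a and b are the levels at m and m0, and x, y, z, t the energies of the scaled u, of u, of a
    near-minimizer w at m0 and of the scaled w. Four steps of size d lead from x to b. *)
Lemma near_chain (a b x y z t d eps : R) : d <= eps / 4 -> y <= a + d -> z <= b + d ->
  `|x - y| <= d -> a <= t -> `|t - z| <= d -> x <= b + eps.
Proof.
by rewrite !ler_norml => h1 h2 h3 /andP[_ h4] h5 /andP[_ h6]; lra.
Qed.

(* Near-minimizers can be moved between nearby masses by scaling, in both
   directions, which makes the level continuous in the mass. *)
Lemma near_min_transfer p mb m0 eps : 4 <= p -> p < 6 -> 0 < m0 -> m0 <= mb -> 0 < eps ->
  exists2 eta, 0 < eta & exists2 delta, 0 < delta &
    forall m u g, m <= mb -> `|m - m0| <= eta -> near_min p m delta u g ->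
    exists v h, near_min p m0 eps v h /\ `|gJ (gsq h) - gJ (gsq g)| <= eps.
Proof.
move=> p4 p6 m00 m0b e0; have mb0 : 0 < mb by lra.
have [B B0 HB] := near_min_bounds p4 p6 mb0.
pose d := Num.min 1 (eps / 4); have d0 : 0 < d by rewrite lt_min ltr01 divr_gt0.
have d1 : d <= 1 by rewrite ge_min lexx.
have d4 : d <= eps / 4 by rewrite ge_min lexx orbT.
have dle : d <= eps by lra.
have [eta eta0 Heta] := scale_close p4 p6 B0 d0.
exists (Num.min (m0 / 2) (m0 / 2 * eta)); first by rewrite lt_min ?mulr_gt0 ?divr_gt0.
exists d => // m u g mb_m; rewrite le_min => /andP[c1 c2] nu.
have m2 : m0 / 2 <= m by move: c1; rewrite ler_norml => /andP[]; lra.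
have m_gt0 : 0 < m by lra.
have k1 : `|m0 / m - 1| <= eta.
  have -> : m0 / m - 1 = (m0 - m) / m by field; rewrite gt_eqF.
  rewrite normrM normfV (gtr0_norm m_gt0) ler_pdivrMr// distrC.
  by apply: le_trans c2 _; rewrite mulrC ler_wpM2l ?(ltW eta0).
have k2 : `|m / m0 - 1| <= eta.
  have -> : m / m0 - 1 = (m - m0) / m0 by field; rewrite gt_eqF.
  rewrite normrM normfV (gtr0_norm m00) ler_pdivrMr//.
  apply: le_trans c2 _; rewrite mulrC ler_wpM2l ?(ltW eta0)//; lra.
have [hu um uE] := nu.
have [w [f nw]] := exists_near_min p4 p6 m00 d0; have [hw wm wE] := nw.
have [Du Pu] := HB _ _ _ _ m_gt0 mb_m d1 nu.
have [Dw Pw] := HB _ _ _ _ m00 m0b d1 nw.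
have [v [h [hv vm vE vD]]] := Heta _ _ _ k1 hu Du Pu.
(* Scaling w to mass m bounds the level at m from above by nearly the level at m0; without it the
   scaled u would not be known to be near-minimal. *)
have [w' [f' [hw' wm' wE' _]]] := Heta _ _ _ k2 hw Dw Pw.
rewrite um divfK ?gt_eqF// in vm; rewrite wm divfK ?gt_eqF// in wm'.
exists v, h; split; last exact: le_trans vD dle.
split=> //.
have lm : level p m <= Energy p w' f' by rewrite -wm'; apply: level_le; rewrite ?wm'.
exact: near_chain d4 uE wE vE lm wE'.
Qed.

End Level.

Section Coexistence.
Variable R : realType.
Implicit Types (p m eps : R) (u v g h : gfun R).

(** Q records what is known of the Dirichlet energy at each tolerance; the tolerances 1 / (n + 1)
    supply a minimizing sequence that carries it to the limit. *)
Lemma minimizer_of_near_min p m (Q : R -> R -> Prop) : 4 <= p -> p < 6 -> 0 < m ->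
  (forall eps, 0 < eps -> exists u g, near_min p m eps u g /\ Q eps (gJ (gsq g))) ->
  exists u g, [/\ isH1 u g, gJ (gsq u) = m, Energy p u g = level p m &
    forall eps, 0 < eps -> exists eps' D,
      [/\ 0 < eps', eps' <= eps, Q eps' D & `|gJ (gsq g) - D| <= eps]].
Proof.
move=> p4 p6 m0 H.
have [B B0 HB] := near_min_bounds p4 p6 m0.
have inv0 (n : nat) : 0 < n.+1%:R^-1 :> R by rewrite invr_gt0.
have {}H n : exists ug : gfun R * gfun R, near_min p m n.+1%:R^-1 ug.1 ug.2 /\
    Q n.+1%:R^-1 (gJ (gsq ug.2)).
  by have [u [g h]] := H _ (inv0 n); exists (u, g).
have [ug Hug] := choice H.
have inv1 (n : nat) : n.+1%:R^-1 <= 1 :> R by rewrite invf_le1// ler1n.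
have invN (N n : nat) : (N <= n)%N -> n.+1%:R^-1 <= N.+1%:R^-1 :> R.
  by move=> Nn; rewrite lef_pV2 ?posrE// ler_nat.
have small eps : 0 < eps -> exists N : nat, forall n, (N <= n)%N -> n.+1%:R^-1 <= eps.
  move=> e0; exists (Num.trunc eps^-1) => n /invN h; apply: le_trans h _.
  by rewrite invf_ple ?posrE// ltW// truncnS_gt.
have [|||||u [g [hu um uE uD]]] := @minimizing_sequence_compact R p m (level p m) B p4 (ltW p6)
  m0 (level_lt0 p4 p6 m0) B0 _ (fun n => (ug n).1) (fun n => (ug n).2).
- by move=> u g hu um; rewrite -um; apply: level_le; rewrite ?um.
- by move=> n; have [[]] := Hug n.
- by move=> n; have [[]] := Hug n.
- by move=> n; have [nm _] := Hug n; have [] := HB _ _ _ _ m0 (lexx m) (inv1 n) nm.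
- move=> eps e0; have [N HN] := small eps e0; exists N => n Nn.
  by have [nm _] := Hug n; have [] := near_min_le (HN n Nn) nm.
exists u, g; split => // eps e0; have [N HN] := small eps e0.
have [n Nn nD] := uD eps N e0.
by exists n.+1%:R^-1, (gJ (gsq (ug n).2)); split => //; [exact: HN|have [] := Hug n].
Qed.

(* The mass m is the supremum of the masses in [ma, mb] having near-minimizers with
   Dirichlet energy at most d. *)
Lemma exists_critical_mass p d mb : 4 <= p -> p < 6 -> 0 < d -> 0 < mb ->
  (exists2 eps, 0 < eps & forall u g, near_min p mb eps u g -> d < gJ (gsq g)) ->
  exists m, [/\ 0 < m, m <= mb,
    (forall eps, 0 < eps ->
      exists u g, near_min p m eps u g /\ gJ (gsq g) <= d + eps) &
    (forall eps, 0 < eps ->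
      exists u g, near_min p m eps u g /\ d - eps <= gJ (gsq g))].
Proof.
move=> p4 p6 d0 mb0 [eb eb0 Hb]; have p2 : 2 < p by lra.
have [ms ms0 Hs] := @small_mass_energy R p d p2 p6 d0.
pose ma := Num.min ms mb; have ma0 : 0 < ma by rewrite lt_min ms0.
have mas : ma <= ms by rewrite ge_min lexx.
have mab : ma <= mb by rewrite ge_min lexx orbT.
pose A := [set m | [/\ ma <= m, m <= mb & forall eps, 0 < eps ->
  exists u g, near_min p m eps u g /\ gJ (gsq g) <= d]].
have Aa : A ma.
  (* A tolerance of half the modulus of the level keeps the energy negative, which at this small
     mass forces Dirichlet energy below d. *)
  split => // eps e0; pose e' := Num.min eps (- level p ma / 2).
  have l0 := level_lt0 p4 p6 ma0.
  have e'0 : 0 < e' by rewrite lt_min e0 divr_gt0// oppr_gt0.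
  have e'1 : e' <= eps by rewrite ge_min lexx.
  have e'2 : e' <= - level p ma / 2 by rewrite ge_min lexx orbT.
  have [u [g nu]] := exists_near_min p4 p6 ma0 e'0.
  exists u, g; split; first exact: near_min_le e'1 nu.
  have [hu um uE] := nu; rewrite leNgt; apply/negP => /ltW dD.
  have := Hs u g hu; rewrite um => /(_ mas dD) E0.
  by move: uE E0 l0 e'2; move: (Energy _ _ _) (level _ _) (e') => a b c; clear; lra.
have supA : has_sup A.
  by split; [exists ma|exists mb => m []].
pose m := sup A.
have mam : ma <= m by exact: (sup_upper_bound supA Aa).
have mmb : m <= mb by apply: ge_sup => [|x []//]; exists ma.
have m0 : 0 < m by lra.
exists m; split => // eps e0.
- have [eta eta0 [del del0 H]] := near_min_transfer p4 p6 m0 mmb e0.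
  have [m1 Am1 m1m] := sup_adherent eta0 supA.
  have [_ m1b /(_ del del0) [u [g [nu Du]]]] := Am1.
  have m1le : m1 <= m by exact: (sup_upper_bound supA Am1).
  have [|v [h [nv]]] := H m1 u g m1b _ nu.
    by rewrite ler_norml; move: m1m m1le; rewrite -/m; lra.
  rewrite ler_norml => /andP[_ hD]; exists v, h; split => //.
  by move: hD Du; move: (gJ _) (gJ _) => x y; clear; lra.
(* At m = mb the hypothesis on mb applies directly. Otherwise masses just above m lie outside A, so
   their near-minimizers have Dirichlet energy above d and can be scaled down to m. *)
- have [mE|mN] := eqVneq m mb.
    pose e' := Num.min eps eb; have e'0 : 0 < e' by rewrite lt_min e0.
    have e'1 : e' <= eps by rewrite ge_min lexx.
    have e'2 : e' <= eb by rewrite ge_min lexx orbT.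
    have [u [g nu]] := exists_near_min p4 p6 mb0 e'0.
    exists u, g; rewrite mE; split; first exact: near_min_le e'1 nu.
    by have /Hb dD := near_min_le e'2 nu; rewrite lerBlDr ltW// ltr_wpDr// ltW.
  have mlt : m < mb by rewrite lt_neqAle mN.
  have [eta eta0 [del del0 H]] := near_min_transfer p4 p6 m0 mmb e0.
  pose m1 := Num.min mb (m + eta).
  have m1b : m1 <= mb by rewrite ge_min lexx.
  have m1m : m < m1 by rewrite lt_min mlt ltrDl.
  have m1e : m1 <= m + eta by rewrite ge_min lexx orbT.
  have NA : ~ A m1 by move=> /(sup_upper_bound supA); rewrite leNgt m1m.
  have [e1 e10 He1] : exists2 e1, 0 < e1 & forall u g, near_min p m1 e1 u g -> d < gJ (gsq g).
    apply: contrapT => N; apply: NA; split => //; first lra.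
    move=> e1 e10; apply: contrapT => N1; apply: N; exists e1 => // u g nu.
    by rewrite ltNge; apply/negP => Dd; apply: N1; exists u, g.
  pose e' := Num.min del e1; have e'0 : 0 < e' by rewrite lt_min del0.
  have e'1 : e' <= del by rewrite ge_min lexx.
  have e'2 : e' <= e1 by rewrite ge_min lexx orbT.
  have m10 : 0 < m1 by lra.
  have [u [g nu]] := exists_near_min p4 p6 m10 e'0.
  have dD := He1 u g (near_min_le e'2 nu).
  have [|v [h [nv]]] := H m1 u g m1b _ (near_min_le e'1 nu).
    by rewrite ler_norml; lra.
  rewrite ler_norml => /andP[hD _]; exists v, h; split => //.
  by move: hD dD; move: (gJ _) (gJ _) => x y; clear; lra.
Qed.

Lemma minimizerP p m u g : 4 <= p -> p < 6 -> 0 < m ->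
  isH1 u g -> gJ (gsq u) = m -> Energy p u g = level p m -> is_minimizer p m u g.
Proof.
move=> p4 p6 m0 hu um uE.
have L2 : L2sq u = m%:E by rewrite L2sqE gJE ?um//; exact: isH1_fin hu.
split => //; apply/eqP; rewrite eq_le; apply/andP; split.
  apply: le_ereal_inf_tmp => _ [v [h [hv vm ->]]]; rewrite lee_fin uE.
  have vm' : gJ (gsq v) = m by rewrite /gJ -L2sqE vm.
  by rewrite -vm'; apply: level_le; rewrite ?vm'.
by apply: ereal_inf_lbound; exists u, g.
Qed.

(* On minimizers the potential term is determined by the Dirichlet term, and
   the multiplier is then increasing in the Dirichlet term. *)
Lemma Lfun_minimizer p u g : 0 < p ->
  Defs.Lfun p u g = ((p / 2 - 1) * gJ (gsq g) - p * Energy p u g) / gJ (gsq u).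
Proof.
move=> p0; rewrite /Defs.Lfun EnergyE; congr (_ / _).
rewrite -/(gJ (gpow p u)) -/(gJ (gsq g)).
by move: (gJ _) (gJ _) => D P; field; rewrite gt_eqF.
Qed.

End Coexistence.

Theorem theorem1p3 (R : realType) :
  exists pG : R, [/\ 2 < pG, pG < 6 &
    forall p : R, pG <= p -> p < 6 -> Zset p !=set0].
Proof.
exists (6 - 1 / 4000); split; [lra|lra|move=> p pG p6].
have p4 : 4 <= p by lra.
have p2 : 2 < p by lra.
have p0 : 0 < p by lra.
have d0 := gap_level_gt0 R.
have b0 : 0 < 81 / 25 :> R by rewrite divr_gt0.
have [|m [m0 mb H1 H2]] := @exists_critical_mass R p (gap_level R) (81 / 25) p4 p6 d0 b0.
  (* The bump puts the level at most at -1, so near-minimizers within 1 / 2 have energy at most -1 /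
     2, contrary to [energy_above] when the Dirichlet energy is at most d. *)
  exists (1 / 2) => // u g [hu um uE]; rewrite ltNge; apply/negP => Dd.
  have := energy_above pG (ltW p6) hu; rewrite um lexx => /(_ isT Dd) E0.
  have [v [h [hv vm vE]]] := concentrated_energy pG (ltW p6).
  have : level p (81 / 25) <= -1.
    by apply: le_trans vE; rewrite -vm; apply: level_le; rewrite ?vm.
  by move: uE E0; move: (level _ _) (Energy _ _ _) => a b; clear; lra.
have [u1 [g1 [hu1 um1 uE1 uD1]]] :=
  minimizer_of_near_min (Q := fun eps D => D <= gap_level R + eps) p4 p6 m0 H1.
have [u2 [g2 [hu2 um2 uE2 uD2]]] :=
  minimizer_of_near_min (Q := fun eps D => gap_level R - eps <= D) p4 p6 m0 H2.
have l0 := level_lt0 p4 p6 m0.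
(* The limits only give weak inequalities with d. Equality would make the energy positive, while the
   level is negative. *)
have neq u g : isH1 u g -> gJ (gsq u) = m -> Energy p u g = level p m ->
    gJ (gsq g) != gap_level R.
  move=> hu um uE; apply/eqP => DE; have := energy_gap pG (ltW p6) hu.
  by rewrite um uE => /(_ mb DE); rewrite ltNge ltW.
have D1 : gJ (gsq g1) < gap_level R.
  rewrite lt_neqAle (neq _ _ hu1 um1 uE1)/=; apply/ler_addgt0Pr => eps e0.
  have [e' [D [_ e'e DE]]] := uD1 _ (divr_gt0 e0 (ltr0n R 2)).
  move: e'e DE; move: (gap_level R) (gJ _) => a b e'e DE.
  by rewrite ler_norml => /andP[_]; clear -e'e DE; lra.
have D2 : gap_level R < gJ (gsq g2).
  rewrite lt_neqAle eq_sym (neq _ _ hu2 um2 uE2)/=; apply/ler_addgt0Pr => eps e0.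
  have [e' [D [_ e'e DE]]] := uD2 _ (divr_gt0 e0 (ltr0n R 2)).
  move: e'e DE; move: (gap_level R) (gJ _) => a b e'e DE.
  by rewrite ler_norml => /andP[+ _]; clear -e'e DE; lra.
have M1 := minimizerP p4 p6 m0 hu1 um1 uE1.
have M2 := minimizerP p4 p6 m0 hu2 um2 uE2.
exists m; split => //; first by exists u1, g1.
apply/eqP; rewrite lt_eqF//.
apply: (@le_lt_trans _ _ (Defs.Lfun p u1 g1)%:E); first by apply: ereal_inf_lbound; exists u1, g1.
apply: (@lt_le_trans _ _ (Defs.Lfun p u2 g2)%:E); last by apply: ereal_sup_ubound; exists u2, g2.
rewrite lte_fin !Lfun_minimizer// um1 um2 uE1 uE2 ltr_pM2r ?invr_gt0//.
rewrite ltrD2r ltr_pM2l ?subr_gt0 ?ltr_pdivlMr ?mul1r//.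
exact: lt_trans D1 D2.
Qed.
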